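(* Let $n\ge 2$, $0<r<1$, $Q=(0,0,\dots,0,r)\in\mathbb{C}^n$, and let $\epsilon>0$ be sufficiently small such that $B^n(Q,\epsilon)\subset\mathbb{D}^n$. Denote $A=(\partial\mathbb{D}^n_r)\setminus B^n(Q,\epsilon)$ and $D=\mathbb{D}^n\setminus A$. Then $s_D^{\mathbb{D}^n}(z)$ is not plurisubharmonic.
   Context: $\mathbb{D}^n$ is the unit polydisk in $\mathbb{C}^n$, $\mathbb{D}^n_r=\{z\in\mathbb{C}^n: |z_i|<r,\ 1\le i\le n\}$, and $B^n(p,\delta)$ is the open Euclidean ball in $\mathbb{C}^n$ with centre $p$ and radius $\delta$. For a bounded domain $D\subset\mathbb{C}^n$ and $z\in D$, the generalized squeezing function with model domain $\mathbb{D}^n$ is $$s^{\mathbb{D}^n}_D(z)=\sup\{t:\ \{w\in\mathbb{C}^n:\max_{1\le i\le n}|w_i|<t\}\subset f(D)\ \text{for some injective holomorphic } f:D\to\mathbb{D}^n\text{ with } f(z)=0\}.$$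
   Formalization: It is additionally assumed that A is nonempty (automatic for ε ≤ 2r); if r is small and ε large, the ball Bⁿ(Q,ε) in the polydisk can contain all of ∂𝔻ⁿ_r, so that D = 𝔻ⁿ and s_D ≡ 1 is plurisubharmonic. *)

(* Defs.v *)
From HB Require Import structures.
From mathcomp Require Import all_boot all_order all_algebra.
From mathcomp Require Import complex.
From mathcomp Require Import all_classical all_reals all_analysis.

Set Implicit Arguments.
Unset Strict Implicit.
Unset Printing Implicit Defensive.

Import Order.TTheory GRing.Theory Num.Theory.
Import numFieldNormedType.Exports.

Local Open Scope classical_set_scope.
Local Open Scope ring_scope.
Local Open Scope complex_scope.

HB.instance Definition _ (R : rcfType) := NormedModule.copy R[i] R[i]^o.

(* C^n is 'rV[R[i]]_n, with the normed topology of the library (max norm).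
   On R[i], `|z| is the modulus seen in R[i]; `|z| < r%:C is the real
   inequality |z| < r. *)

Definition polydisk (R : realType) (n : nat) (r : R) : set 'rV[R[i]]_n :=
  [set z | forall i, `|z 0 i| < r%:C].

Arguments polydisk {R} n r.

Definition euclidean_ball (R : realType) (n : nat) (p : 'rV[R[i]]_n) (d : R) :
    set 'rV[R[i]]_n :=
  [set z | Num.sqrt (\sum_i Normc.normc (z 0 i - p 0 i) ^+ 2) < d].

Definition boundary (T : topologicalType) (A : set T) : set T :=
  closure A `\` interior A.

(* [differentiable] is over the field R[i], hence it is complex (Frechet)
   differentiability. Meaningful for D open. *)
Definition holomorphic_on (R : realType) (m n : nat) (D : set 'rV[R[i]]_m)
    (f : 'rV[R[i]]_m -> 'rV[R[i]]_n) : Prop :=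
  forall z, D z -> differentiable f z.

(* The supremum is taken in \bar R, so that it needs no side condition. *)
Definition squeezing (R : realType) (n : nat) (D : set 'rV[R[i]]_n)
    (z : 'rV[R[i]]_n) : \bar R :=
  ereal_sup [set t%:E | t in [set t : R |
    exists f : 'rV[R[i]]_n -> 'rV[R[i]]_n,
      [/\ holomorphic_on D f,
          set_inj D f,
          f @` D `<=` polydisk n 1,
          f z = 0 &
          polydisk n t `<=` f @` D]]].

Definition usc_on (R : realType) (T : topologicalType) (D : set T)
    (u : T -> \bar R) : Prop :=
  forall x, D x -> forall a : R, (u x < a%:E)%E ->
    \forall y \near x, D y -> (u y < a%:E)%E.

Definition circle_point (R : realType) (c : R[i]) (rho t : R) : R[i] :=
  c + rho%:C * (cos t +i* sin t).

(* u takes values in [-oo, +oo[ on U; the function identically -oo is allowed.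
   The integral makes sense since u is bounded above on compact sets. *)
Definition subharmonic_on (R : realType) (U : set R[i])
    (u : R[i] -> \bar R) : Prop :=
  [/\ forall c, U c -> (u c < +oo)%E,
      usc_on U u &
      forall (c : R[i]) (rho : R), 0 < rho ->
        [set x : R[i] | `|x - c| <= rho%:C] `<=` U ->
        (u c <= ((2 * pi)^-1)%:E *
           \int[@lebesgue_measure R]_(t in `[0%R, (2 * pi)%R])
              u (circle_point c rho t))%E].

Definition plurisubharmonic_on (R : realType) (n : nat) (D : set 'rV[R[i]]_n)
    (u : 'rV[R[i]]_n -> \bar R) : Prop :=
  [/\ forall z, D z -> (u z < +oo)%E,
      usc_on D u &
      forall a b : 'rV[R[i]]_n,
        subharmonic_on [set x : R[i] | D (a + x *: b)]
          (fun x => u (a + x *: b))].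

Definition Q (R : realType) (n : nat) (r : R) : 'rV[R[i]]_n :=
  \row_(i < n) (if i.+1 == n then r%:C else 0).

Arguments Q {R} n r.

(* May be empty: if r is small compared to eps, the ball can contain the whole
   boundary of the polydisk of radius r. *)
Definition slit_set (R : realType) (n : nat) (r eps : R) : set 'rV[R[i]]_n :=
  boundary (polydisk n r) `\` euclidean_ball (Q n r) eps.

Arguments slit_set {R} n r eps.

Definition slit_polydisk (R : realType) (n : nat) (r eps : R) :
    set 'rV[R[i]]_n :=
  polydisk n 1 `\` slit_set n r eps.

Arguments slit_polydisk {R} n r eps.

(* Main.v *)
Require Import Defs.
From mathcomp Require Import all_boot all_order all_algebra.
From mathcomp Require Import complex ring lra.
From mathcomp Require Import all_classical all_reals all_analysis.
Import Order.TTheory GRing.Theory Num.Theory.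
Import numFieldNormedType.Exports.
Local Open Scope classical_set_scope.
Local Open Scope ring_scope.
Local Open Scope complex_scope.

(* For a suitable real [w0] the torus of the points [(x, ..., x, w0)] with
   [|x| = r] lies in the slit, while the disc [|x| < r] that it bounds lies in
   [D].  An injective holomorphic [f : D -> D^n] is bounded, and a Hartogs
   argument, using the slices that pass through the hole of the slit, makes it
   Lipschitz on that disc along radii, with a constant [L] that does not depend
   on [f].  If [f z = 0] for some [z = (x, ..., x, w0)] and [f(D)] contained a
   polydisk of radius [t > L (r - |x|)], the limit of [f] at the nearest torus
   point would be a value [f b] with [b] in [D]; injective holomorphic maps
   being open, points near the torus and points near [b] would share their
   images.  So the squeezing function is at most [L (r - |x|)] on the disc, while
   it is positive at the centre: the mean value inequality fails on circles of
   radius close to [r].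
   No contour integrals are used: Goursat's theorem is proved for midpoint sums
   and yields the maximum principle, from which removable singularities, limits
   of holomorphic functions and means over roots of unity follow by way of
   divided differences. *)

(** The height [w0] must put the whole torus into the slit and leave the open disc in [D]. For
    [w0 = r - sqrt b] a torus point has squared distance [(n-1) r^2 + b] from [Q n r], which forces
    [b >= eps^2 - (n-1) r^2]; asking also for [b >= r^2] gives [w0 <= 0], away from the face through
    [Q n r]. A point of the slit bounds [eps], whence [b <= 4 r^2] and [w0 >= -r]. In the extreme
    case [w0 = -r] the disc lies in the face [|w| = r], but then the torus is at distance exactly
    [eps] from [Q n r] and the disc is inside the hole. The constant [L] is a Lipschitz constant of
    the Cauchy kernel [zeta / (zeta - x)] for [|x| < r] and [|zeta| = (1 + r) / 2]; the values of
    [f] that enter are bounded by 1, so [L] ignores [f]. Openness of [f] is needed at a point [b]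
    where the Jacobian determinant is not known to be nonzero, so the inverse function theorem does
    not reach it. Hence the detour: some regular point exists by a rank argument, and Rado's lemma
    spreads the image from there. *)

Local Notation Re := complex.Re.
Local Notation Im := complex.Im.

(** * Modulus, row norm and compactness *)

Section Modulus.
Set Implicit Arguments.
Unset Strict Implicit.
Variable R : realType.
Implicit Types z w : R[i].

Definition cabs z : R := Normc.normc z.
Arguments cabs : simpl never.

Lemma normCE z : `|z| = (cabs z)%:C.
Proof. by rewrite normc_def; case: z. Qed.

Lemma cabs_ge0 z : 0 <= cabs z.
Proof. by rewrite -ler0c -normCE. Qed.

Lemma cabs0 : cabs 0 = 0.
Proof. exact: Normc.normc0. Qed.

Lemma cabs1 : cabs 1 = 1.
Proof. exact: Normc.normc1. Qed.

Lemma cabs0_eq0 z : cabs z = 0 -> z = 0.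
Proof. exact: Normc.eq0_normc. Qed.

Lemma cabs_eq0 z : (cabs z == 0) = (z == 0).
Proof. by apply/eqP/eqP => [/cabs0_eq0|->]; rewrite ?cabs0. Qed.

Lemma cabs_gt0 z : (0 < cabs z) = (z != 0).
Proof. by rewrite lt_def cabs_ge0 andbT cabs_eq0. Qed.

Lemma cabsM z w : cabs (z * w) = cabs z * cabs w.
Proof. exact: Normc.normcM. Qed.

Lemma cabsV z : cabs z^-1 = (cabs z)^-1.
Proof. exact: Normc.normcV. Qed.

Lemma cabsN z : cabs (- z) = cabs z.
Proof. exact: normcN. Qed.

Lemma cabsX z n : cabs (z ^+ n) = cabs z ^+ n.
Proof. by elim: n => [|n ih]; rewrite ?expr0 ?cabs1 // !exprS cabsM ih. Qed.

Lemma cabsD z w : cabs (z + w) <= cabs z + cabs w.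
Proof. exact: le_normcD. Qed.

Lemma cabsB z w : cabs (z - w) <= cabs z + cabs w.
Proof. by rewrite -[leRHS](congr1 (+%R _) (cabsN w)); exact: cabsD. Qed.

Lemma cabs_distC z w : cabs (z - w) = cabs (w - z).
Proof. by rewrite -cabsN opprB. Qed.

Lemma cabs_dist_ge z w : cabs z - cabs w <= cabs (z - w).
Proof. by rewrite lerBlDr; have := cabsD (z - w) w; rewrite subrK. Qed.

Lemma cabs_real (x : R) : cabs x%:C = `|x|.
Proof. by apply: complexI; rewrite -normCE normc_def /= expr0n addr0 sqrtr_sqr. Qed.

Lemma cabs_nat n : cabs n%:R = n%:R.
Proof. by rewrite -(rmorph_nat (real_complex R)) cabs_real normr_nat. Qed.

Lemma cabs_sqr z : cabs z ^+ 2 = Re z ^+ 2 + Im z ^+ 2.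
Proof.
apply: complexI; rewrite rmorphXn /= -normCE -add_Re2_Im2 //.
Qed.

Lemma cabs_Re z : `|Re z| <= cabs z.
Proof.
rewrite -(@ler_pXn2r _ 2) ?nnegrE ?cabs_ge0 // cabs_sqr real_normK ?num_real //.
by rewrite lerDl sqr_ge0.
Qed.

Lemma cabs_Im z : `|Im z| <= cabs z.
Proof.
rewrite -(@ler_pXn2r _ 2) ?nnegrE ?cabs_ge0 // cabs_sqr real_normK ?num_real //.
by rewrite lerDr sqr_ge0.
Qed.

Lemma cabs_le_ReIm z : cabs z <= `|Re z| + `|Im z|.
Proof.
rewrite -(@ler_pXn2r _ 2) ?nnegrE ?cabs_ge0 ?addr_ge0 // cabs_sqr sqrrD.
rewrite !real_normK ?num_real // -addrA [X in _ <= _ + X]addrC addrA lerDl.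
by rewrite mulrn_wge0 // mulr_ge0.
Qed.

Lemma cabs_i : cabs 'i = 1.
Proof.
apply/eqP; rewrite -(@eqrXn2 _ 2) ?cabs_ge0 ?ler01 //.
by rewrite cabs_sqr /= expr0n expr1n add0r.
Qed.

End Modulus.

Lemma ler_sum_const (R : realType) (n : nat) (F : 'I_n -> R) (e : R) :
  (forall i, F i <= e) -> \sum_i F i <= n%:R * e.
Proof.
move=> Fe; rewrite mulr_natl -[n in leRHS]card_ord -sumr_const.
by apply: ler_sum => i _; exact: Fe.
Qed.

Section RowNorm.
Set Implicit Arguments.
Unset Strict Implicit.
Variables (R : realType) (n : nat).
Implicit Types u v : 'rV[R[i]]_n.

Definition nrm v : R := \sum_i cabs (v 0 i).

Lemma nrm_ge0 v : 0 <= nrm v.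
Proof. by apply: sumr_ge0 => i _; exact: cabs_ge0. Qed.

Lemma cabs_le_nrm v i : cabs (v 0 i) <= nrm v.
Proof.
by rewrite /nrm (bigD1 i) //= lerDl sumr_ge0 // => j _; exact: cabs_ge0.
Qed.

Lemma nrm0 : nrm 0 = 0.
Proof. by rewrite /nrm big1 // => i _; rewrite mxE cabs0. Qed.

Lemma nrm0_eq0 v : nrm v = 0 -> v = 0.
Proof.
move=> v0; apply/rowP => i; rewrite mxE; apply: cabs0_eq0; apply/eqP.
by rewrite eq_le cabs_ge0 andbT -v0 cabs_le_nrm.
Qed.

Lemma nrmD u v : nrm (u + v) <= nrm u + nrm v.
Proof.
rewrite /nrm -big_split; apply: ler_sum => i _; rewrite mxE; exact: cabsD.
Qed.

Lemma nrmN v : nrm (- v) = nrm v.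
Proof. by apply: eq_bigr => i _; rewrite mxE cabsN. Qed.

Lemma nrmB u v : nrm (u - v) <= nrm u + nrm v.
Proof. by rewrite -[leRHS](congr1 (+%R _) (nrmN v)); exact: nrmD. Qed.

Lemma nrm_distC u v : nrm (u - v) = nrm (v - u).
Proof. by rewrite -nrmN opprB. Qed.

Lemma nrm_dist_ge u v : nrm u - nrm v <= nrm (u - v).
Proof. by rewrite lerBlDr; have := nrmD (u - v) v; rewrite subrK. Qed.

Lemma nrmZ (a : R[i]) v : nrm (a *: v) = cabs a * nrm v.
Proof. by rewrite /nrm mulr_sumr; apply: eq_bigr => i _; rewrite mxE cabsM. Qed.

Lemma nrm_le v (e : R) : (forall i, cabs (v 0 i) <= e) -> nrm v <= n%:R * e.
Proof.
exact: ler_sum_const.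
Qed.

Definition mnrm m (A : 'M[R[i]]_(n, m)) : R := \sum_i \sum_j cabs (A i j).

Lemma nrm_mulmx m v (A : 'M[R[i]]_(n, m)) :
  \sum_j cabs ((v *m A) 0 j) <= nrm v * mnrm A.
Proof.
apply: le_trans (_ : \sum_j \sum_i cabs (v 0 i) * cabs (A i j) <= _).
  apply: ler_sum => j _; rewrite mxE.
  elim/big_ind2: _ => [|x1 x2 y1 y2 h1 h2|i _]; rewrite ?cabs0 ?cabsM //.
  by apply: le_trans (cabsD _ _) (lerD _ _).
rewrite exchange_big /= mulr_sumr; apply: ler_sum => i _.
rewrite -mulr_sumr ler_wpM2r ?cabs_le_nrm // sumr_ge0 // => j _; exact: cabs_ge0.
Qed.

Lemma mnrm_ge0 m (A : 'M[R[i]]_(n, m)) : 0 <= mnrm A.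
Proof. by do 2![apply: sumr_ge0 => ? _]; exact: cabs_ge0. Qed.

End RowNorm.

(** * Cluster points and attained maxima *)

Section Compactness.
Set Implicit Arguments.
Unset Strict Implicit.
Variable R : realType.

Lemma bounded_cluster_real n (x : nat -> 'rV[R]_n) (B : R) :
  (forall k i, `|x k 0 i| <= B) ->
  exists p : 'rV[R]_n, forall e, 0 < e -> forall N : nat,
    exists2 k, (N <= k)%N & forall i, `|x k 0 i - p 0 i| < e.
Proof.
move=> xB.
have cK := @rV_compact R n (fun=> `[- B, B]%classic) (fun=> @segment_compact _ _ _).
have [|p [_ pcl]] := cK (x @ \oo) _.
  by exists 0%N => // k _ i /=; rewrite in_itv /= -ler_norml.
exists p => e e0 N.
have [||q [[j Nj <-]]] := pcl (x @` [set k | (N <= k)%N]) (ball p e).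
- by exists N => // k Nk /=; exists k.
- exact: nbhsx_ballx.
move=> [_ pe]; exists j => // i.
by have := pe 0 i; rewrite /ball /= distrC.
Qed.

Lemma bounded_cluster n (x : nat -> 'rV[R[i]]_n) (B : R) :
  (forall k, nrm (x k) <= B) ->
  exists p, forall e, 0 < e -> forall N : nat,
    exists2 k, (N <= k)%N & nrm (x k - p) < e.
Proof.
move=> xB.
pose y k : 'rV[R]_(n + n) := row_mx (\row_i Re (x k 0 i)) (\row_i Im (x k 0 i)).
have [|p ph] := @bounded_cluster_real _ y B.
  move=> k i; rewrite /y mxE; case: (fintype.split i) => j; rewrite mxE.
    by apply: le_trans (cabs_Re _) _; apply: le_trans (cabs_le_nrm _ _) (xB k).
  by apply: le_trans (cabs_Im _) _; apply: le_trans (cabs_le_nrm _ _) (xB k).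
exists (\row_i (p 0 (lshift n i) +i* p 0 (rshift n i))) => e e0 N.
(* The factor 2 shares the error between real and imaginary parts; [n.+1] instead of [n] keeps the
   divisor nonzero when [n = 0]. *)
have e1 : 0 < e / (2 * n.+1%:R) by rewrite divr_gt0 // mulr_gt0 ?ltr0n.
have [k Nk hk] := ph _ e1 N; exists k => //.
apply: le_lt_trans (nrm_le (e := e / n.+1%:R) _) _.
  move=> i; rewrite !mxE; apply: le_trans (cabs_le_ReIm _) _.
  have h1 := ltW (hk (lshift n i)); have h2 := ltW (hk (rshift n i)).
  rewrite /y row_mxEl mxE in h1; rewrite /y row_mxEr mxE in h2.
  apply: le_trans (_ : e / (2 * n.+1%:R) + e / (2 * n.+1%:R) <= _).
    by case: (x k 0 i) h1 h2 => a b /= h1 h2; apply: lerD.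
  have ? : n.+1%:R != 0 :> R by rewrite pnatr_eq0.
  by rewrite le_eqVlt; apply/orP; left; apply/eqP; field.
rewrite mulrA ltr_pdivrMr ?ltr0n // mulrC ltr_pM2l // ltr_nat //.
Qed.

Lemma invS_gt0 (k : nat) : 0 < (k.+1%:R : R)^-1.
Proof. by rewrite invr_gt0 ltr0n. Qed.

Lemma exists_invS_lt (e : R) : 0 < e ->
  exists N : nat, forall k, (N <= k)%N -> (k.+1%:R : R)^-1 < e.
Proof.
move=> e0; exists (Num.bound e^-1) => k Nk.
rewrite -[e]invrK ltf_pV2 ?posrE ?ltr0n ?invr_gt0 //.
have : e^-1 < (Num.bound e^-1)%:R by rewrite archi_boundP // invr_ge0 ltW.
by move=> /lt_le_trans; apply; rewrite ler_nat leqW.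
Qed.

Definition seq_closed n (K : set 'rV[R[i]]_n) :=
  forall p, (forall e, 0 < e -> exists2 q, K q & nrm (q - p) < e) -> K p.

Definition cont_in n (K : set 'rV[R[i]]_n) (u : 'rV[R[i]]_n -> R) :=
  forall p, K p -> forall e, 0 < e ->
    exists2 d, 0 < d & forall q, K q -> nrm (q - p) < d -> `|u q - u p| < e.

(** A cluster point of a maximizing sequence attains the supremum. The same extraction, applied to
    points with values above every [k], shows beforehand that the supremum is finite. *)
Lemma extreme_value n (K : set 'rV[R[i]]_n) (u : 'rV[R[i]]_n -> R) (B : R) :
  K !=set0 -> (forall p, K p -> nrm p <= B) -> seq_closed K -> cont_in K u ->
  exists2 p, K p & forall q, K q -> u q <= u p.
Proof.
move=> K0 KB Kc uc.
have lim (x : nat -> 'rV[R[i]]_n) : (forall k, K (x k)) ->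
    exists2 p, K p & forall e, 0 < e -> forall N : nat,
      exists2 k, (N <= k)%N & `|u (x k) - u p| < e.
  move=> Kx; have [p ph] := bounded_cluster (fun k => KB _ (Kx k)).
  have Kp : K p.
    by apply: Kc => e e0; have [k _ ke] := ph _ e0 0%N; exists (x k).
  exists p => // e e0 N; have [d d0 hd] := uc _ Kp _ e0.
  by have [k Nk ke] := ph _ d0 N; exists k => //; exact: hd.
have [M uM] : exists M, forall p, K p -> u p <= M.
  apply: contrapT => nM.
  have /choice[x xh] : forall k : nat, exists p, K p /\ k%:R < u p.
    move=> k; apply: contrapT => nk; apply: nM; exists k%:R => p Kp.
    by rewrite leNgt; apply/negP => kp; apply: nk; exists p.
  have [p Kp ph] := lim x (fun k => (xh k).1).
  pose N := Num.bound (`|u p| + 1).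
  have [k Nk] := ph 1 ltr01 N.
  rewrite ltr_norml => /andP[_ h].
  have h1 : `|u p| + 1 < N%:R by rewrite archi_boundP // addr_ge0.
  have h2 := (xh k).2.
  have h3 : N%:R <= k%:R :> R by rewrite ler_nat.
  have := ler_norm (u p); lra.
have us : has_sup (u @` K).
  by split; [case: K0 => p Kp; exists (u p), p|exists M => _ [p Kp <-]; exact: uM].
have /choice[x xh] : forall k : nat, exists p,
    K p /\ sup (u @` K) - k.+1%:R^-1 < u p.
  move=> k; have [_ [p Kp <-] hp] := sup_adherent (invS_gt0 k) us.
  by exists p.
have [p Kp ph] := lim x (fun k => (xh k).1).
exists p => // q Kq; apply: le_trans (_ : sup (u @` K) <= _).
  by apply: ub_le_sup; [exact: us.2|exists q].
apply/ler_addgt0Pr => e e0.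
have [N hN] := exists_invS_lt (divr_gt0 e0 (ltr0n _ 2)).
have [k Nk] := ph _ (divr_gt0 e0 (ltr0n _ 2)) N.
rewrite ltr_norml => /andP[h1 h2].
move: h1 h2 (xh k).2 (hN _ Nk).
by move: (k.+1%:R^-1) (u p) (u (x k)) (sup _) => y a b c; lra.
Qed.

End Compactness.

(** * Limits and complex derivatives *)

Section Derivative.
Set Implicit Arguments.
Unset Strict Implicit.
Variable R : realType.
Implicit Types (f g q : R[i] -> R[i]) (p z : R[i]).

(** [dist] stands for the distance to a fixed base point, so that one algebra of limits serves both
    complex numbers and rows. *)
Definition tends (T : Type) (dist : T -> R) (F : T -> R[i]) (a : R[i]) :=
  forall e, 0 < e -> exists2 d, 0 < d & forall o, dist o < d -> cabs (F o - a) < e.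

Section Tends.
Variables (T : Type) (dist : T -> R).

Lemma tends_cst a : tends dist (fun=> a) a.
Proof. by move=> e e0; exists 1 => // o _; rewrite subrr cabs0. Qed.

Lemma tendsD F G a b : tends dist F a -> tends dist G b ->
  tends dist (fun o => F o + G o) (a + b).
Proof.
move=> fp gp e e0; have e2 : 0 < e / 2 by lra.
have [d d0 hd] := fp _ e2; have [d' d'0 hd'] := gp _ e2.
exists (Num.min d d'); first by rewrite lt_min d0.
move=> o; rewrite lt_min => /andP[/hd h1 /hd' h2].
rewrite (_ : _ - _ = (F o - a) + (G o - b)); last by ring.
by apply: le_lt_trans (cabsD _ _) _; lra.
Qed.

Lemma tendsM F G a b : tends dist F a -> tends dist G b ->
  tends dist (fun o => F o * G o) (a * b).
Proof.
move=> fp gp e e0.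
pose B := cabs a + cabs b + 1.
have fp0 := cabs_ge0 a; have gp0 := cabs_ge0 b.
have B0 : 0 < B by rewrite /B; lra.
pose e' := Num.min 1 (e / (B *+ 2)).
have e'0 : 0 < e' by rewrite lt_min ltr01 divr_gt0 // mulrn_wgt0.
have [d d0 hd] := fp _ e'0; have [d' d'0 hd'] := gp _ e'0.
exists (Num.min d d'); first by rewrite lt_min d0.
move=> o; rewrite lt_min => /andP[/hd h1 /hd' h2].
rewrite (_ : _ - _ = (F o - a) * (G o - b) + (F o - a) * b + a * (G o - b)); last by ring.
have e'1 : e' <= 1 by rewrite ge_min lexx.
have e'2 : e' * B < e.
  have : e' * (B *+ 2) <= e by rewrite -ler_pdivlMr ?mulrn_wgt0 // ge_min lexx orbT.
  by rewrite mulrnAr; have := mulr_gt0 e'0 B0; lra.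
apply: le_lt_trans (cabsD _ _) _; apply: le_lt_trans (lerD (cabsD _ _) (lexx _)) _.
rewrite !cabsM; apply: le_lt_trans e'2; rewrite /B.
have u0 := cabs_ge0 (F o - a); have v0 := cabs_ge0 (G o - b).
move: (cabs (F o - a)) (cabs (G o - b)) (cabs a) (cabs b) u0 v0 fp0 gp0 h1 h2 => u v x y u0 v0 a0 b0 h1 h2.
have : u * v <= e' * 1 by apply: ler_pM => //; [exact: ltW|lra].
have : u * y <= e' * y by rewrite ler_wpM2r // ltW.
have : x * v <= x * e' by rewrite ler_wpM2l // ltW.
lra.
Qed.

Lemma tends_sum (I : Type) (r : seq I) (P : pred I) (F : I -> T -> R[i]) (a : I -> R[i]) :
  (forall i, tends dist (F i) (a i)) ->
  tends dist (fun o => \sum_(i <- r | P i) F i o) (\sum_(i <- r | P i) a i).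
Proof.
move=> Fa; elim: r => [|i r ih].
  by rewrite big_nil => e e0; exists 1 => // o _; rewrite big_nil subrr cabs0.
rewrite big_cons; case Pi : (P i).
  move=> e /(tendsD (Fa i) ih)[d d0 hd]; exists d => // o /hd.
  by rewrite big_cons Pi.
by move=> e /ih[d d0 hd]; exists d => // o /hd; rewrite big_cons Pi.
Qed.

Lemma tends_prod (I : Type) (r : seq I) (P : pred I) (F : I -> T -> R[i]) (a : I -> R[i]) :
  (forall i, tends dist (F i) (a i)) ->
  tends dist (fun o => \prod_(i <- r | P i) F i o) (\prod_(i <- r | P i) a i).
Proof.
move=> Fa; elim: r => [|i r ih].
  by rewrite big_nil => e e0; exists 1 => // o _; rewrite big_nil subrr cabs0.
rewrite big_cons; case Pi : (P i).
  move=> e /(tendsM (Fa i) ih)[d d0 hd]; exists d => // o /hd.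
  by rewrite big_cons Pi.
by move=> e /ih[d d0 hd]; exists d => // o /hd; rewrite big_cons Pi.
Qed.

End Tends.

Definition ccont f p := tends (fun z => cabs (z - p)) f (f p).

Lemma ccont_cst a p : ccont (fun=> a) p.
Proof. by move=> e e0; exists 1 => // z _; rewrite subrr cabs0. Qed.

Lemma ccont_id p : ccont id p.
Proof. by move=> e e0; exists e. Qed.

Lemma ccontD f g p : ccont f p -> ccont g p -> ccont (fun z => f z + g z) p.
Proof. exact: tendsD. Qed.

Lemma ccontM f g p : ccont f p -> ccont g p -> ccont (fun z => f z * g z) p.
Proof. exact: tendsM. Qed.

Lemma ccontN f p : ccont f p -> ccont (fun z => - f z) p.
Proof.
by move=> fp e /fp[d d0 hd]; exists d => // z /hd; rewrite -opprD cabsN.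
Qed.

Lemma ccontV f p : f p != 0 -> ccont f p -> ccont (fun z => (f z)^-1) p.
Proof.
move=> f0 fp e e0.
have a0 : 0 < cabs (f p) by rewrite cabs_gt0.
pose e' := Num.min (cabs (f p) / 2) (e * (cabs (f p) ^+ 2 / 4)).
have e'0 : 0 < e' by rewrite lt_min !(divr_gt0, mulr_gt0, exprn_gt0).
have [d d0 hd] := fp _ e'0; exists d => // z /hd h1.
have e'1 : e' <= cabs (f p) / 2 by rewrite ge_min lexx.
have e'2 : e' <= e * (cabs (f p) ^+ 2 / 4) by rewrite ge_min lexx orbT.
have h2 : cabs (f p) / 2 < cabs (f z).
  by have := cabs_dist_ge (f p) (f z); rewrite cabs_distC; lra.
have fz0 : f z != 0 by rewrite -cabs_gt0; lra.
rewrite (_ : _ - _ = (f p - f z) / (f z * f p)); last by field; rewrite fz0 f0.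
rewrite cabsM cabsV cabsM ltr_pdivrMr ?mulr_gt0 ?cabs_gt0 // cabs_distC.
move: (cabs (f z - f p)) (cabs (f z)) (cabs (f p)) h1 h2 a0 e'1 e'2 => u v a h1 h2 a0 e1 e2.
have h3 : a ^+ 2 / 2 <= v * a by rewrite expr2 mulrAC ler_pM2r // ltW.
have h4 : 0 < e * (a ^+ 2 / 4) by rewrite !(divr_gt0, mulr_gt0, exprn_gt0).
have : e * (a ^+ 2 / 2) <= e * (v * a) by rewrite ler_pM2l.
lra.
Qed.

Lemma ccont_comp f g p : ccont f p -> ccont g (f p) -> ccont (fun z => g (f z)) p.
Proof.
move=> fp gp e e0; have [d d0 hd] := gp _ e0; have [d' d'0 hd'] := fp _ d0.
by exists d' => // z /hd' /hd.
Qed.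

Lemma ccont_near f g p d : 0 < d -> (forall z, cabs (z - p) < d -> f z = g z) ->
  ccont f p -> ccont g p.
Proof.
move=> d0 fg fp e e0; have [d' d'0 hd] := fp _ e0.
exists (Num.min d d'); first by rewrite lt_min d0.
by move=> z; rewrite lt_min => /andP[z1 /hd]; rewrite !fg // subrr cabs0.
Qed.

Definition is_cderiv f p a := forall e, 0 < e -> exists2 d, 0 < d &
  forall z, cabs (z - p) < d -> cabs (f z - f p - a * (z - p)) <= e * cabs (z - p).

Definition cdiff f p := exists a, is_cderiv f p a.

(** Caratheodory's form of the derivative: the rules of calculus become algebra on the continuous
    factor [q], whose value at [p] is the derivative. *)
Lemma cdiffP f p : cdiff f p <->
  exists q, (forall z, f z = f p + q z * (z - p)) /\ ccont q p.
Proof.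
split=> [[a fa]|[q [fq qp]]].
  exists (fun z => if z == p then a else (f z - f p) / (z - p)); split=> [z|].
    case: eqVneq => [->|zp]; first by rewrite subrr mulr0 addr0.
    by rewrite divfK ?subr_eq0 // addrC subrK.
  move=> e e0; have [d d0 hd] := fa _ (divr_gt0 e0 (ltr0n _ 2)).
  exists d => // z zd; rewrite eqxx; case: eqVneq => [_|zp].
    by rewrite subrr cabs0.
  have zp0 : z - p != 0 by rewrite subr_eq0.
  rewrite (_ : _ / _ - a = (f z - f p - a * (z - p)) / (z - p)); last by field.
  rewrite cabsM cabsV ltr_pdivrMr ?cabs_gt0 //.
  apply: le_lt_trans (hd _ zd) _; rewrite ltr_pM2r ?cabs_gt0 //; lra.
exists (q p) => e e0; have [d d0 hd] := qp _ e0; exists d => // z zd.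
rewrite fq (_ : _ - _ - _ = (q z - q p) * (z - p)); last by ring.
by rewrite cabsM ler_wpM2r ?cabs_ge0 // ltW // hd.
Qed.

Lemma cdiff_cont f p : cdiff f p -> ccont f p.
Proof.
case/cdiffP => q [fq qp]; apply: (@ccont_near (fun z => f p + q z * (z - p)) _ _ 1).
- exact: ltr01.
- by move=> z _; rewrite -fq.
- apply: ccontD (ccont_cst _ _) (ccontM qp _).
  exact: ccontD (ccont_id _) (ccont_cst _ _).
Qed.

Lemma cdiff_near f g p d : 0 < d -> (forall z, cabs (z - p) < d -> f z = g z) ->
  cdiff f p -> cdiff g p.
Proof.
move=> d0 fg [a fa]; exists a => e e0; have [d' d'0 hd] := fa _ e0.
exists (Num.min d d'); first by rewrite lt_min d0.
move=> z; rewrite lt_min => /andP[z1 /hd]; rewrite !fg //.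
by rewrite subrr cabs0.
Qed.

Lemma cdiff_cst a p : cdiff (fun=> a) p.
Proof.
by apply/cdiffP; exists (fun=> 0); split=> [z|]; [ring|exact: ccont_cst].
Qed.

Lemma cdiff_id p : cdiff id p.
Proof.
by apply/cdiffP; exists (fun=> 1); split=> [z|]; [ring|exact: ccont_cst].
Qed.

Lemma cdiffD f g p : cdiff f p -> cdiff g p -> cdiff (fun z => f z + g z) p.
Proof.
move=> /cdiffP[q1 [f1 c1]] /cdiffP[q2 [f2 c2]]; apply/cdiffP.
exists (fun z => q1 z + q2 z); split; last exact: ccontD.
by move=> z; rewrite f1 f2; ring.
Qed.

Lemma cdiffN f p : cdiff f p -> cdiff (fun z => - f z) p.
Proof.
move=> /cdiffP[q1 [f1 c1]]; apply/cdiffP.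
exists (fun z => - q1 z); split; last exact: ccontN.
by move=> z; rewrite f1; ring.
Qed.

Lemma cdiffB f g p : cdiff f p -> cdiff g p -> cdiff (fun z => f z - g z) p.
Proof. by move=> fp /cdiffN; exact: cdiffD. Qed.

Lemma cdiffM f g p : cdiff f p -> cdiff g p -> cdiff (fun z => f z * g z) p.
Proof.
move=> fp gp; have cg := cdiff_cont gp.
move: fp gp => /cdiffP[q1 [f1 c1]] /cdiffP[q2 [f2 c2]]; apply/cdiffP.
exists (fun z => q1 z * g z + f p * q2 z); split; last first.
  exact: ccontD (ccontM c1 cg) (ccontM (ccont_cst _ _) c2).
by move=> z; rewrite f1 f2; ring.
Qed.

Lemma cdiffV f p : f p != 0 -> cdiff f p -> cdiff (fun z => (f z)^-1) p.
Proof.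
move=> fp0 fp; have cf := cdiff_cont fp.
have [d d0 hd] : exists2 d, 0 < d & forall z, cabs (z - p) < d -> f z != 0.
  have [|d d0 hd] := cf (cabs (f p)); first by rewrite cabs_gt0.
  by exists d => // z /hd; apply: contraTneq => ->; rewrite sub0r cabsN ltxx.
move: fp => /cdiffP[q [fq cq]].
(* The factorization must hold for every [z], but where [f] vanishes its inverse is 0 by convention.
   The function is therefore altered at the zeros of [f], which stay away from [p]. *)
apply: (@cdiff_near (fun z => if f z == 0 then (f p)^-1 - q z / (f z * f p) * (z - p) else (f z)^-1) _ _ d) => //.
  by move=> z /hd /negPf ->.
apply/cdiffP; exists (fun z => - (q z / (f z * f p))); split=> [z|].
  rewrite (negPf fp0); case: eqVneq => [->|fz0]; first by ring.
  have h : q z * (z - p) = f z - f p by rewrite [f z]fq; ring.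
  rewrite mulNr mulrAC h; field; rewrite fz0 fp0 //.
apply: ccontN; apply: ccontM => //; apply: ccontV; first by rewrite mulf_neq0.
exact: ccontM cf (ccont_cst _ _).
Qed.

Lemma cdiff_div f g p : g p != 0 -> cdiff f p -> cdiff g p ->
  cdiff (fun z => f z / g z) p.
Proof. by move=> g0 fp gp; exact: cdiffM fp (cdiffV g0 gp). Qed.

Lemma cdiffX f p n : cdiff f p -> cdiff (fun z => f z ^+ n) p.
Proof.
move=> fp; elim: n => [|n ih].
  apply: (@cdiff_near (fun=> 1) _ _ 1) => //; exact: cdiff_cst.
apply: (@cdiff_near (fun z => f z * f z ^+ n) _ _ 1) => //.
  by move=> z _; rewrite exprS.
exact: cdiffM.
Qed.

Lemma cdiff_sum (I : Type) (r : seq I) (P : pred I) (F : I -> R[i] -> R[i]) p :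
  (forall i, P i -> cdiff (F i) p) -> cdiff (fun z => \sum_(i <- r | P i) F i z) p.
Proof.
move=> Fp; elim: r => [|i r ih].
  by apply: (@cdiff_near (fun=> 0) _ _ 1); [exact: ltr01|by move=> z _; rewrite big_nil|exact: cdiff_cst].
apply: (@cdiff_near (fun z => (if P i then F i z else 0) + \sum_(j <- r | P j) F j z) _ _ 1) => //.
  by move=> z _; rewrite big_cons; case: ifP => // _; rewrite add0r.
by apply: cdiffD => //; case: (P i) (Fp i) => h; [exact: h|exact: cdiff_cst].
Qed.

Lemma cdiff_prod (I : Type) (r : seq I) (P : pred I) (F : I -> R[i] -> R[i]) p :
  (forall i, P i -> cdiff (F i) p) -> cdiff (fun z => \prod_(i <- r | P i) F i z) p.
Proof.
move=> Fp; elim: r => [|i r ih].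
  by apply: (@cdiff_near (fun=> 1) _ _ 1); [exact: ltr01|by move=> z _; rewrite big_nil|exact: cdiff_cst].
apply: (@cdiff_near (fun z => (if P i then F i z else 1) * \prod_(j <- r | P j) F j z) _ _ 1) => //.
  by move=> z _; rewrite big_cons; case: ifP => // _; rewrite mul1r.
by apply: cdiffM => //; case: (P i) (Fp i) => h; [exact: h|exact: cdiff_cst].
Qed.

Lemma cdiff_comp f g p : cdiff f p -> cdiff g (f p) -> cdiff (fun z => g (f z)) p.
Proof.
move=> fp; have cf := cdiff_cont fp; move: fp.
move=> /cdiffP[q1 [f1 c1]] /cdiffP[q2 [f2 c2]]; apply/cdiffP.
exists (fun z => q2 (f z) * q1 z); split; last exact: ccontM (ccont_comp cf c2) c1.
by move=> z; rewrite f2 [f z in X in _ * X]f1; ring.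
Qed.

Lemma cdiff_aff a b p : cdiff (fun z => a + z * b) p.
Proof. apply: cdiffD (cdiff_cst _ _) (cdiffM (cdiff_id _) (cdiff_cst _ _)). Qed.

End Derivative.

(** * Goursat's theorem with discrete contour sums *)

Section Goursat.
Set Implicit Arguments.
Unset Strict Implicit.
Variable R : realType.
Implicit Types (f g : R[i] -> R[i]) (p u v z c : R[i]) (s t : R).

(* The midpoint Riemann sum of [f dz] over the segment from [p] to [p + u]
   with [2 ^ k] pieces. *)
Fixpoint segsum f p u k : R[i] :=
  if k is k'.+1 then
    segsum f p (u / 2) k' + segsum f (p + u / 2) (u / 2) k'
  else u * f (p + u / 2).

Lemma segsumD f g p u k :
  segsum (fun z => f z + g z) p u k = segsum f p u k + segsum g p u k.
Proof. by elim: k p u => [|k ih] p u /=; rewrite ?ih; ring. Qed.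

Lemma segsumZ a f p u k :
  segsum (fun z => a * f z) p u k = a * segsum f p u k.
Proof. by elim: k p u => [|k ih] p u /=; rewrite ?ih; ring. Qed.

Lemma half_half u : u / 2 + u / 2 = u.
Proof. by field. Qed.

(** The midpoint rule is exact on affine functions, for every [k]; hence contour sums of affine
    functions vanish without a limit. *)
Lemma segsum_aff a b p u k :
  segsum (fun z => a + b * z) p u k = a * u + b * u * (p + u / 2).
Proof. by elim: k p u => [|k ih] p u /=; rewrite ?ih; field. Qed.

Lemma segsum_rev f p u k : segsum f (p + u) (- u) k = - segsum f p u k.
Proof.
elim: k p u => [|k ih] p u /=.
  by rewrite (_ : p + u + _ = p + u / 2) ?mulNr //; field.
rewrite mulNr (_ : p + u - u / 2 = p + u / 2); last by field.
rewrite -{1}(half_half u) addrA !ih opprD; exact: addrC.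
Qed.

Definition segm p u z := exists2 t, 0 <= t <= 1 & z = p + t%:C * u.

Lemma segm_l p u z : segm p (u / 2) z -> segm p u z.
Proof.
case=> t /andP[t0 t1] ->; exists (t / 2); first by apply/andP; split; lra.
by rewrite rmorphM fmorphV /= rmorph_nat; field.
Qed.

Lemma segm_r p u z : segm (p + u / 2) (u / 2) z -> segm p u z.
Proof.
case=> t /andP[t0 t1] ->; exists (1 / 2 + t / 2); first by apply/andP; split; lra.
by rewrite rmorphD !rmorphM fmorphV /= rmorph1 rmorph_nat; field.
Qed.

Lemma segm_mid p u : segm p u (p + u / 2).
Proof.
exists (1 / 2); first by apply/andP; split; lra.
by rewrite rmorphM fmorphV /= rmorph1 rmorph_nat; field.
Qed.

Lemma eq_segsum f g p u k : (forall z, segm p u z -> f z = g z) ->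
  segsum f p u k = segsum g p u k.
Proof.
elim: k p u => [|k ih] p u fg /=; first by rewrite fg //; exact: segm_mid.
by rewrite !ih // => z h; apply: fg; [exact: segm_r|exact: segm_l].
Qed.

Lemma cabs_half u : cabs (u / 2) = cabs u / 2.
Proof. by rewrite cabsM cabsV cabs_nat. Qed.

Lemma segsum_le f p u k (m : R) : (forall z, segm p u z -> cabs (f z) <= m) ->
  cabs (segsum f p u k) <= cabs u * m.
Proof.
elim: k p u => [|k ih] p u fm /=.
  by rewrite cabsM ler_wpM2l ?cabs_ge0 //; apply: fm; exact: segm_mid.
apply: le_trans (cabsD _ _) _.
have h1 := ih p (u / 2) (fun z h => fm _ (segm_l h)).
have h2 := ih (p + u / 2) (u / 2) (fun z h => fm _ (segm_r h)).
apply: le_trans (lerD h1 h2) _.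
by rewrite cabs_half; lra.
Qed.

(** Meant for [f z = 1 / (z - c)]: a pointwise lower bound on the imaginary part of [f dz] takes the
    place of the exact value [2 pi i] of the contour integral. *)
Lemma segsum_Im_ge f p u k (m : R) : (forall z, segm p u z -> m <= Im (u * f z)) ->
  m <= Im (segsum f p u k).
Proof.
elim: k p u m => [|k ih] p u m fm /=; first by apply: fm; exact: segm_mid.
have half z : Im (u / 2 * f z) = Im (u * f z) / 2.
  have -> : u / 2 * f z = 2^-1%:C * (u * f z).
    by rewrite fmorphV rmorph_nat; ring.
  by case: (u * f z) => a b /=; rewrite mul0r addr0 mulrC.
rewrite raddfD /=.
have h1 := ih p (u / 2) (m / 2); have h2 := ih (p + u / 2) (u / 2) (m / 2).
rewrite (_ : m = m / 2 + m / 2); last by field.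
apply: lerD.
  by apply: h1 => z /segm_l /fm h; rewrite half; lra.
by apply: h2 => z /segm_r /fm h; rewrite half; lra.
Qed.

Definition parsum f p u v k :=
  segsum f p u k + segsum f (p + u) v k - segsum f (p + v) u k - segsum f p v k.

(** Inner edges of the quarters are traversed twice, in opposite directions. Each outer side is cut
    in two, which uses up one level of [k]. *)
Lemma parsum_split f p u v k :
  parsum f p u v k.+1 =
    parsum f p (u / 2) (v / 2) k + parsum f (p + u / 2) (u / 2) (v / 2) k
    + parsum f (p + v / 2) (u / 2) (v / 2) k
    + parsum f (p + u / 2 + v / 2) (u / 2) (v / 2) k.
Proof.
rewrite /parsum /=.
rewrite (_ : p + u / 2 + u / 2 = p + u); last by rewrite -addrA half_half.
rewrite (_ : p + v / 2 + v / 2 = p + v); last by rewrite -addrA half_half.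
rewrite (_ : p + v / 2 + u / 2 = p + u / 2 + v / 2); last by rewrite addrAC.
rewrite (_ : p + u / 2 + v / 2 + u / 2 = p + u + v / 2); last first.
  by rewrite addrAC -(addrA p (u / 2)) half_half.
rewrite (_ : p + u / 2 + v / 2 + v / 2 = p + v + u / 2); last first.
  by rewrite -addrA half_half addrAC.
ring.
Qed.

Definition par p u v z :=
  exists s t, [/\ 0 <= s <= 1, 0 <= t <= 1 & z = p + s%:C * u + t%:C * v].

Lemma par_bottom p u v z : segm p u z -> par p u v z.
Proof. by case=> t t1 ->; exists t, 0; split; rewrite ?lexx ?ler01 // mul0r addr0. Qed.
Lemma par_left p u v z : segm p v z -> par p u v z.
Proof. by case=> t t1 ->; exists 0, t; split; rewrite ?lexx ?ler01 // mul0r addr0. Qed.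
Lemma par_right p u v z : segm (p + u) v z -> par p u v z.
Proof. by case=> t t1 ->; exists 1, t; split; rewrite ?lexx ?ler01 // mul1r. Qed.
Lemma par_top p u v z : segm (p + v) u z -> par p u v z.
Proof.
by case=> t t1 ->; exists t, 1; split; rewrite ?lexx ?ler01 // mul1r addrAC.
Qed.

Lemma parsum_le f p u v k (m : R) : (forall z, par p u v z -> cabs (f z) <= m) ->
  cabs (parsum f p u v k) <= (cabs u + cabs v) * m *+ 2.
Proof.
move=> fm; rewrite /parsum.
have h1 := @segsum_le f p u k m (fun z h => fm z (@par_bottom _ _ v _ h)).
have h2 := @segsum_le f p v k m (fun z h => fm z (@par_left _ u _ _ h)).
have h3 := @segsum_le f (p + u) v k m (fun z h => fm z (par_right h)).
have h4 := @segsum_le f (p + v) u k m (fun z h => fm z (par_top h)).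
apply: le_trans (cabsB _ _) _; apply: le_trans (lerD (cabsB _ _) (lexx _)) _.
apply: le_trans (lerD (lerD (cabsD _ _) (lexx _)) (lexx _)) _; lra.
Qed.

Lemma eq_parsum f g p u v k : (forall z, par p u v z -> f z = g z) ->
  parsum f p u v k = parsum g p u v k.
Proof.
move=> fg; rewrite /parsum; congr (_ + _ - _ - _); apply: eq_segsum => z h; apply: fg.
- exact: par_bottom.
- exact: par_right.
- exact: par_top.
- exact: par_left.
Qed.

Lemma parsumD f g p u v k :
  parsum (fun z => f z + g z) p u v k = parsum f p u v k + parsum g p u v k.
Proof. by rewrite /parsum !segsumD; ring. Qed.

Lemma parsumZ a f p u v k :
  parsum (fun z => a * f z) p u v k = a * parsum f p u v k.
Proof. by rewrite /parsum !segsumZ; ring. Qed.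

Lemma parsum_aff a b p u v k : parsum (fun z => a + b * z) p u v k = 0.
Proof. by rewrite /parsum !segsum_aff; field. Qed.

Definition par_to0 f p u v := forall e : R, 0 < e ->
  exists N : nat, forall k, (N <= k)%N -> cabs (parsum f p u v k) <= e.

Definition par_bad f p u v (e : R) := forall N : nat,
  exists2 k, (N <= k)%N & e < cabs (parsum f p u v k).

Lemma par_to0_split f p u v :
  par_to0 f p (u / 2) (v / 2) -> par_to0 f (p + u / 2) (u / 2) (v / 2) ->
  par_to0 f (p + v / 2) (u / 2) (v / 2) ->
  par_to0 f (p + u / 2 + v / 2) (u / 2) (v / 2) -> par_to0 f p u v.
Proof.
move=> h1 h2 h3 h4 e e0; have e4 : 0 < e / 4 by lra.
have [N1 k1] := h1 _ e4; have [N2 k2] := h2 _ e4.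
have [N3 k3] := h3 _ e4; have [N4 k4] := h4 _ e4.
exists (maxn (maxn N1 N2) (maxn N3 N4)).+1 => -[//|k].
rewrite ltnS !geq_max => /andP[/andP[/k1 {}k1 /k2 {}k2] /andP[/k3 {}k3 /k4 {}k4]].
rewrite parsum_split.
apply: le_trans (cabsD _ _) _; apply: le_trans (lerD (cabsD _ _) (lexx _)) _.
apply: le_trans (lerD (lerD (cabsD _ _) (lexx _)) (lexx _)) _; lra.
Qed.

(** Pigeonhole: were all quarters eventually at most [e / 4], the whole would eventually be at most
    [e]. The pair of booleans names the quarter. *)
Lemma par_bad_split f p u v e : par_bad f p u v e ->
  exists b : bool * bool,
    par_bad f (p + b.1%:R%:C * (u / 2) + b.2%:R%:C * (v / 2)) (u / 2) (v / 2) (e / 4).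
Proof.
move=> bad; apply: contrapT => nb.
have good (b : bool * bool) : exists N : nat, forall k, (N <= k)%N ->
    cabs (parsum f (p + b.1%:R%:C * (u / 2) + b.2%:R%:C * (v / 2)) (u / 2) (v / 2) k) <= e / 4.
  apply: contrapT => ng; apply: nb; exists b => N.
  apply: contrapT => nk; apply: ng; exists N => k Nk.
  by rewrite leNgt; apply/negP => ek; apply: nk; exists k.
have [N1 k1] := good (false, false); have [N2 k2] := good (true, false).
have [N3 k3] := good (false, true); have [N4 k4] := good (true, true).
move: k1 k2 k3 k4; rewrite /= !(mul0r, mul1r, addr0) => k1 k2 k3 k4.
have [[//|k]] := bad (maxn (maxn N1 N2) (maxn N3 N4)).+1.
rewrite ltnS !geq_max => /andP[/andP[/k1 {}k1 /k2 {}k2] /andP[/k3 {}k3 /k4 {}k4]].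
rewrite parsum_split ltNge => /negP; apply.
apply: le_trans (cabsD _ _) _; apply: le_trans (lerD (cabsD _ _) (lexx _)) _.
apply: le_trans (lerD (lerD (cabsD _ _) (lexx _)) (lexx _)) _; lra.
Qed.

Lemma nested_sup (s : nat -> R) :
  (forall m, s m <= s m.+1 <= s m + (2 ^+ m.+1)^-1) ->
  exists l, forall m, s m <= l <= s m + (2 ^+ m)^-1.
Proof.
move=> h.
have mono m j : s m <= s (m + j)%N.
  elim: j => [|j ih]; rewrite ?addn0 // addnS.
  by apply: le_trans ih _; case/andP: (h (m + j)%N).
have ub m j : s (m + j)%N + (2 ^+ (m + j))^-1 <= s m + (2 ^+ m)^-1.
  elim: j => [|j ih]; rewrite ?addn0 // addnS; apply: le_trans _ ih.
  case/andP: (h (m + j)%N) => _; rewrite exprS invfM.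
  by move: (2 ^+ _)^-1 => x; lra.
have pos m : 0 <= (2 ^+ m : R)^-1 by rewrite invr_ge0 exprn_ge0.
have bd m k : s k <= s m + (2 ^+ m)^-1.
  case: (leqP m k) => mk.
    by have := ub m (k - m)%N; rewrite subnKC //; apply: le_trans; rewrite lerDl.
  have := mono k (m - k)%N; rewrite subnKC; last exact: ltnW.
  by move/le_trans; apply; rewrite lerDl.
exists (sup (range s)) => m; apply/andP; split.
  apply: ub_le_sup; last by exists m.
  by exists (s 0%N + (2 ^+ 0)^-1) => _ [k _ <-]; exact: bd.
apply: ge_sup; first by exists (s 0%N), 0%N.
by move=> _ [k _ <-]; exact: bd.
Qed.

(** Goursat's bisection: badness passes from a parallelogram to one of its quarters with [e / 4],
    and differentiability at the common point of the nested parallelograms makes their contour sums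
    too small for that. *)
Lemma goursat f p u v : (forall z, par p u v z -> cdiff f z) -> par_to0 f p u v.
Proof.
move=> fd e e0; apply: contrapT => ne.
(* Corners are recorded by real coordinates along [u] and [v], so the common point comes from two
   nested sequences of real intervals, even if [u] and [v] are parallel. *)
pose pt (x : R * R) := p + x.1%:C * u + x.2%:C * v.
have bad0 : par_bad f p u v e.
  move=> N; apply: contrapT => nk; apply: ne; exists N => k Nk.
  by rewrite leNgt; apply/negP => ek; apply: nk; exists k.
pose sc m : R[i] := (2 ^+ m)^-1.
pose bad m x := par_bad f (pt x) (u * sc m) (v * sc m) (e / 4 ^+ m).
have step m (x : R * R) : exists b : bool * bool, bad m x -> 
    bad m.+1 (x.1 + b.1%:R / 2 ^+ m.+1, x.2 + b.2%:R / 2 ^+ m.+1).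
  have [bx|nbx] := pselect (bad m x); last by exists (true, true).
  have [b hb] := par_bad_split bx; exists b => _; rewrite /bad.
  have sE : sc m / 2 = sc m.+1 by rewrite /sc exprS invfM mulrC.
  rewrite (_ : pt _ = pt x + b.1%:R%:C * (u * sc m / 2) + b.2%:R%:C * (v * sc m / 2)).
    rewrite -!sE !mulrA (_ : e / 4 ^+ m.+1 = e / 4 ^+ m / 4); last first.
      by rewrite exprS invfM [X in e * X]mulrC mulrA.
    by move: hb; rewrite !mulrA.
  rewrite /pt /= !rmorphD !rmorphM !fmorphV /= !rmorphXn /= !rmorph_nat.
  by rewrite /sc exprS !invfM; ring.
have [b hb] : exists b : nat * (R * R) -> bool * bool, forall m x, bad m x ->
    bad m.+1 (x.1 + (b (m, x)).1%:R / 2 ^+ m.+1, x.2 + (b (m, x)).2%:R / 2 ^+ m.+1).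
  have /choice[b hb] : forall mx : nat * (R * R), exists b : bool * bool,
      bad mx.1 mx.2 -> bad mx.1.+1 (mx.2.1 + b.1%:R / 2 ^+ mx.1.+1, mx.2.2 + b.2%:R / 2 ^+ mx.1.+1).
    by move=> mx; exact: step.
  by exists b => m x; exact: (hb (m, x)).
pose fix xs m : R * R := if m is m'.+1 then
  ((xs m').1 + (b (m', xs m')).1%:R / 2 ^+ m,
   (xs m').2 + (b (m', xs m')).2%:R / 2 ^+ m) else (0, 0).
have badx m : bad m (xs m).
  elim: m => [|m ih]; last exact: hb.
  rewrite /bad /sc !expr0 invr1 !mulr1 divr1 /pt /= !mul0r !addr0 //.
have b01 (c : bool) m : 0 <= (c%:R / 2 ^+ m : R) <= (2 ^+ m)^-1.
  rewrite divr_ge0 ?exprn_ge0 ?ler0n //= ler_piMl ?invr_ge0 ?exprn_ge0 //.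
  by case: c; rewrite /= ?ler01.
have [s hs] : exists l, forall m, (xs m).1 <= l <= (xs m).1 + (2 ^+ m)^-1.
  by apply: nested_sup => m /=; rewrite lerDl lerD2l.
have [t ht] : exists l, forall m, (xs m).2 <= l <= (xs m).2 + (2 ^+ m)^-1.
  by apply: nested_sup => m /=; rewrite lerDl lerD2l.
pose q := pt (s, t).
have pq : par p u v q.
  exists s, t; split=> //.
    by have := hs 0%N; rewrite /= expr0 invr1 add0r.
  by have := ht 0%N; rewrite /= expr0 invr1 add0r.
have [a fa] := fd q pq.
pose L := cabs u + cabs v.
have L0 : 0 <= L by rewrite addr_ge0 ?cabs_ge0.
(* At level [m], with [S = 2^-m], the sum is at most [2 e1 (L S)^2], to be compared with [e S^2].
   The added 1 covers [L = 0]. *)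
pose e1 := e / (L ^+ 2 + 1) / 4.
have L1 : 0 < L ^+ 2 + 1 by rewrite ltr_wpDl // sqr_ge0.
have e10 : 0 < e1 by rewrite !divr_gt0.
have [d d0 hd] := fa _ e10.
have [m md] : exists m : nat, L * (2 ^+ m)^-1 < d.
  have [N hN] := exists_invS_lt (divr_gt0 d0 (ltr_wpDl L0 ltr01)).
  exists N.
  have h1 := hN N (leqnn _).
  have h2 : (2 ^+ N : R)^-1 <= N.+1%:R^-1.
    by rewrite lef_pV2 ?posrE ?ltr0n ?exprn_gt0 // -natrX ler_nat ltn_expl.
  have h3 := le_lt_trans h2 h1.
  have h4 : (2 ^+ N : R)^-1 * (L + 1) < d by rewrite -ltr_pdivlMr // ltr_wpDl.
  apply: le_lt_trans h4; rewrite mulrC ler_wpM2l ?invr_ge0 ?exprn_ge0 //; lra.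
pose S := (2 ^+ m : R)^-1.
have S0 : 0 < S by rewrite invr_gt0 exprn_gt0.
have scE : sc m = S%:C by rewrite /sc /S fmorphV rmorphXn /= rmorph_nat.
have cS : cabs (sc m) = S by rewrite scE cabs_real ger0_norm // ltW.
have close z : par (pt (xs m)) (u * sc m) (v * sc m) z -> cabs (z - q) <= L * S.
  case=> s' [t' [s'1 t'1 ->]].
  rewrite (_ : _ - q = ((xs m).1 + s' * S - s)%:C * u + ((xs m).2 + t' * S - t)%:C * v); last first.
    by rewrite /q /pt scE /= !rmorphB !rmorphD !rmorphM /=; ring.
  have aux (x y y' : R) : 0 <= y <= 1 -> x <= y' <= x + S -> `|x + y * S - y'| <= S.
    move=> /andP[y0 y1] /andP[h1 h2]; rewrite ler_norml.
    have h3 : 0 <= y * S by rewrite mulr_ge0 // ltW.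
    have h4 : y * S <= S by rewrite ler_piMl // ltW.
    by apply/andP; split; lra.
  apply: le_trans (cabsD _ _) _; rewrite !cabsM !cabs_real /L mulrDl.
  apply: lerD; rewrite mulrC ler_wpM2l ?cabs_ge0 //; apply: aux => //.
have [k _] := badx m 0%N.
rewrite ltNge => /negP; apply.
(* The first-order expansion at [q]: its affine part contributes exactly 0, and only the remainder
   is left to estimate. *)
rewrite (@eq_parsum _ (fun z => (f q - a * q + a * z) + (f z - f q - a * (z - q)))); last first.
  by move=> z _; ring.
rewrite parsumD parsum_aff add0r.
have rem z : par (pt (xs m)) (u * sc m) (v * sc m) z ->
    cabs (f z - f q - a * (z - q)) <= e1 * (L * S).
  move=> /close hz; apply: le_trans (hd _ (le_lt_trans hz md)) _.
  by rewrite ler_wpM2l // ltW.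
apply: le_trans (parsum_le k rem) _.
rewrite !cabsM cS -mulrDl -/L.
have -> : 4 ^+ m = (2 ^+ m) ^+ 2 :> R by rewrite exprAC (_ : 2 ^+ 2 = 4 :> R) //; ring.
rewrite -[2 ^+ m]invrK -/S exprVn invrK /e1.
have -> : L * S * (e / (L ^+ 2 + 1) / 4 * (L * S)) *+ 2 = e * S ^+ 2 * (L ^+ 2 / (L ^+ 2 + 1)) / 2.
  by field; rewrite gt_eqF.
have h : L ^+ 2 / (L ^+ 2 + 1) <= 1 by rewrite ler_pdivrMr // mul1r lerDl ler01.
have h0 : 0 < e * S ^+ 2 by rewrite mulr_gt0 // exprn_gt0.
have := ler_wpM2l (ltW h0) h; lra.
Qed.

End Goursat.

(** * The maximum principle *)

Section MaximumPrinciple.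
Set Implicit Arguments.
Unset Strict Implicit.
Variable R : realType.
Implicit Types (f g : R[i] -> R[i]) (p u v z c w : R[i]) (s t : R).

(** Bisection leaves only one quarter outside the reach of Goursat's theorem, the one at [p]. Near
    [p] the function is bounded, so the sum over that quarter is at most a constant times its
    perimeter. *)
Lemma goursat_corner f p u v (m d : R) : 0 < d ->
  (forall z, cabs (z - p) < d -> cabs (f z) <= m) ->
  (forall s t, 0 <= s <= 1 -> 0 <= t <= 1 -> (0 < s) || (0 < t) ->
     cdiff f (p + s%:C * u + t%:C * v)) ->
  par_to0 f p u v.
Proof.
move=> d0 fm fd e e0.
have m0 : 0 <= m by apply: le_trans (cabs_ge0 _) (fm p _); rewrite subrr cabs0.
have [j jd] : exists j : nat, (cabs u + cabs v) * (2 ^+ j)^-1 < Num.min d (e / 4 / (m + 1)).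
  set L := cabs u + cabs v; set D := Num.min _ _.
  have L0 : 0 <= L by rewrite addr_ge0 ?cabs_ge0.
  have D0 : 0 < D by rewrite lt_min d0 /= !divr_gt0 //; lra.
  have [N hN] := exists_invS_lt (divr_gt0 D0 (ltr_wpDl L0 ltr01)).
  exists N; have h : (2 ^+ N : R)^-1 < D / (L + 1).
    apply: le_lt_trans _ (hN N (leqnn _)).
    by rewrite lef_pV2 ?posrE ?ltr0n ?exprn_gt0 // -natrX ler_nat ltn_expl.
  rewrite ltr_pdivlMr in h; last by rewrite ltr_wpDl.
  apply: le_lt_trans h; rewrite mulrC ler_wpM2l ?invr_ge0 ?exprn_ge0 //; lra.
move: jd; rewrite lt_min => /andP[jd jm].
(* Induction on the number [j] of bisections. The slack [r] is shared equally by the four quarters,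
   while the term [e / 2] is passed on to the corner quarter alone. *)
have : forall r, 0 < r -> exists N : nat, forall k, (N <= k)%N ->
    cabs (parsum f p u v k) <= e / 2 + r.
  elim: j u v fd jd jm => [|j ih] u v fd jd jm r r0.
    exists 0%N => k _.
    have fm' z : par p u v z -> cabs (f z) <= m.
      move=> [s [t [/andP[s0 s1] /andP[t0 t1] ->]]]; apply: fm.
      rewrite (_ : _ - p = s%:C * u + t%:C * v); last by ring.
      apply: le_lt_trans (cabsD _ _) _.
      rewrite !cabsM !cabs_real !ger0_norm //.
      have := ler_piMl (cabs_ge0 u) s1; have := ler_piMl (cabs_ge0 v) t1.
      by move: jd; rewrite expr0; lra.
    apply: le_trans (parsum_le _ fm') _.
    move: jm; rewrite expr0 invr1 mulr1 ltr_pdivlMr; last by lra.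
    rewrite mulrDr mulr1.
    have := mulr_ge0 (addr_ge0 (cabs_ge0 u) (cabs_ge0 v)) m0.
    by have := cabs_ge0 u; have := cabs_ge0 v; lra.
  have scl (x : R) : 0 <= x <= 1 -> 0 <= x / 2 <= 1.
    by move=> /andP[? ?]; apply/andP; split; lra.
  have scl2 (x : R) : 0 <= x <= 1 -> 0 < 1 / 2 + x / 2 <= 1.
    by move=> /andP[? ?]; apply/andP; split; lra.
  have scl2' (x : R) : 0 <= x <= 1 -> 0 <= 1 / 2 + x / 2 <= 1.
    by move=> /scl2 /andP[? ?]; apply/andP; split; lra.
  have C2 (x : R) : (x / 2)%:C = x%:C / 2 by rewrite rmorphM fmorphV rmorph_nat.
  have C12 (x : R) : (1 / 2 + x / 2)%:C = 1 / 2 + x%:C / 2.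
    by rewrite rmorphD /= !C2 rmorph1.
  have L2 : (cabs (u / 2) + cabs (v / 2)) * (2 ^+ j)^-1
      = (cabs u + cabs v) * (2 ^+ j.+1)^-1.
    by rewrite !cabs_half exprS invfM; ring.
  have r4 : 0 < r / 4 by lra.
  have [|||N1 k1] := ih (u / 2) (v / 2) _ _ _ _ r4; rewrite ?L2 //.
    move=> s t s1 t1 st.
    rewrite (_ : _ + _ = p + (s / 2)%:C * u + (t / 2)%:C * v); last first.
      by rewrite !C2; ring.
    by apply: fd; [exact: scl|exact: scl|case/orP: st => ?; apply/orP; [left|right]; lra].
  have [|N2 k2] := @goursat _ f (p + u / 2) (u / 2) (v / 2) _ _ r4.
    move=> _ [s [t [s1 t1 ->]]].
    rewrite (_ : _ + _ = p + (1 / 2 + s / 2)%:C * u + (t / 2)%:C * v); last first.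
      by rewrite C12 C2; ring.
    by apply: fd; [exact: scl2'|exact: scl|case/scl2/andP: s1 => ->].
  have [|N3 k3] := @goursat _ f (p + v / 2) (u / 2) (v / 2) _ _ r4.
    move=> _ [s [t [s1 t1 ->]]].
    rewrite (_ : _ + _ = p + (s / 2)%:C * u + (1 / 2 + t / 2)%:C * v); last first.
      by rewrite C12 C2; ring.
    by apply: fd; [exact: scl|exact: scl2'|case/scl2/andP: t1 => ->; rewrite orbT].
  have [|N4 k4] := @goursat _ f (p + u / 2 + v / 2) (u / 2) (v / 2) _ _ r4.
    move=> _ [s [t [s1 t1 ->]]].
    rewrite (_ : _ + _ = p + (1 / 2 + s / 2)%:C * u + (1 / 2 + t / 2)%:C * v); last first.
      by rewrite !C12; ring.
    by apply: fd; [exact: scl2'|exact: scl2'|case/scl2/andP: s1 => ->].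
  exists (maxn (maxn N1 N2) (maxn N3 N4)).+1 => -[//|k].
  rewrite ltnS !geq_max => /andP[/andP[/k1 {}k1 /k2 {}k2] /andP[/k3 {}k3 /k4 {}k4]].
  rewrite parsum_split.
  apply: le_trans (cabsD _ _) _; apply: le_trans (lerD (cabsD _ _) (lexx _)) _.
  apply: le_trans (lerD (lerD (cabsD _ _) (lexx _)) (lexx _)) _; lra.
have e2 : 0 < e / 2 by lra.
by move=> /(_ _ e2)[N hN]; exists N => k /hN; lra.
Qed.

Lemma par_to0_flip_u f p u v : par_to0 f (p + u) (- u) v -> par_to0 f p u v.
Proof.
move=> h e /h[N hN]; exists N => k /hN; congr (_ <= _).
rewrite -cabsN; congr cabs.
rewrite /parsum addrK segsum_rev (_ : p + u + v = p + v + u) ?segsum_rev; ring.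
Qed.

Lemma par_to0_flip_v f p u v : par_to0 f (p + v) u (- v) -> par_to0 f p u v.
Proof.
move=> h e /h[N hN]; exists N => k /hN; congr (_ <= _).
rewrite -cabsN; congr cabs.
rewrite /parsum addrK segsum_rev (_ : p + v + u = p + u + v) ?segsum_rev; ring.
Qed.

(** For [w] equal to 1, i, -1, -i these are the sides of the square with centre [c] and side [2 l],
    traversed in order. Each contributes [i pi / 2] to the integral of [1 / (z - c)]; the pointwise
    bound by 1 is cruder but suffices. *)
Lemma side_point c w (l : R) z : 0 < l -> cabs w = 1 ->
  segm (c + w * l%:C * (- 1 - 'i)) (w * (2 * l)%:C) z ->
  [/\ l <= cabs (z - c) <= 2 * l & 1 <= Im (w * (2 * l)%:C * (z - c)^-1)].
Proof.
move=> l0 w1 [t /andP[t0 t1] ->].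
pose y : R[i] := (2 * t - 1) +i* (- 1).
have yE : c + w * l%:C * (- 1 - 'i) + t%:C * (w * (2 * l)%:C) - c = w * l%:C * y.
  have -> : y = (2 * t - 1)%:C - 'i.
    by rewrite /y; apply/eqP; rewrite eq_complex /= !(oppr0, addr0, add0r) !eqxx.
  by rewrite rmorphB !rmorphM /= rmorph1 !rmorph_nat; ring.
have y2 : cabs y ^+ 2 = (2 * t - 1) ^+ 2 + 1 by rewrite cabs_sqr /= sqrrN expr1n.
have yy : 0 <= (2 * t - 1) ^+ 2 <= 1.
  have h : 0 <= t * (1 - t) by rewrite mulr_ge0 // subr_ge0.
  by rewrite sqr_ge0 /=; lra.
have y0 : 0 < cabs y.
  rewrite lt_def cabs_ge0 andbT; apply/eqP => y00.
  by move: y2; rewrite y00 expr0n /=; lra.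
have cy : 1 <= cabs y <= 2.
  rewrite -(@ler_pXn2r _ 2) ?nnegrE ?ler01 ?cabs_ge0 // -(@ler_pXn2r _ 2 _ (cabs y) 2) ?nnegrE ?cabs_ge0 //.
  by rewrite y2 expr1n; apply/andP; split; lra.
rewrite yE; split.
  rewrite !cabsM w1 mul1r cabs_real gtr0_norm //.
  have /andP[h1 h2] := cy; apply/andP; split.
    by rewrite ler_pMr.
  by rewrite mulrC ler_pM2r.
have w0 : w != 0 by rewrite -cabs_gt0 w1.
have lc0 : l%:C != 0 by rewrite -cabs_gt0 cabs_real normr_gt0 gt_eqF.
have yc0 : y != 0 by rewrite -cabs_gt0.
rewrite (_ : _ * _ * _ = 2 * y^-1); last first.
  by rewrite rmorphM rmorph_nat; field; rewrite yc0 lc0 w0.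
have -> : y^-1 = ((2 * t - 1) / cabs y ^+ 2) +i* (cabs y ^+ 2)^-1.
  apply: (mulfI yc0); rewrite mulfV //; apply/eqP; rewrite eq_complex /= y2.
  by apply/andP; split; apply/eqP; field; rewrite gt_eqF //; lra.
rewrite -(rmorph_nat (real_complex R)) /= mul0r addr0 y2.
by rewrite ler_pdivlMr; lra.
Qed.

(** The power trick: a multiplicative constant that does not depend on [n] disappears in the [n]-th
    root. The growth comes from Bernoulli's inequality. *)
Lemma pow_bound (a M C : R) : 0 <= M -> (forall n, a ^+ n <= C * M ^+ n) -> a <= M.
Proof.
move=> M0 h; rewrite leNgt; apply/negP => Ma.
have a0 : 0 < a by exact: le_lt_trans Ma.
have [M00|Mn0] := eqVneq M 0.
  by have := h 1%N; rewrite M00 !expr1 mulr0 leNgt a0.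
have Mp : 0 < M by rewrite lt_def Mn0.
pose x := a / M - 1.
have x0 : 0 < x by rewrite subr_gt0 ltr_pdivlMr // mul1r.
have xn n : 1 + n%:R * x <= (1 + x) ^+ n.
  elim: n => [|n ih]; first by rewrite mul0r addr0 expr0.
  rewrite exprS; have := ler_wpM2l (ltW (ltr_wpDl ler01 x0)) ih.
  have : 0 <= n%:R * (x * x) by rewrite !mulr_ge0 // ltW.
  by rewrite -natr1; lra.
have C1 n : 1 + n%:R * x <= C.
  apply: le_trans (xn n) _; rewrite /x addrC subrK expr_div_n ler_pdivrMr //.
  by rewrite exprn_gt0.
have C0 : 0 <= C by have := C1 0%N; rewrite mul0r addr0; exact: le_trans ler01.
have := C1 (Num.bound (C / x)).
have : C / x < (Num.bound (C / x))%:R by rewrite archi_boundP // divr_ge0 // ltW.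
by rewrite ltr_pdivrMr //; lra.
Qed.

(** Cauchy's formula on a square. Contour sums of [(f z - f c) / (z - c)] tend to 0, those of
    [1 / (z - c)] have modulus at least 4 and those of [f z / (z - c)] at most [8 M], whence the
    factor 2. Powers of [f] remove it afterwards. *)
Lemma cauchy_square f c (l M : R) : 0 < l ->
  (forall z, cabs (z - c) <= 2 * l -> cdiff f z) ->
  (forall z, l <= cabs (z - c) <= 2 * l -> cabs (f z) <= M) ->
  cabs (f c) <= 2 * M.
Proof.
move=> l0 fd fM.
pose h z := f z * (z - c)^-1 + (- f c) * (z - c)^-1.
pose p := c + 1 * l%:C * (- 1 - 'i); pose L := l%:C.
have L0 : L != 0 by rewrite -cabs_gt0 cabs_real normr_gt0 gt_eqF.
have ii : 'i * 'i = -1 :> R[i] by rewrite -expr2 sqr_i.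
have cw w : w \in [:: 1; 'i; -1; - 'i] -> cabs w = 1.
  by rewrite !inE => /or4P[] /eqP ->; rewrite ?cabsN ?cabs1 ?cabs_i.
have h0 : par_to0 h p (1 * (2 * l)%:C) ('i * (2 * l)%:C).
  have [m [d d0 hm]] : exists m, exists2 d, 0 < d & forall z, cabs (z - c) < d -> cabs (h z) <= m.
    have [|a fa] := fd c; first by rewrite subrr cabs0 mulr_ge0 // ltW.
    have [d d0 hd] := fa 1 ltr01; exists (cabs a + 1), d => // z zc.
    have [->|zc0] := eqVneq z c.
      by rewrite /h subrr invr0 !mulr0 addr0 cabs0 addr_ge0 ?cabs_ge0.
    have zcn : z - c != 0 by rewrite subr_eq0.
    rewrite (_ : h z = a + (f z - f c - a * (z - c)) / (z - c)); last by rewrite /h; field.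
    apply: le_trans (cabsD _ _) _; rewrite lerD2l cabsM cabsV ler_pdivrMr ?cabs_gt0 //.
    exact: hd.
  (* The lines through [c] cut the square into quadrants with a corner at [c], where [h] is bounded
     but need not be differentiable. *)
  have quad (a b : R) : `|a| = l -> `|b| = l ->
      par_to0 h c a%:C (b%:C * 'i).
    move=> al bl; apply: goursat_corner d0 hm _ => s t /andP[s0 s1] /andP[t0 t1] st.
    have zc : c + s%:C * a%:C + t%:C * (b%:C * 'i) - c = (s * a)%:C + (t * b)%:C * 'i.
      by rewrite !rmorphM; ring.
    have zn : (s * a)%:C + (t * b)%:C * 'i != 0 :> R[i].
      rewrite eq_complex /= !(mul0r, mulr0, mulr1, addr0, add0r, subr0) negb_and.
      have a0 : a != 0 by rewrite -normr_gt0 al.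
      have b0 : b != 0 by rewrite -normr_gt0 bl.
      by rewrite !mulf_eq0 (negPf a0) (negPf b0) !orbF -negb_and; case/orP: st => /gt_eqF ->; rewrite ?andbF.
    have zl : cabs (c + s%:C * a%:C + t%:C * (b%:C * 'i) - c) <= 2 * l.
      rewrite zc; apply: le_trans (cabsD _ _) _.
      rewrite cabsM cabs_i mulr1 !cabs_real !normrM al bl !ger0_norm //.
      have := ler_piMl (ltW l0) s1; have := ler_piMl (ltW l0) t1; lra.
    have zi := cdiffV (f := fun z => z - c); rewrite /= in zi.
    have zi' := zi _ _ (cdiffB (cdiff_id _) (cdiff_cst c _)).
    apply: cdiffD; apply: cdiffM.
    - exact: fd.
    - by apply: zi'; rewrite zc.
    - exact: cdiff_cst.
    - by apply: zi'; rewrite zc.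
  have nl : `|l| = l by rewrite gtr0_norm.
  have nnl : `|- l| = l by rewrite normrN.
  have C2 : (2 * l)%:C = 2 * L by rewrite rmorphM rmorph_nat.
  have uE : 1 * (2 * l)%:C / 2 = L by rewrite C2; field.
  have vE : 'i * (2 * l)%:C / 2 = L * 'i by rewrite C2; field.
  apply: par_to0_split; rewrite uE vE.
  - apply: par_to0_flip_u; apply: par_to0_flip_v.
    rewrite (_ : p + L + L * 'i = c); last by rewrite /p -/L; ring.
    by have := quad _ _ nnl nnl; rewrite !rmorphN mulNr.
  - apply: par_to0_flip_v.
    rewrite (_ : p + L + L * 'i = c); last by rewrite /p -/L; ring.
    by have := quad _ _ nl nnl; rewrite !rmorphN mulNr.
  - apply: par_to0_flip_u.
    rewrite (_ : p + L * 'i + L = c); last by rewrite /p -/L; ring.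
    by have := quad _ _ nnl nl; rewrite !rmorphN.
  - rewrite (_ : p + L + L * 'i = c); last by rewrite /p -/L; ring.
    by have := quad _ _ nl nl.
have M0 : 0 <= M.
  apply: le_trans (cabs_ge0 _) (fM (c + L) _).
  by rewrite addrAC subrr add0r cabs_real gtr0_norm // lexx /=; lra.
pose side w := (c + w * l%:C * (- 1 - 'i), w * (2 * l)%:C).
have parE g k : parsum g p (1 * (2 * l)%:C) ('i * (2 * l)%:C) k =
    segsum g (side 1).1 (side 1).2 k + segsum g (side 'i).1 (side 'i).2 k
    + segsum g (side (-1)).1 (side (-1)).2 k + segsum g (side (- 'i)).1 (side (- 'i)).2 k.
  rewrite /parsum -!segsum_rev /side /=.
  have cplx (x y : R[i]) : Re x = Re y -> Im x = Im y -> x = y.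
    by case: x y => [x1 x2] [y1 y2] /= -> ->.
  congr (_ + _ + _ + _).
  - congr segsum; rewrite /p; apply: cplx; case: (c) => c1 c2 /=; ring.
  - rewrite mulNr; congr segsum; rewrite /p; apply: cplx; case: (c) => c1 c2 /=; ring.
  - rewrite mulNr; congr segsum; rewrite /p; apply: cplx; case: (c) => c1 c2 /=; ring.
have sideP w k : w \in [:: 1; 'i; -1; - 'i] ->
    1 <= Im (segsum (fun z => (z - c)^-1) (side w).1 (side w).2 k) /\
    cabs (segsum (fun z => f z * (z - c)^-1) (side w).1 (side w).2 k) <= 2 * M.
  move=> /cw w1; split.
    by apply: segsum_Im_ge => z /(side_point l0 w1)[].
  rewrite (_ : 2 * M = cabs (side w).2 * (M * l^-1)); last first.
    by rewrite /= cabsM w1 mul1r cabs_real gtr0_norm ?mulr_gt0 //; field; rewrite gt_eqF.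
  apply: segsum_le => z /(side_point l0 w1)[/andP[z1 z2] _].
  rewrite cabsM cabsV; apply: ler_pM; rewrite ?invr_ge0 ?cabs_ge0 //.
    by apply: fM; rewrite z1.
  by rewrite lef_pV2 ?posrE // (lt_le_trans l0).
apply/ler_addgt0Pr => e e0.
have e4 : 0 < 4 * e by lra.
have [N hN] := h0 _ e4; have {hN} := hN N (leqnn _).
rewrite /h parsumD parsumZ !parE.
have [|i1 f1] := sideP 1 N; first by rewrite !inE eqxx.
have [|i2 f2] := sideP 'i N; first by rewrite !inE eqxx !orbT.
have [|i3 f3] := sideP (-1) N; first by rewrite !inE eqxx !orbT.
have [|i4 f4] := sideP (-'i) N; first by rewrite !inE eqxx !orbT.
set F := (X in cabs (X + _)); set I := (X in - f c * X).
have FM : cabs F <= 8 * M.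
  apply: le_trans (cabsD _ _) _; apply: le_trans (lerD (cabsD _ _) (lexx _)) _.
  apply: le_trans (lerD (lerD (cabsD _ _) (lexx _)) (lexx _)) _; lra.
have I4 : 4 <= cabs I.
  apply: le_trans (le_trans (ler_norm _) (cabs_Im I)); rewrite /I !raddfD /=; lra.
have h1 : cabs (f c * I) <= cabs F + cabs (F + - f c * I).
  rewrite (_ : f c * I = F - (F + - f c * I)); last by ring.
  exact: cabsB.
rewrite cabsM in h1 => h2.
have := ler_wpM2l (cabs_ge0 (f c)) I4; lra.
Qed.

Lemma max_square f c (l M : R) : 0 < l ->
  (forall z, cabs (z - c) <= 2 * l -> cdiff f z) ->
  (forall z, l <= cabs (z - c) <= 2 * l -> cabs (f z) <= M) ->
  cabs (f c) <= M.
Proof.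
move=> l0 fd fM.
have M0 : 0 <= M.
  apply: le_trans (cabs_ge0 _) (fM (c + l%:C) _).
  by rewrite addrAC subrr add0r cabs_real gtr0_norm // lexx /=; lra.
apply: (@pow_bound _ _ 2) => // n; rewrite -cabsX.
apply: (cauchy_square l0 (f := fun z => f z ^+ n)).
  by move=> z /fd; exact: cdiffX.
by move=> z /fM h; rewrite cabsX lerXn2r ?nnegrE ?cabs_ge0.
Qed.

Lemma nrm1E (x : 'rV[R[i]]_1) : nrm x = cabs (x 0 0).
Proof. by rewrite /nrm big_ord1. Qed.

Lemma extreme_value1 (K : set R[i]) (u : R[i] -> R) (B : R) :
  K !=set0 -> (forall p, K p -> cabs p <= B) ->
  (forall p, (forall e, 0 < e -> exists2 q, K q & cabs (q - p) < e) -> K p) ->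
  (forall p, K p -> forall e, 0 < e -> exists2 d, 0 < d &
    forall q, K q -> cabs (q - p) < d -> `|u q - u p| < e) ->
  exists2 p, K p & forall q, K q -> u q <= u p.
Proof.
move=> [p0 Kp0] KB Kc uc.
have [||||p Kp ph] := @extreme_value R 1 [set x : 'rV[R[i]]_1 | K (x 0 0)] (fun x => u (x 0 0)) B.
- by exists (const_mx p0 : 'rV_1); rewrite /= mxE.
- by move=> x /KB; rewrite nrm1E.
- move=> x hx; apply: Kc => e /hx[q Kq qp]; exists (q 0 0) => //.
  by rewrite nrm1E !mxE in qp.
- move=> x Kx e e0; have [d d0 hd] := uc _ Kx _ e0; exists d => // q Kq qp.
  by apply: hd => //; rewrite nrm1E !mxE in qp.
by exists (p 0 0) => // q Kq; have := ph (const_mx q : 'rV_1); rewrite /= !mxE; apply.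
Qed.

Definition ccompact (K : set R[i]) := (exists B, forall p, K p -> cabs p <= B) /\
  (forall p, (forall e, 0 < e -> exists2 q, K q & cabs (q - p) < e) -> K p).

Definition cabs_cont_in (K : set R[i]) f := forall p, K p -> forall e, 0 < e ->
  exists2 d, 0 < d & forall q, K q -> cabs (q - p) < d ->
    `|cabs (f q) - cabs (f p)| < e.

(* At a maximum [c] of [|f z| (1 + eta |z|^2)] the function
   [f z (1 + 2 a conj(c) (z - c))] would be strictly larger in modulus at [c]
   than on a surrounding annulus. *)
Theorem max_principle (K : set R[i]) f (M : R) : 0 <= M -> ccompact K -> cabs_cont_in K f ->
  (forall p, K p -> cabs (f p) <= M \/
     exists2 d, 0 < d & forall z, cabs (z - p) < d -> K z /\ cdiff f z) ->
  forall z, K z -> cabs (f z) <= M.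
Proof.
move=> M0 [[B KB] Kc] fc hK z0 Kz0.
have B0 : 0 <= B by exact: le_trans (cabs_ge0 _) (KB _ Kz0).
(* The condition on [eta] keeps the weight between 1 and 5/4 on [K]. The factor [1 + eta B^2] is
   removed at the end by letting [eta] tend to 0. *)
have key eta : 0 < eta -> eta * B ^+ 2 <= 1 / 4 ->
    cabs (f z0) <= M * (1 + eta * B ^+ 2).
  move=> eta0 etaB.
  pose u z := cabs (f z) * (1 + eta * cabs z ^+ 2).
  have [||||c Kc' hc] := @extreme_value1 K u B; [by exists z0|exact: KB|exact: Kc| |].
    move=> p Kp e e0; have e2 : 0 < e / 4 by lra.
    have [d d0 hd] := fc _ Kp _ e2.
    pose D := cabs (f p) * eta * (2 * B) + 1.
    have D0 : 0 < D by rewrite ltr_wpDl // !mulr_ge0 ?cabs_ge0 // ltW.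
    exists (Num.min d (e / 2 / D)); first by rewrite lt_min d0 !divr_gt0.
    move=> q Kq; rewrite lt_min => /andP[/(hd _ Kq) h1 h2].
    rewrite /u (_ : _ - _ = (cabs (f q) - cabs (f p)) * (1 + eta * cabs q ^+ 2)
      + cabs (f p) * eta * ((cabs q + cabs p) * (cabs q - cabs p))); last by ring.
    apply: le_lt_trans (ler_normD _ _) _; rewrite !normrM.
    rewrite (ger0_norm (cabs_ge0 _)) (ger0_norm (ltW eta0)) (ger0_norm (addr_ge0 (cabs_ge0 q) (cabs_ge0 p))).
    have h3 : `|1 + eta * cabs q ^+ 2| <= 5 / 4.
      rewrite ger0_norm; last by rewrite addr_ge0 // mulr_ge0 ?sqr_ge0 // ltW.
      have : cabs q ^+ 2 <= B ^+ 2 by rewrite lerXn2r ?nnegrE ?cabs_ge0 ?KB.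
      by move=> /(ler_wpM2l (ltW eta0)); lra.
    have h4 : `|cabs q - cabs p| <= cabs (q - p).
      rewrite ler_norml cabs_dist_ge andbT; have := cabs_dist_ge p q.
      by rewrite cabs_distC; lra.
    have h5 : cabs q + cabs p <= 2 * B by have := KB _ Kq; have := KB _ Kp; lra.
    have h6 : (cabs q + cabs p) * `|cabs q - cabs p| <= 2 * B * cabs (q - p).
      by apply: ler_pM; rewrite ?addr_ge0 ?cabs_ge0.
    have h7 : 0 <= cabs (f p) * eta by rewrite mulr_ge0 ?cabs_ge0 // ltW.
    have h8 := ler_wpM2l h7 h6.
    have h9 : `|cabs (f q) - cabs (f p)| * `|1 + eta * cabs q ^+ 2| <= e / 4 * (5 / 4).
      by apply: ler_pM => //; exact: ltW.
    have h10 : cabs (q - p) * D < e / 2 by rewrite -ltr_pdivlMr.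
    have := cabs_ge0 (q - p); rewrite /D in h10; lra.
  have w1 z : 1 <= 1 + eta * cabs z ^+ 2 by rewrite lerDl mulr_ge0 ?sqr_ge0 // ltW.
  apply: le_trans (_ : u z0 <= _).
    by rewrite ler_peMr ?cabs_ge0.
  apply: le_trans (hc _ Kz0) _.
  have cB : cabs c ^+ 2 <= B ^+ 2 by rewrite lerXn2r ?nnegrE ?cabs_ge0 ?KB.
  have fin x : cabs (f c) <= x -> 0 <= x -> u c <= x * (1 + eta * B ^+ 2).
    move=> cx x0; apply: ler_pM => //; rewrite ?cabs_ge0 ?(le_trans ler01) //.
    by rewrite lerD2l ler_wpM2l // ltW.
  case: (hK c Kc') => [cM|[d d0 hd]].
    exact: fin.
  suff -> : u c = 0 by rewrite mulr_ge0 // addr_ge0 // mulr_ge0 ?sqr_ge0 // ltW.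
  rewrite /u; apply/eqP; rewrite mulf_eq0; apply/orP; left.
  apply: contraT => fc0; have fcp : 0 < cabs (f c) by rewrite lt_def fc0 cabs_ge0.
  set A := 1 + eta * cabs c ^+ 2 in fin; have A1 : 1 <= A by exact: w1.
  have A0 : 0 < A by exact: lt_le_trans ltr01 A1.
  pose a := eta / A; have a0 : 0 < a by rewrite divr_gt0.
  have a4 : 4 * a * cabs c ^+ 2 <= 1.
    have : a <= eta by rewrite ler_pdivrMr // ler_peMr // ltW.
    have := ler_wpM2l (ltW eta0) cB.
    by move=> h /(ler_wpM2r (sqr_ge0 (cabs c))); lra.
  pose l := d / 3; have l0 : 0 < l by rewrite divr_gt0.
  have ld : 2 * l < d by rewrite /l; lra.
  pose w z := 1 + 2 * a%:C * c^*%C * (z - c).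
  (* With [Y] the weight at [z] divided by the weight at [c], [Y^2] exceeds [|w z|^2] by at least
     [a |z - c|^2]. Since [Y <= 5 / 4], the factor [16 / 25] turns this gain into a relative one,
     [|w z|^2 <= Y^2 (1 - kap)]. *)
  pose kap := a * l ^+ 2 * (16 / 25).
  have kap0 : 0 < kap by apply: mulr_gt0; [apply: mulr_gt0 => //; exact: exprn_gt0|exact: divr_gt0].
  have sq1 : Num.sqrt (1 - kap) < 1 by rewrite -[ltRHS]sqrtr1 ltr_sqrt //; lra.
  have : cabs (f c * w c) <= cabs (f c) * Num.sqrt (1 - kap).
    apply: (@max_square (fun z => f z * w z) c l) => // z.
      move=> zc; apply: cdiffM; first by case: (hd z) => //; exact: le_lt_trans ld.
      by apply: cdiffD (cdiff_cst _ _) (cdiffM (cdiff_cst _ _) (cdiffB (cdiff_id _) (cdiff_cst _ _))).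
    move=> /andP[z1 z2]; have [Kz _] := hd z (le_lt_trans z2 ld).
    pose X := Re (c^*%C * (z - c)).
    have zE : cabs z ^+ 2 = cabs c ^+ 2 + 2 * X + cabs (z - c) ^+ 2.
      by rewrite /X !cabs_sqr; case: (z) (c) => [z1' z2'] [c1 c2] /=; ring.
    have wE : cabs (w z) ^+ 2 = 1 + 4 * a * X + 4 * a ^+ 2 * cabs c ^+ 2 * cabs (z - c) ^+ 2.
      rewrite /X /w !cabs_sqr -(rmorph_nat (real_complex R)).
      by case: (z) (c) => [z1' z2'] [c1 c2] /=; ring.
    pose Y := (1 + eta * cabs z ^+ 2) / A.
    have YE : Y = 1 + a * (2 * X + cabs (z - c) ^+ 2).
      by rewrite /Y /a zE /A; field; rewrite gt_eqF.
    have Y0 : 0 < Y by rewrite divr_gt0 // (lt_le_trans ltr01).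
    have Y5 : Y <= 5 / 4.
      rewrite /Y ler_pdivrMr //; apply: le_trans (_ : 5 / 4 * 1 <= _); last first.
        by rewrite ler_pM2l // divr_gt0.
      have : cabs z ^+ 2 <= B ^+ 2 by rewrite lerXn2r ?nnegrE ?cabs_ge0 ?KB.
      by move=> /(ler_wpM2l (ltW eta0)); lra.
    have Ymax : cabs (f z) * Y <= cabs (f c).
      by rewrite mulrA ler_pdivrMr //; exact: hc.
    have wY : cabs (w z) ^+ 2 <= Y ^+ 2 * (1 - kap).
      have h1 : l ^+ 2 <= cabs (z - c) ^+ 2 by rewrite lerXn2r ?nnegrE ?cabs_ge0 // ltW.
      have h2 : Y ^+ 2 <= 25 / 16.
        have : Y ^+ 2 <= (5 / 4) ^+ 2 by rewrite lerXn2r ?nnegrE ?(ltW Y0) //; lra.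
        by lra.
      have h3 : Y ^+ 2 * kap <= a * cabs (z - c) ^+ 2.
        have := ler_wpM2r (ltW kap0) h2; rewrite {2}/kap.
        have := ler_wpM2l (ltW a0) h1; lra.
      have h4 : 1 + 4 * a * X + 2 * a * cabs (z - c) ^+ 2 <= Y ^+ 2.
        rewrite YE; have := sqr_ge0 (a * (2 * X + cabs (z - c) ^+ 2)); lra.
      have h5 : 4 * a ^+ 2 * cabs c ^+ 2 * cabs (z - c) ^+ 2 <= a * cabs (z - c) ^+ 2.
        have := ler_wpM2r (mulr_ge0 (ltW a0) (sqr_ge0 (cabs (z - c)))) a4; lra.
      by rewrite wE mulrBr mulr1; lra.
    rewrite cabsM -(ler_pM2r Y0) mulrAC.
    apply: le_trans (ler_wpM2r (cabs_ge0 _) Ymax) _; rewrite -mulrA ler_pM2l //.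
    rewrite -[leLHS]ger0_norm ?cabs_ge0 // -sqrtr_sqr.
    rewrite -[X in _ <= _ * X]ger0_norm ?(ltW Y0) // -(sqrtr_sqr Y) mulrC -sqrtrM ?sqr_ge0 //.
    exact: ler_wsqrtr.
  by rewrite /w subrr mulr0 addr0 mulr1 ler_pMr // leNgt sq1.
apply/ler_addgt0Pr => e e0.
have MB : 0 <= M * B ^+ 2 by rewrite mulr_ge0 ?sqr_ge0.
have B2 : 0 <= B ^+ 2 by exact: sqr_ge0.
pose eta := Num.min (1 / (4 * (B ^+ 2 + 1))) (e / (M * B ^+ 2 + 1)).
have eta0 : 0 < eta by rewrite lt_min !divr_gt0 // ?mulr_gt0 // ltr_wpDl.
have h1 : eta * (B ^+ 2 + 1) <= 1 / 4.
  rewrite -ler_pdivlMr ?ltr_wpDl //; apply: le_trans (_ : 1 / (4 * (B ^+ 2 + 1)) <= _).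
    by rewrite ge_min lexx.
  by rewrite invfM mulrA.
have h2 : eta * (M * B ^+ 2 + 1) <= e.
  by rewrite -ler_pdivlMr ?ltr_wpDl // ge_min lexx orbT.
by apply: le_trans (key eta eta0 _) _; lra.
Qed.

End MaximumPrinciple.

(** * Divided differences and removable singularities *)

Section OneVariable.
Set Implicit Arguments.
Unset Strict Implicit.
Variable R : realType.
Implicit Types (f g : R[i] -> R[i]) (a b c p u v z w e : R[i]) (s t d M : R).

Lemma cabs_triangle a b c : cabs (a - c) <= cabs (a - b) + cabs (b - c).
Proof. by rewrite -[a - c](subrKA b) cabsD. Qed.

Lemma ccompact_annulus c s t : ccompact [set z | s <= cabs (z - c) <= t].
Proof.
split.
  exists (t + cabs c) => p /= /andP[_ pt].
  by have := cabsD (p - c) c; rewrite subrK; lra.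
move=> p hp /=; apply/andP; split; apply/ler_addgt0Pr => e e0; have [q /= /andP[h1 h2] h3] := hp e e0.
  by have := cabs_triangle q p c; lra.
by have := cabs_triangle p q c; rewrite cabs_distC in h3; lra.
Qed.

Lemma ccont_cabs_cont (K : set R[i]) f : (forall p, K p -> ccont f p) -> cabs_cont_in K f.
Proof.
move=> fc p Kp e e0; have [d d0 hd] := fc p Kp e e0; exists d => // q _ /hd h.
rewrite ltr_norml; have := cabs_dist_ge (f q) (f p); have := cabs_dist_ge (f p) (f q).
by rewrite (cabs_distC (f p)) => h1 h2; apply/andP; split; lra.
Qed.

Definition bnd_near f e := exists B, exists2 d, 0 < d &
  forall z, z != e -> cabs (z - e) < d -> cabs (f z) <= B.

Lemma ccont_bnd_near f e : ccont f e -> bnd_near f e.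
Proof.
move=> /(_ 1 ltr01)[d d0 hd]; exists (cabs (f e) + 1), d => // z _ /hd h.
by have := cabs_dist_ge (f z) (f e); lra.
Qed.

Lemma bnd_nearM f g e : bnd_near f e -> bnd_near g e ->
  bnd_near (fun z => f z * g z) e.
Proof.
move=> [B [d d0 hd]] [B' [d' d'0 hd']]; exists (B * B'), (Num.min d d').
  by rewrite lt_min d0.
move=> z ze; rewrite lt_min => /andP[z1 z2]; rewrite cabsM.
by apply: ler_pM; rewrite ?cabs_ge0 ?hd ?hd'.
Qed.

Lemma bnd_nearD f g e : bnd_near f e -> bnd_near g e ->
  bnd_near (fun z => f z + g z) e.
Proof.
move=> [B [d d0 hd]] [B' [d' d'0 hd']]; exists (B + B'), (Num.min d d').
  by rewrite lt_min d0.
move=> z ze; rewrite lt_min => /andP[z1 z2]; apply: le_trans (cabsD _ _) _.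
by apply: lerD; rewrite ?hd ?hd'.
Qed.

Lemma bnd_near_quot f e : cdiff f e -> bnd_near (fun z => (f z - f e) / (z - e)) e.
Proof.
case/cdiffP => q [fq cq]; have [B [d d0 hd]] := ccont_bnd_near cq.
exists B, d => // z ze zd; rewrite fq addrC addKr mulfK ?subr_eq0 //; exact: hd.
Qed.

Lemma ccont_shiftV p e : p != e -> ccont (fun z => (z - e)^-1) p.
Proof.
move=> pe; apply: (@ccontV _ (fun z => z - e)); first by rewrite subr_eq0.
exact: ccontD (ccont_id _) (ccont_cst _ _).
Qed.

Lemma cdiff_shiftV p e : p != e -> cdiff (fun z => (z - e)^-1) p.
Proof.
move=> pe; apply: (@cdiffV _ (fun z => z - e)); first by rewrite subr_eq0.
exact: cdiffD (cdiff_id _) (cdiff_cst _ _).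
Qed.

(** The product [P] of the [z - e] makes [f^n P] continuous at the exceptional points and zero
    there, so that the maximum principle applies to it. The constant brought in by [P] does not
    depend on [n] and is lost in the [n]-th root. *)
Lemma max_exceptional f c (r M : R) (es : seq R[i]) : 0 < r -> 0 <= M ->
  (forall z, cabs (z - c) <= r -> z \notin es -> cdiff f z) ->
  (forall e, e \in es -> cabs (e - c) < r /\ bnd_near f e) ->
  (forall z, cabs (z - c) = r -> cabs (f z) <= M) ->
  forall z, cabs (z - c) <= r -> z \notin es -> cabs (f z) <= M.
Proof.
move=> r0 M0 fd es1 fM z0 z0r z0es.
pose P z := \prod_(e <- es) (z - e).
have PE z : (P z == 0) = (z \in es).
  by rewrite prodf_seq_eq0 -has_pred1 /=; apply: eq_has => e /=; rewrite subr_eq0 eq_sym.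
have Pd z : cdiff P z.
  by apply: cdiff_prod => e _; exact: cdiffB (cdiff_id _) (cdiff_cst _ _).
have Pc z := cdiff_cont (Pd z).
have P0 : 0 < cabs (P z0) by rewrite cabs_gt0 PE.
have Pr z : cabs (z - c) <= r -> cabs (P z) <= (2 * r) ^+ size es.
  move=> zr; rewrite /P; elim: (es) es1 => [|e l ih] h; first by rewrite big_nil cabs1.
  rewrite big_cons cabsM /= exprS; apply: ler_pM; rewrite ?cabs_ge0 //.
    have [h1 _] := h e (mem_head _ _); have := cabs_triangle z c e.
    by rewrite (cabs_distC c); lra.
  by apply: ih => x xl; apply: h; rewrite inE xl orbT.
apply: (@pow_bound _ _ _ ((2 * r) ^+ size es / cabs (P z0))) => // n.
rewrite mulrAC ler_pdivlMr // -cabsX -cabsM.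
pose K := [set z | 0 <= cabs (z - c) <= r].
apply: (@max_principle _ K (fun z => f z ^+ n * P z)); last by rewrite /K /= cabs_ge0.
- by rewrite mulr_ge0 // exprn_ge0 // mulr_ge0 // ltW.
- exact: ccompact_annulus.
- apply: ccont_cabs_cont => p /andP[_ pr].
  have [pes|pes] := boolP (p \in es); last first.
    by apply: cdiff_cont; apply: cdiffM => //; apply: cdiffX; exact: fd.
  have Pp0 : P p = 0 by apply/eqP; rewrite PE.
  have [_ [B [d d0 hd]]] := es1 p pes => eps eps0.
  pose B' := `|B| ^+ n + 1; have B'0 : 0 < B' by rewrite ltr_wpDl // exprn_ge0.
  have [d' d'0 hd'] := Pc p _ (divr_gt0 eps0 B'0).
  exists (Num.min d d'); first by rewrite lt_min d0.
  move=> z; rewrite lt_min Pp0 mulr0 subr0 => /andP[z1 /hd'].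
  rewrite Pp0 subr0 ltr_pdivlMr // => h.
  have [->|zp] := eqVneq z p; first by rewrite Pp0 mulr0 cabs0.
  apply: le_lt_trans h; rewrite cabsM mulrC ler_wpM2l ?cabs_ge0 // cabsX /B'.
  apply: le_trans (_ : `|B| ^+ n <= _); last by rewrite lerDl.
  rewrite lerXn2r ?nnegrE ?cabs_ge0 //.
  exact: le_trans (hd z zp z1) (ler_norm _).
- move=> p /andP[_ pr]; have [pes|pes] := boolP (p \in es).
    left; move: pes; rewrite -PE => /eqP ->; rewrite mulr0 cabs0.
    by rewrite mulr_ge0 // exprn_ge0 // mulr_ge0 // ltW.
  move: pr; rewrite le_eqVlt => /orP[/eqP pr|pr].
    left; rewrite cabsM cabsX mulrC; apply: ler_pM; rewrite ?exprn_ge0 ?cabs_ge0 //.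
      by apply: Pr; rewrite pr.
    by rewrite lerXn2r ?nnegrE ?cabs_ge0 // fM.
  right; have [|d d0 hd] := Pc p (cabs (P p)); first by rewrite cabs_gt0 PE.
  exists (Num.min d (r - cabs (p - c))); first by rewrite lt_min d0 subr_gt0.
  move=> z; rewrite lt_min => /andP[/hd h1 h2].
  have zr : cabs (z - c) <= r by have := cabs_triangle z p c; lra.
  split; first by rewrite /K /= cabs_ge0.
  apply: cdiffM => //; apply: cdiffX; apply: fd => //.
  by rewrite -PE; apply: contraTneq h1 => ->; rewrite sub0r cabsN ltxx.
Qed.

Lemma max_disc f c (r M : R) : 0 < r -> 0 <= M ->
  (forall z, cabs (z - c) <= r -> cdiff f z) ->
  (forall z, cabs (z - c) = r -> cabs (f z) <= M) ->
  forall z, cabs (z - c) <= r -> cabs (f z) <= M.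
Proof.
move=> r0 M0 fd fM z zr.
by apply: (@max_exceptional f c r M [::]) => // z' z'r _; exact: fd.
Qed.

(** * Bounds on first and second divided differences *)

Definition dq f a b := (f a - f b) / (a - b).

Lemma dqC f a b : dq f a b = dq f b a.
Proof. by rewrite /dq -[a - b]opprB invrN mulrN -mulNr opprB. Qed.

(** As a function of [a] the quotient is bounded near [b] and near [e], so its bound on the circle
    [|a - c| = r] holds inside. There the numerator is at most [2 M] and the denominator at least
    [r / 2]. *)
Lemma dq_bound f c (r M : R) e : 0 < r ->
  (forall z, cabs (z - c) <= r -> z != e -> cdiff f z) -> ccont f e ->
  cabs (e - c) < r ->
  (forall z, cabs (z - c) <= r -> cabs (f z) <= M) ->
  forall a b, b != e -> a != e -> a != b -> cabs (b - c) <= r / 2 ->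
    cabs (a - c) <= r -> cabs (dq f a b) <= 4 * M / r.
Proof.
move=> r0 fd fe er fM a b be ae ab br ar.
have M0 : 0 <= M by apply: le_trans (cabs_ge0 _) (fM e (ltW er)).
apply: (@max_exceptional (dq f ^~ b) c r _ [:: b; e]) => //.
- by rewrite divr_ge0 ?mulr_ge0 // ltW.
- move=> z zr; rewrite !inE negb_or => /andP[zb ze].
  apply: cdiffM; last exact: cdiff_shiftV.
  exact: cdiffB (fd _ zr ze) (cdiff_cst _ _).
- move=> x; rewrite !inE => /orP[/eqP ->|/eqP ->].
    split; first by lra.
    by apply: bnd_near_quot; apply: fd => //; lra.
  split=> //; apply: bnd_nearM; apply: ccont_bnd_near.
    exact: ccontD fe (ccont_cst _ _).
  by apply: ccont_shiftV; rewrite eq_sym.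
- move=> z zr; rewrite cabsM cabsV.
  have h1 : r / 2 <= cabs (z - b).
    by have := cabs_triangle z b c; rewrite zr; lra.
  rewrite ler_pdivrMr; last by lra.
  apply: le_trans (cabsB _ _) _.
  have := fM z; rewrite zr lexx => /(_ isT) h2.
  have h3 : cabs (f b) <= M by apply: fM; lra.
  have h4 : 4 * M / r * (r / 2) <= 4 * M / r * cabs (z - b).
    by rewrite ler_wpM2l // divr_ge0 ?mulr_ge0 // ltW.
  have h5 : 4 * M / r * (r / 2) = 2 * M by field; rewrite gt_eqF.
  by lra.
- by rewrite !inE negb_or ab ae.
Qed.

(** The same argument once more: on the circle both quotients are at most [4 M / r], and the
    denominator is again at least [r / 2]. *)
Lemma dd_bound_off f c (r M : R) e : 0 < r ->
  (forall z, cabs (z - c) <= r -> z != e -> cdiff f z) -> ccont f e ->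
  cabs (e - c) < r ->
  (forall z, cabs (z - c) <= r -> cabs (f z) <= M) ->
  forall (a b d : R[i]), b != e -> d != e -> a != e -> a != b -> a != d -> b != d ->
    cabs (b - c) <= r / 2 -> cabs (d - c) <= r / 2 -> cabs (a - c) <= r ->
    cabs ((dq f a b - dq f d b) / (a - d)) <= 16 * M / r ^+ 2.
Proof.
move=> r0 fd fe er fM a b d be de ae ab ad bd br dr ar.
have M0 : 0 <= M by apply: le_trans (cabs_ge0 _) (fM e (ltW er)).
have dqb := dq_bound r0 fd fe er fM.
have dqd z : cabs (z - c) <= r -> z != b -> z != e -> cdiff (dq f ^~ b) z.
  move=> zr zb ze; apply: cdiffM; last exact: cdiff_shiftV.
  exact: cdiffB (fd _ zr ze) (cdiff_cst _ _).
apply: (@max_exceptional (fun z => (dq f z b - dq f d b) / (z - d)) c r _ [:: b; d; e]) => //.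
- by rewrite divr_ge0 ?mulr_ge0 // ltW.
- move=> z zr; rewrite !inE !negb_or => /and3P[zb zd ze].
  apply: cdiffM; last exact: cdiff_shiftV.
  exact: cdiffB (dqd _ zr zb ze) (cdiff_cst _ _).
- move=> x; rewrite !inE => /or3P[/eqP ->|/eqP ->|/eqP ->].
  + split; first by lra.
    apply: bnd_nearM; last exact/ccont_bnd_near/ccont_shiftV.
    apply: bnd_nearD; last exact/ccont_bnd_near/ccont_cst.
    by apply: bnd_near_quot; apply: fd => //; lra.
  + split; first by lra.
    by apply: bnd_near_quot; apply: dqd; rewrite // 1?eq_sym //; lra.
  + split=> //; apply: bnd_nearM; apply: ccont_bnd_near; last first.
      by apply: ccont_shiftV; rewrite eq_sym.
    apply: ccontD (ccont_cst _ _); apply: ccontM; last by apply: ccont_shiftV; rewrite eq_sym.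
    exact: ccontD fe (ccont_cst _ _).
- move=> z zr.
  have zn x : cabs (x - c) < r -> z != x.
    by move=> xr; apply: contraTneq xr => <-; rewrite zr ltxx.
  have bn : cabs (b - c) < r by lra.
  have dn : cabs (d - c) < r by lra.
  rewrite cabsM cabsV.
  have h1 : r / 2 <= cabs (z - d).
    by have := cabs_triangle z d c; rewrite zr; lra.
  rewrite ler_pdivrMr; last by lra.
  apply: le_trans (cabsB _ _) _.
  have h2 : cabs (dq f z b) <= 4 * M / r by apply: dqb => //; rewrite ?zn // zr.
  have h3 : cabs (dq f d b) <= 4 * M / r by apply: dqb => //; [rewrite eq_sym|lra].
  have h4 : 16 * M / r ^+ 2 * (r / 2) <= 16 * M / r ^+ 2 * cabs (z - d).
    by rewrite ler_wpM2l // divr_ge0 ?mulr_ge0 // ltW.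
  have h5 : 16 * M / r ^+ 2 * (r / 2) = 2 * (4 * M / r) by field; rewrite gt_eqF.
  by lra.
- by rewrite !inE !negb_or ab ad ae.
Qed.

Lemma punctured_le g e (d K : R) : 0 < d -> ccont g e ->
  (forall z, z != e -> cabs (z - e) < d -> cabs (g z) <= K) -> cabs (g e) <= K.
Proof.
move=> d0 ge gK; apply/ler_addgt0Pr => eps eps0.
have [d' d'0 hd] := ge _ eps0.
pose x := Num.min d d' / 2.
have m0 : 0 < Num.min d d' by rewrite lt_min d0.
have x0 : 0 < x by rewrite divr_gt0.
have : x < Num.min d d' by rewrite /x; lra.
rewrite lt_min => /andP[xd xd'].
have xE : cabs (e + x%:C - e) = x by rewrite addrAC subrr add0r cabs_real gtr0_norm.
have h1 : cabs (g (e + x%:C)) <= K.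
  by apply: gK; rewrite ?xE // -subr_eq0 -cabs_gt0 xE.
have h2 : cabs (g (e + x%:C) - g e) < eps by apply: hd; rewrite xE.
have := cabs_dist_ge (g e) (g (e + x%:C)); rewrite cabs_distC; lra.
Qed.

(** Of three distinct points at most one is [e], where [f] is only known to be continuous; a limit
    in that point extends the previous bound to it. This is what makes the singularity at [e]
    removable. *)
Lemma dd_bound f c (r M : R) e : 0 < r ->
  (forall z, cabs (z - c) <= r -> z != e -> cdiff f z) -> ccont f e ->
  cabs (e - c) < r / 2 ->
  (forall z, cabs (z - c) <= r -> cabs (f z) <= M) ->
  forall (a b d : R[i]), a != b -> a != d -> b != d ->
    cabs (a - c) < r / 2 -> cabs (b - c) < r / 2 -> cabs (d - c) < r / 2 ->
    cabs (dq f a b - dq f d b) <= 16 * M / r ^+ 2 * cabs (a - d).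
Proof.
move=> r0 fd fe er fM a b d ab ad bd ar br dr.
have er' : cabs (e - c) < r by lra.
have off := dd_bound_off r0 fd fe er' fM.
rewrite -ler_pdivrMr ?cabs_gt0 ?subr_eq0 // -cabsV -cabsM.
have near x y : x != y -> cabs (x - c) < r / 2 -> exists2 d, 0 < d &
    forall z, cabs (z - x) < d -> z != y /\ cabs (z - c) < r / 2.
  move=> xy xr; exists (Num.min (cabs (x - y)) (r / 2 - cabs (x - c))).
    by rewrite lt_min cabs_gt0 !subr_eq0 xy subr_gt0.
  move=> z; rewrite lt_min => /andP[z1 z2]; split.
    by apply: contraTneq z1 => ->; rewrite cabs_distC ltxx.
  by have := cabs_triangle z x c; lra.
have cq x : x != e -> ccont (dq f x) e.
  move=> xe; apply: ccontM.
    exact: ccontD (ccont_cst _ _) (ccontN fe).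
  apply: (@ccontV _ (fun z => x - z)); first by rewrite subr_eq0.
  exact: ccontD (ccont_cst _ _) (ccontN (ccont_id _)).
have cq' x : x != e -> ccont (dq f ^~ x) e.
  by move=> xe; apply: (ccont_near ltr01 _ (cq x xe)) => z _; exact: dqC.
have [ae|ae] := eqVneq a e; last have [be|be] := eqVneq b e; last have [de|de] := eqVneq d e.
- subst a; have [d1 d10 h1] := near e b ab ar; have [d2 d20 h2] := near e d ad ar.
  apply: (@punctured_le (fun z => (dq f z b - dq f d b) / (z - d)) e (Num.min d1 d2)).
  + by rewrite lt_min d10.
  + apply: ccontM; last exact: ccont_shiftV.
    by apply: ccontD (ccont_cst _ _); apply: cq'; rewrite eq_sym.
  + move=> z ze; rewrite lt_min => /andP[/h1[zb zr] /h2[zd _]].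
    by apply: off; rewrite // 1?eq_sym //; lra.
- subst b; have ea : e != a by rewrite eq_sym.
  have [d1 d10 h1] := near e a ea br; have [d2 d20 h2] := near e d bd br.
  apply: (@punctured_le (fun z => (dq f a z - dq f d z) / (a - d)) e (Num.min d1 d2)).
  + by rewrite lt_min d10.
  + apply: ccontM (ccont_cst _ _); apply: ccontD (cq _ ae) (ccontN (cq _ _)).
    by rewrite eq_sym.
  + move=> z ze; rewrite lt_min => /andP[/h1[za zr] /h2[zd _]].
    by apply: off; rewrite // 1?eq_sym //; lra.
- subst d; have ea : e != a by rewrite eq_sym.
  have eb : e != b by rewrite eq_sym.
  have [d1 d10 h1] := near e a ea dr; have [d2 d20 h2] := near e b eb dr.
  apply: (@punctured_le (fun z => (dq f a b - dq f z b) / (a - z)) e (Num.min d1 d2)).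
  + by rewrite lt_min d10.
  + apply: ccontM; first exact: ccontD (ccont_cst _ _) (ccontN (cq' _ be)).
    apply: (@ccontV _ (fun z => a - z)); first by rewrite subr_eq0.
    exact: ccontD (ccont_cst _ _) (ccontN (ccont_id _)).
  + move=> z ze; rewrite lt_min => /andP[/h1[za zr] /h2[zb _]].
    by apply: off; rewrite // 1?eq_sym //; lra.
- by apply: off => //; lra.
Qed.

(** The bound makes the quotients at [p] a Lipschitz function of their other end. A cluster value
    along points tending to [p] is then the derivative, and the Lipschitz estimate becomes the
    quadratic remainder. *)
Lemma is_cderiv_dd f p (d K : R) : 0 < d -> 0 <= K ->
  (forall (a b x : R[i]), a != b -> a != x -> b != x ->
    cabs (a - p) < d -> cabs (b - p) < d -> cabs (x - p) < d ->
    cabs (dq f a b - dq f x b) <= K * cabs (a - x)) ->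
  exists2 A, is_cderiv f p A & forall z, cabs (z - p) < d ->
    cabs (f z - f p - A * (z - p)) <= K * cabs (z - p) ^+ 2.
Proof.
move=> d0 K0 hdd.
have pp : cabs (p - p) < d by rewrite subrr cabs0.
pose x (k : nat) := p + (d / k.+2%:R)%:C.
have xp k : cabs (x k - p) = d / k.+2%:R.
  by rewrite /x addrAC subrr add0r cabs_real gtr0_norm // divr_gt0 // ltr0n.
have xd k : cabs (x k - p) < d.
  by rewrite xp ltr_pdivrMr ?ltr0n // ltr_pMr // ltr1n.
have xnp k : x k != p by rewrite -subr_eq0 -cabs_gt0 xp divr_gt0 // ltr0n.
have dqp z y : z != p -> y != p -> cabs (z - p) < d -> cabs (y - p) < d ->
    cabs (dq f z p - dq f y p) <= K * cabs (z - y).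
  move=> zp yp zd yd; have [->|zy] := eqVneq z y.
    by rewrite !subrr cabs0 mulr0.
  by apply: hdd => //; rewrite eq_sym.
have [|A hA] := @bounded_cluster R 1 (fun k => const_mx (dq f (x k) p))
    (cabs (dq f (x 0%N) p) + K * (2 * d)).
  move=> k; rewrite nrm1E mxE.
  have h1 := dqp (x k) (x 0%N) (xnp _) (xnp _) (xd _) (xd _).
  have h2 : K * cabs (x k - x 0%N) <= K * (2 * d).
    rewrite ler_wpM2l //; have := cabs_triangle (x k) p (x 0%N).
    by rewrite (cabs_distC p); have := xd k; have := xd 0%N; lra.
  by have := cabs_dist_ge (dq f (x k) p) (dq f (x 0%N) p); lra.
have quad z : cabs (z - p) < d ->
    cabs (f z - f p - A 0 0 * (z - p)) <= K * cabs (z - p) ^+ 2.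
  move=> zd; have [->|zp] := eqVneq z p.
    by rewrite !subrr mulr0 subrr cabs0 mulr_ge0 // sqr_ge0.
  have zp0 : z - p != 0 by rewrite subr_eq0.
  rewrite (_ : _ - _ = (dq f z p - A 0 0) * (z - p)); last by rewrite /dq; field.
  rewrite cabsM expr2 mulrA ler_wpM2r ?cabs_ge0 //.
  apply/ler_addgt0Pr => e e0.
  have e1 : 0 < e / 2 by lra.
  have [N hN] := exists_invS_lt (divr_gt0 e1 (ltr_wpDl (mulr_ge0 K0 (ltW d0)) ltr01)).
  have [k Nk] := hA _ e1 N.
  rewrite nrm1E !mxE => h1.
  have h2 := dqp z (x k) zp (xnp _) zd (xd _).
  have h3 : cabs (z - x k) <= cabs (z - p) + d / k.+2%:R.
    by rewrite -xp (cabs_distC (x k)); exact: cabs_triangle.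
  have h4 : K * (d / k.+2%:R) <= e / 2.
    have h := hN _ Nk; have [K1|K1] := eqVneq (K * d) 0.
      by rewrite mulrA K1 mul0r ltW.
    rewrite ltr_pdivlMr in h; last by rewrite ltr_wpDl // mulr_ge0 // ltW.
    apply: le_trans (ltW h); rewrite mulrA mulrC; apply: ler_pM.
    - by rewrite invr_ge0 ler0n.
    - by rewrite mulr_ge0 // ltW.
    - by rewrite lef_pV2 ?posrE ?ltr0n // ler_nat.
    - by rewrite lerDl.
  have h5 := ler_wpM2l K0 h3.
  have h6 := cabs_triangle (dq f z p) (dq f (x k) p) (A 0 0).
  by move: (d / k.+2%:R) h4 h5 => y h4 h5; lra.
exists (A 0 0) => // e e0.
exists (Num.min d (e / (K + 1))); first by rewrite lt_min d0 divr_gt0 // ltr_wpDl.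
move=> z; rewrite lt_min => /andP[/quad h1 h2].
apply: le_trans h1 _; rewrite expr2 mulrA ler_wpM2r ?cabs_ge0 //.
rewrite ltr_pdivlMr in h2; last by rewrite ltr_wpDl.
by have := cabs_ge0 (z - p); lra.
Qed.

Lemma is_cderiv_unique f p a b : is_cderiv f p a -> is_cderiv f p b -> a = b.
Proof.
move=> fa fb; apply/eqP; rewrite -subr_eq0 -cabs_eq0 eq_le cabs_ge0 andbT.
apply/ler_addgt0Pr => e e0; rewrite add0r; have e2 : 0 < e / 2 by lra.
have [d d0 hd] := fa _ e2; have [d' d'0 hd'] := fb _ e2.
pose x := Num.min d d' / 2.
have m0 : 0 < Num.min d d' by rewrite lt_min d0.
have x0 : 0 < x by rewrite divr_gt0.
have : x < Num.min d d' by rewrite /x; lra.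
rewrite lt_min => /andP[xd xd'].
have xE : cabs (p + x%:C - p) = x by rewrite addrAC subrr add0r cabs_real gtr0_norm.
have h1 := hd (p + x%:C); have h2 := hd' (p + x%:C); rewrite xE in h1 h2.
have {}h1 := h1 xd; have {}h2 := h2 xd'.
rewrite -(ler_pM2r x0) -{1}xE -cabsM.
rewrite (_ : (a - b) * _ = (f (p + x%:C) - f p - b * (p + x%:C - p)) - (f (p + x%:C) - f p - a * (p + x%:C - p))); last by ring.
by apply: le_trans (cabsB _ _) _; lra.
Qed.

Lemma removable_bound f c (r M : R) e : 0 < r ->
  (forall z, cabs (z - c) <= r -> z != e -> cdiff f z) -> ccont f e ->
  cabs (e - c) < r / 2 ->
  (forall z, cabs (z - c) <= r -> cabs (f z) <= M) -> cdiff f e.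
Proof.
move=> r0 fd fe er fM; have h := dd_bound r0 fd fe er fM.
have d0 : 0 < r / 2 - cabs (e - c) by rewrite subr_gt0.
have M0 : 0 <= M by apply: le_trans (cabs_ge0 _) (fM c _); rewrite subrr cabs0 ltW.
have K0 : 0 <= 16 * M / r ^+ 2 by rewrite divr_ge0 ?mulr_ge0 // ltW.
have [|A] := @is_cderiv_dd f e _ (16 * M / r ^+ 2) d0 K0; last by exists A.
move=> a b x ab ax bx ae be xe; apply: h => //.
- by have := cabs_triangle a e c; lra.
- by have := cabs_triangle b e c; lra.
- by have := cabs_triangle x e c; lra.
Qed.

Lemma removable f e (d : R) : 0 < d ->
  (forall z, cabs (z - e) < d -> z != e -> cdiff f z) -> ccont f e -> cdiff f e.
Proof.
move=> d0 fd fe; have [d' d'0 hd'] := fe 1 ltr01.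
have m0 : 0 < Num.min d d' by rewrite lt_min d0.
have r0 : 0 < Num.min d d' / 2 by rewrite divr_gt0.
have near z : cabs (z - e) <= Num.min d d' / 2 -> cabs (z - e) < d /\ cabs (z - e) < d'.
  move=> h; have : cabs (z - e) < Num.min d d' by lra.
  by rewrite lt_min => /andP[].
apply: (@removable_bound f e _ (cabs (f e) + 1) e r0) => //.
- by move=> z /near[h _]; exact: fd.
- by rewrite subrr cabs0 divr_gt0.
- move=> z /near[_ /hd' h]; have := cabs_dist_ge (f z) (f e); lra.
Qed.

Lemma cderiv_quad f p (r M : R) A : 0 < r ->
  (forall z, cabs (z - p) <= r -> cdiff f z) ->
  (forall z, cabs (z - p) <= r -> cabs (f z) <= M) -> is_cderiv f p A ->
  forall z, cabs (z - p) < r / 2 ->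
    cabs (f z - f p - A * (z - p)) <= 16 * M / r ^+ 2 * cabs (z - p) ^+ 2.
Proof.
move=> r0 fd fM fA.
have pp : cabs (p - p) = 0 by rewrite subrr cabs0.
have fp : ccont f p by apply: cdiff_cont; apply: fd; rewrite pp ltW.
have M0 : 0 <= M by apply: le_trans (cabs_ge0 _) (fM p _); rewrite pp ltW.
have [||| B fB h] := @is_cderiv_dd f p (r / 2) (16 * M / r ^+ 2).
- by rewrite divr_gt0.
- by rewrite divr_ge0 ?mulr_ge0 // ltW.
- apply: (dd_bound r0 _ fp _ fM); last by rewrite pp divr_gt0.
  by move=> z zr _; exact: fd.
- by rewrite (is_cderiv_unique fA fB).
Qed.

(** The bound on second divided differences depends on [r] and [M] only and passes to pointwise
    limits. *)
Lemma limit_cdiff (F : nat -> R[i] -> R[i]) f p (r M : R) : 0 < r ->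
  (forall k z, cabs (z - p) <= r -> cdiff (F k) z) ->
  (forall k z, cabs (z - p) <= r -> cabs (F k z) <= M) ->
  (forall z, cabs (z - p) <= r -> forall e : R, 0 < e ->
    exists N : nat, forall k, (N <= k)%N -> cabs (F k z - f z) <= e) ->
  cdiff f p.
Proof.
move=> r0 Fd FM Ff; have r2 : 0 < r / 2 by rewrite divr_gt0.
have pp : cabs (p - p) = 0 by rewrite subrr cabs0.
have M0 : 0 <= M by apply: le_trans (cabs_ge0 _) (FM 0%N p _); rewrite pp ltW.
have K0 : 0 <= 16 * M / r ^+ 2 by rewrite divr_ge0 ?mulr_ge0 // ltW.
have [|A] := @is_cderiv_dd f p (r / 2) (16 * M / r ^+ 2) r2 K0; last by exists A.
move=> a b x ab ax bx ar br xr; apply/ler_addgt0Pr => e e0.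
(* [T] collects the factors by which the errors [F k - f] at [a], [b] and [x] are multiplied in the
   second differences; the last 1 makes it positive. *)
pose T := (cabs (a - b))^-1 + (cabs (b - a))^-1 + (cabs (x - b))^-1 + (cabs (b - x))^-1 + 1.
have T0 : 0 < T by rewrite ltr_wpDl // !addr_ge0 ?invr_ge0 ?cabs_ge0.
have eT : 0 < e / T by rewrite divr_gt0.
have [|N1 h1] := Ff a _ _ eT; first by lra.
have [|N2 h2] := Ff b _ _ eT; first by lra.
have [|N3 h3] := Ff x _ _ eT; first by lra.
pose k := maxn N1 (maxn N2 N3).
have {}h1 := h1 k (leq_maxl _ _).
have {}h2 : cabs (F k b - f b) <= e / T by apply: h2; rewrite /k !leq_max leqnn orbT.
have {}h3 : cabs (F k x - f x) <= e / T by apply: h3; rewrite /k !leq_max leqnn !orbT.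
have Fp : ccont (F k) p by apply: cdiff_cont; apply: Fd; rewrite pp ltW.
have := @dd_bound (F k) p r M p r0 (fun z zr _ => Fd k z zr) Fp _ (FM k) a b x ab ax bx ar br xr.
rewrite pp => /(_ r2) h4.
rewrite (_ : dq f a b - dq f x b = (dq (F k) a b - dq (F k) x b)
  - ((F k a - f a) / (a - b) + (F k b - f b) / (b - a)
     - (F k x - f x) / (x - b) - (F k b - f b) / (b - x))); last first.
  by rewrite /dq; field; rewrite !subr_eq0 ?ab ?bx ?(eq_sym b a) ?(eq_sym x b) ?ab ?bx.
apply: le_trans (cabsB _ _) _; apply: lerD h4 _.
apply: le_trans (cabsB _ _) _; apply: le_trans (lerD (cabsB _ _) (lexx _)) _.
apply: le_trans (lerD (lerD (cabsD _ _) (lexx _)) (lexx _)) _.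
rewrite !cabsM !cabsV.
have q u v : cabs u <= e / T -> cabs u / cabs v <= e / T * (cabs v)^-1.
  by move=> h; rewrite ler_wpM2r ?invr_ge0 ?cabs_ge0.
have eE : e / T * T = e by rewrite divfK // gt_eqF.
have := q _ (a - b) h1; have := q _ (b - a) h2.
have := q _ (x - b) h3; have := q _ (b - x) h2.
move: eE eT; move: (e / T) => y; rewrite /T => eE eT; lra.
Qed.

End OneVariable.

(** * Averages over roots of unity and propagation of smallness *)

Section Propagation.
Set Implicit Arguments.
Unset Strict Implicit.
Variable R : realType.
Implicit Types (f g : R[i] -> R[i]) (z w : R[i]).

Lemma cabs_prim_root n (w : R[i]) : (0 < n)%N -> n.-primitive_root w -> cabs w = 1.
Proof.
move=> n0 /prim_expr_order wn; apply/eqP.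
by rewrite -(@pexpr_eq1 _ _ n) ?cabs_ge0 // -cabsX wn cabs1.
Qed.

(* The average over the [n]-th roots of unity is invariant under rotation by
   [w], so that its first [n] Taylor coefficients other than the constant one
   vanish. *)
Lemma mean_roots f (n : nat) w (r r1 M : R) : (0 < n)%N -> n.-primitive_root w ->
  0 < r -> r < r1 -> (forall z, cabs z < r1 -> cdiff f z) ->
  (forall z, cabs z <= r -> cabs (f z) <= M) ->
  forall z, cabs z <= r ->
    cabs (n%:R^-1 * (\sum_(j < n) f (w ^+ j * z)) - f 0) <= 2 * M * (cabs z / r) ^+ n.
Proof.
move=> n0 wn r0 rr1 fd fM.
have w1 := cabs_prim_root n0 wn.
have wX j : cabs (w ^+ j) = 1 by rewrite cabsX w1 expr1n.
have r10 : 0 < r1 by exact: lt_trans rr1.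
pose A z := n%:R^-1 * (\sum_(j < n) f (w ^+ j * z)) - f 0.
have Ad z : cabs z < r1 -> cdiff A z.
  move=> zr; apply: cdiffB; last exact: cdiff_cst.
  apply: cdiffM; first exact: cdiff_cst.
  apply: cdiff_sum => j _; apply: cdiff_comp.
    exact: cdiffM (cdiff_cst _ _) (cdiff_id _).
  by apply: fd; rewrite cabsM wX mul1r.
have Aw z : A (w * z) = A z.
  rewrite /A; congr (_ * _ - _); case: n n0 wn {A Ad} => // n _ /prim_expr_order wn.
  rewrite big_ord_recr [RHS]big_ord_recl /= expr0 mul1r addrC; congr (_ + _).
    by rewrite mulrA -exprSr wn mul1r.
  by apply: eq_bigr => j _; rewrite mulrA -exprSr.
have nn : n%:R != 0 :> R[i] by rewrite pnatr_eq0 -lt0n.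
have A0 : A 0 = 0.
  rewrite /A (eq_bigr (fun=> f 0)) => [|j _]; last by rewrite mulr0.
  by rewrite sumr_const card_ord -[f 0 *+ n]mulr_natl mulKf // subrr.
(* Division of [A] by [z], repeated [n] times; [u 0] is the next Taylor coefficient. *)
have : forall k, (k <= n)%N -> exists2 u, (forall z, cabs z < r1 -> cdiff u z) &
    forall z, A z = z ^+ k * u z.
  elim=> [_|k ih kn]; first by exists A => // z; rewrite expr0 mul1r.
  have [u ud Au] := ih (ltnW kn).
  (* For [k = 0] this is [A 0 = 0]. Otherwise rotation invariance gives [w^k u (w z) = u z], and
     [w^k] differs from 1 because [0 < k < n]. *)
  have u0 : u 0 = 0.
    case: k kn {ih} Au => [_ /(_ 0)|k kn Au]; first by rewrite A0 expr0 mul1r.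
    have uc : ccont u 0 by apply: cdiff_cont; apply: ud; rewrite cabs0.
    have : cabs (w ^+ k.+1 * u (w * 0) - u 0) <= 0.
      apply: (@punctured_le _ (fun z => w ^+ k.+1 * u (w * z) - u z) 0 1 0) => //.
        apply: ccontD; last exact: ccontN.
        apply: ccontM (ccont_cst _ _) _; apply: ccont_comp; last by rewrite mulr0.
        exact: ccontM (ccont_cst _ _) (ccont_id _).
      move=> z z0 _; have := Aw z; rewrite !Au exprMn -!mulrA mulrCA.
      by move=> /(mulfI (expf_neq0 _ z0)) ->; rewrite subrr cabs0.
    rewrite mulr0 -{2}[u 0]mul1r -mulrBl => h.
    have {h} : (w ^+ k.+1 - 1) * u 0 == 0 by rewrite -cabs_eq0 eq_le h cabs_ge0.
    rewrite mulf_eq0 => /orP[|/eqP //]; rewrite subr_eq0 -(prim_order_dvd wn) => h.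
    by have := dvdn_leq (ltn0Sn k) h; rewrite leqNgt kn.
  have [|q [uq qc]] := (cdiffP u 0).1 (ud 0 _); first by rewrite cabs0.
  have uE z : u z = q z * z by rewrite uq u0 add0r subr0.
  exists q; last by move=> z; rewrite Au uE exprS; ring.
  have qd z : cabs z < r1 -> z != 0 -> cdiff q z.
    move=> zr z0; apply: (@cdiff_near _ (fun z => u z / z) _ _ (cabs z)).
    - by rewrite cabs_gt0.
    - move=> x xz; rewrite uE mulfK //; apply: contraTneq xz => ->.
      by rewrite sub0r cabsN ltxx.
    - exact: cdiff_div (ud _ zr) (cdiff_id _).
  move=> z zr; have [->|] := eqVneq z 0; last exact: qd.
  apply: (@removable _ _ _ r1) => //.
  by move=> x; rewrite subr0; exact: qd.
move=> /(_ n (leqnn _))[u ud Au] z zr; rewrite -/(A z) Au cabsM cabsX expr_div_n.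
rewrite mulrA mulrAC mulrC ler_wpM2r ?exprn_ge0 ?cabs_ge0 //.
have M0 : 0 <= M by apply: le_trans (cabs_ge0 _) (fM 0 _); rewrite cabs0 ltW.
have AM x : cabs x <= r -> cabs (A x) <= 2 * M.
  move=> xr; apply: le_trans (cabsB _ _) _.
  have h1 : cabs (f 0) <= M by apply: fM; rewrite cabs0 ltW.
  suff h2 : cabs (n%:R^-1 * \sum_(j < n) f (w ^+ j * x)) <= M by lra.
  rewrite cabsM cabsV cabs_nat mulrC ler_pdivrMr ?ltr0n //.
  have -> : M * n%:R = \sum_(j < n) M by rewrite sumr_const card_ord mulr_natr.
  elim/big_ind2: _ => [|x1 x2 y1 y2 h2 h3|j _]; first by rewrite cabs0.
    by apply: le_trans (cabsD _ _) (lerD h2 h3).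
  by apply: fM; rewrite cabsM wX mul1r.
apply: (@max_disc _ u 0 r) => //; last by rewrite subr0.
- by rewrite divr_ge0 ?mulr_ge0 // exprn_ge0 // ltW.
- by move=> x; rewrite subr0 => xr; apply: ud; exact: le_lt_trans rr1.
- move=> x; rewrite subr0 => xr; rewrite ler_pdivlMr ?exprn_gt0 //.
  by rewrite mulrC -xr -cabsX -cabsM -Au AM // xr.
Qed.

(** Hadamard's three circles theorem with an integer exponent: the maximum principle for [f z / z^k]
    on the annulus [dl <= |z| <= 2], read at 1. The exponent is chosen by the user of the lemma. *)
Lemma three_circles f (dl C eps : R) (k : nat) : 0 < dl <= 1 ->
  (forall z, cabs z <= 2 -> cdiff f z) -> (forall z, cabs z <= 2 -> cabs (f z) <= C) ->
  (forall z, cabs z <= dl -> cabs (f z) <= eps) ->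
  cabs (f 1) <= Num.max (C / 2 ^+ k) (eps / dl ^+ k).
Proof.
move=> /andP[dl0 dl1] fd fC fe; set m := Num.max _ _.
have C0 : 0 <= C by apply: le_trans (cabs_ge0 _) (fC 0 _); rewrite cabs0.
rewrite -[f 1]divr1 -[X in f 1 / X](expr1n _ k).
have zn z : dl <= cabs z -> z != 0 by rewrite -cabs_gt0; exact: lt_le_trans.
apply: (@max_principle _ [set z | dl <= cabs (z - 0) <= 2] (fun z => f z / z ^+ k) m).
- by rewrite le_max divr_ge0 ?exprn_ge0.
- exact: ccompact_annulus.
- apply: ccont_cabs_cont => p /=; rewrite subr0 => /andP[p1 p2].
  apply: cdiff_cont; apply: cdiff_div; rewrite ?expf_neq0 ?zn //; first exact: fd.
  exact: cdiffX (cdiff_id _).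
- move=> p /=; rewrite subr0 => /andP[]; rewrite le_eqVlt => /orP[/eqP p1|p1].
    move=> _; left; rewrite cabsM cabsV cabsX -p1 le_max; apply/orP; right.
    by rewrite ler_pM2r ?invr_gt0 ?exprn_gt0 // fe // p1.
  rewrite le_eqVlt => /orP[/eqP p2|p2].
    left; rewrite cabsM cabsV cabsX p2 le_max; apply/orP; left.
    by rewrite ler_pM2r ?invr_gt0 ?exprn_gt0 // fC // p2.
  right; exists (Num.min (cabs p - dl) (2 - cabs p)).
    by rewrite lt_min !subr_gt0 p1.
  move=> z; rewrite lt_min subr0 => /andP[h1 h2].
  have h3 : cabs z < 2 by have := cabsD (z - p) p; rewrite subrK; lra.
  have h4 : dl < cabs z.
    by have := cabs_dist_ge p z; rewrite cabs_distC; lra.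
  split; first by apply/andP; split; exact: ltW.
  apply: cdiff_div; rewrite ?expf_neq0 ?zn ?ltW //; first by apply: fd; exact: ltW.
  exact: cdiffX (cdiff_id _).
- by rewrite /mkset subr0 cabs1 dl1 ler1n.
Qed.

(** The maximum principle accepts points where the function vanishes, so it applies to [f z / z^k]
    on [dl <= |z| <= r], and the inner circle contributes nothing. The bound
    [|f z0| <= M (|z0| / r)^k] for every [k] gives [f z0 = 0]. *)
Lemma rado f (dl r : R) : 0 < dl ->
  (forall z, cabs z <= r -> ccont f z) ->
  (forall z, cabs z < r -> f z = 0 \/
    exists2 d, 0 < d & forall x, cabs (x - z) < d -> cdiff f x) ->
  (forall z, cabs z <= dl -> f z = 0) ->
  forall z, cabs z < r -> f z = 0.
Proof.
move=> dl0 fc fd f0 z0 z0r.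
have [/f0 //|z0dl] := lerP (cabs z0) dl.
have r0 : 0 < r by apply: le_lt_trans z0r; exact: cabs_ge0.
have [M M0 fM] : exists2 M, 0 <= M & forall z, cabs z <= r -> cabs (f z) <= M.
  have [||||p pr hp] := @extreme_value1 R [set z | cabs z <= r] (fun z => cabs (f z)) r.
  - by exists z0; exact: ltW.
  - by [].
  - have [_ h] := ccompact_annulus 0 0 r.
    move=> p hp; have := h p; rewrite /= subr0 => h'; have [|//] := andP (h' _).
    by move=> e /hp[q qr qp]; exists q => //; rewrite subr0 cabs_ge0.
  - exact: ccont_cabs_cont.
  by exists (cabs (f p)); [exact: cabs_ge0|exact: hp].
have zn z : dl <= cabs z -> z != 0 by rewrite -cabs_gt0; exact: lt_le_trans.
have key k : cabs (f z0) / cabs z0 ^+ k <= M / r ^+ k.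
  rewrite -cabsX -cabsV -cabsM.
  apply: (@max_principle _ [set z | dl <= cabs (z - 0) <= r] (fun z => f z / z ^+ k)).
  - by rewrite divr_ge0 // exprn_ge0 // ltW.
  - exact: ccompact_annulus.
  - apply: ccont_cabs_cont => p /=; rewrite subr0 => /andP[p1 p2].
    apply: ccontM; first exact: fc.
    apply: (@ccontV _ (fun z => z ^+ k)); first by rewrite expf_neq0 ?zn.
    by apply: cdiff_cont; exact: cdiffX (cdiff_id _).
  - move=> p /=; rewrite subr0 => /andP[]; rewrite le_eqVlt => /orP[/eqP p1|p1].
      by move=> _; left; rewrite f0 ?mul0r ?cabs0 ?divr_ge0 ?exprn_ge0 ?(ltW r0) // p1.
    rewrite le_eqVlt => /orP[/eqP p2|p2].
      left; rewrite cabsM cabsV cabsX p2.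
      by rewrite ler_pM2r ?invr_gt0 ?exprn_gt0 // fM // p2.
    have [fp|[d d0 hd]] := fd p p2.
      by left; rewrite fp mul0r cabs0 divr_ge0 // exprn_ge0 // ltW.
    right; exists (Num.min d (Num.min (cabs p - dl) (r - cabs p))).
      by rewrite !lt_min d0 !subr_gt0 p1.
    move=> z; rewrite !lt_min subr0 => /and3P[/hd fz h1 h2].
    have h3 : cabs z < r by have := cabsD (z - p) p; rewrite subrK; lra.
    have h4 : dl < cabs z.
      by have := cabs_dist_ge p z; rewrite cabs_distC; lra.
    split; first by apply/andP; split; exact: ltW.
    apply: cdiff_div; rewrite ?expf_neq0 ?zn ?ltW //.
    exact: cdiffX (cdiff_id _).
  - by rewrite /= subr0 !ltW.
apply: cabs0_eq0; apply/eqP; apply: contraT => fz0.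
have fz : 0 < cabs (f z0) by rewrite lt_def fz0 cabs_ge0.
have : r <= cabs z0.
  apply: (@pow_bound _ _ _ (M / cabs (f z0))); first exact: cabs_ge0.
  move=> k; have := key k; rewrite ler_pdivrMr ?exprn_gt0 ?(lt_trans dl0) //.
  by rewrite mulrAC ler_pdivlMr ?exprn_gt0 // mulrAC ler_pdivlMr // mulrC.
by rewrite leNgt z0r.
Qed.

End Propagation.

(** * Differentiation in several variables *)

Section Frechet.
Set Implicit Arguments.
Unset Strict Implicit.
Variables (R : realType) (n : nat).
Local Notation V := 'rV[R[i]]_n.
Implicit Types (f g : V -> V) (z h w p q : V) (A : 'M[R[i]]_n) (c : R[i] -> V).

Lemma nrm_triangle z p q : nrm (z - q) <= nrm (z - p) + nrm (p - q).
Proof. by rewrite -[z - q](subrKA p) nrmD. Qed.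

Lemma nrm_mul h A : nrm (h *m A) <= nrm h * mnrm A.
Proof. exact: nrm_mulmx. Qed.

(** Vectors are rows and act from the left, so [A] is the transpose of the usual Jacobian matrix. *)
Definition is_frechet f z A := forall e : R, 0 < e -> exists2 d : R, 0 < d &
  forall h, nrm h < d -> nrm (f (z + h) - f z - h *m A) <= e * nrm h.

Definition vcont f z := forall e : R, 0 < e -> exists2 d : R, 0 < d &
  forall w, nrm (w - z) < d -> nrm (f w - f z) < e.

Lemma frechet_cont f z A : is_frechet f z A -> vcont f z.
Proof.
move=> fz e e0; have [d d0 hd] := fz 1 ltr01.
pose B := 2 + mnrm A; have B0 : 0 < B by have := mnrm_ge0 A; rewrite /B; lra.
exists (Num.min d (e / B)); first by rewrite lt_min d0 divr_gt0.
move=> w; rewrite lt_min => /andP[h1 h2].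
have := hd _ h1; rewrite (addrC z) subrK mul1r => h3.
rewrite (_ : f w - f z = (f w - f z - (w - z) *m A) + (w - z) *m A); last by rewrite subrK.
apply: le_lt_trans (nrmD _ _) _.
have h4 := nrm_mul (w - z) A; rewrite ltr_pdivlMr // in h2.
by have := nrm_ge0 (w - z); rewrite /B in h2; lra.
Qed.

Definition is_vderiv c (t : R[i]) h := forall e : R, 0 < e -> exists2 d : R, 0 < d &
  forall s, cabs (s - t) < d -> nrm (c s - c t - (s - t) *: h) <= e * cabs (s - t).

Lemma is_vderiv_comp c t h j : is_vderiv c t h -> is_cderiv (fun s => c s 0 j) t (h 0 j).
Proof.
move=> ct e /ct[d d0 hd]; exists d => // s /hd; apply: le_trans.
rewrite [X in cabs X](_ : _ = (c s - c t - (s - t) *: h) 0 j); last first.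
  by rewrite !mxE; ring.
exact: cabs_le_nrm.
Qed.

Lemma is_vderiv_line z h t : is_vderiv (fun s => z + s *: h) t h.
Proof.
move=> e e0; exists 1 => // s _; rewrite (_ : _ - _ - _ = 0).
  by rewrite nrm0 mulr_ge0 ?cabs_ge0 // ltW.
by apply/rowP => j; rewrite !mxE; ring.
Qed.

Lemma is_vderiv_shift c t h p : is_vderiv c t h -> is_vderiv (fun s => c s + p) t h.
Proof. by move=> ct e /ct[d d0 hd]; exists d => // s /hd; rewrite opprD addrACA subrr addr0. Qed.

Lemma chain_rule f c t h A : is_frechet f (c t) A -> is_vderiv c t h ->
  is_vderiv (fun s => f (c s)) t (h *m A).
Proof.
move=> fA ch e e0.
pose B := mnrm A + nrm h + 1.
have A0 := mnrm_ge0 A; have h0 := nrm_ge0 h.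
have B0 : 0 < B by rewrite /B; lra.
pose e1 := Num.min 1 (e / (2 * B)).
have e10 : 0 < e1 by rewrite lt_min ltr01 divr_gt0 // mulr_gt0.
have e11 : e1 <= 1 by rewrite ge_min lexx.
have e12 : e1 * (2 * B) <= e by rewrite -ler_pdivlMr ?mulr_gt0 // ge_min lexx orbT.
have [d d0 hd] := fA _ e10; have [d' d'0 hd'] := ch _ e10.
exists (Num.min d' (d / B)); first by rewrite lt_min d'0 divr_gt0.
move=> s; rewrite lt_min => /andP[/hd' h1 h2].
have s0 := cabs_ge0 (s - t).
have h3 : nrm (c s - c t) <= cabs (s - t) * (nrm h + e1).
  rewrite (_ : c s - c t = (c s - c t - (s - t) *: h) + (s - t) *: h); last by rewrite subrK.
  by apply: le_trans (nrmD _ _) _; rewrite nrmZ; lra.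
have h4 : nrm (c s - c t) <= cabs (s - t) * B.
  by apply: le_trans h3 _; rewrite ler_wpM2l // /B; lra.
have h5 : nrm (c s - c t) < d by apply: le_lt_trans h4 _; rewrite -ltr_pdivlMr.
have := hd _ h5; rewrite (addrC (c t)) subrK => h6.
rewrite (_ : _ - _ - _ = (f (c s) - f (c t) - (c s - c t) *m A)
   + (c s - c t - (s - t) *: h) *m A); last first.
  by rewrite (mulmxBl _ ((s - t) *: h)) -scalemxAl addrA subrK.
apply: le_trans (nrmD _ _) _.
have h7 := nrm_mul (c s - c t - (s - t) *: h) A.
have h8 := ler_wpM2r A0 h1.
have h9 := ler_wpM2l (ltW e10) h4.
have h10 := ler_wpM2r s0 e12.
have : e1 * cabs (s - t) * mnrm A <= e1 * cabs (s - t) * B.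
  by rewrite ler_wpM2l ?mulr_ge0 ?(ltW e10) // /B; lra.
move: (mnrm A) (nrm h) h6 h7 h8 h9 h10 => *; lra.
Qed.

Lemma frechet_line_cdiff f z h A t j : is_frechet f (z + t *: h) A ->
  is_cderiv (fun s => f (z + s *: h) 0 j) t ((h *m A) 0 j).
Proof.
move=> fA; apply: (@is_vderiv_comp (fun s => f (z + s *: h))).
by apply: chain_rule fA _; exact: is_vderiv_line.
Qed.

(** On the complex line through [z] in the direction [h] the coordinates of [f] are holomorphic
    functions of one variable, and their quadratic remainder at [s = 1] depends only on a bound for
    [f]. Thus the remainder is uniform in [z], with nothing assumed on the continuity of [D]. *)
Lemma frechet_quad f (D : V -> 'M[R[i]]_n) z0 (d : R) : 0 < d ->
  (forall z, nrm (z - z0) < d -> is_frechet f z (D z)) ->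
  exists r C : R, [/\ 0 < r, r <= d, 0 <= C &
    forall z h, nrm (z - z0) < r -> nrm h < r ->
      nrm (f (z + h) - f z - h *m D z) <= C * nrm h ^+ 2].
Proof.
move=> d0 fD.
have z00 : nrm (z0 - z0) < d by rewrite subrr nrm0.
have [d' d'0 hd'] := frechet_cont (fD _ z00) ltr01.
have [rho [rho0 rd rd']] : exists rho, [/\ 0 < rho, rho < d & rho < d'].
  exists (Num.min d d' / 2).
  have m0 : 0 < Num.min d d' by rewrite lt_min d0.
  have : Num.min d d' / 2 < Num.min d d' by lra.
  by rewrite lt_min => /andP[-> ->]; rewrite divr_gt0.
pose M := nrm (f z0) + 1.
have fM z : nrm (z - z0) <= rho -> nrm (f z) <= M.
  move=> zr; have /hd' h1 : nrm (z - z0) < d' by lra.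
  by have := nrm_dist_ge (f z) (f z0); rewrite /M; lra.
have M0 : 0 <= M by rewrite addr_ge0 ?nrm_ge0.
pose C := 64 * M / rho ^+ 2.
have C0 : 0 <= C by rewrite divr_ge0 ?mulr_ge0 // ltW.
exists (rho / 4), (n%:R * C); split.
- by rewrite divr_gt0.
- lra.
- by rewrite mulr_ge0.
move=> z h zr hr; rewrite -mulrA; apply: nrm_le => j.
have [h0|h0] := eqVneq (nrm h) 0.
  rewrite (nrm0_eq0 h0) addr0 subrr mul0mx subrr mxE cabs0 nrm0 expr0n mulr0 //.
have hp : 0 < nrm h by rewrite lt_def h0 nrm_ge0.
(* For [|s| <= r] the point [z + s h] is within [rho / 4 + rho / 2] of [z0], and [nrm h < rho / 4]
   puts [s = 1] inside the radius [r / 2]. The bound [16 M / r^2] is then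
   [64 M (nrm h)^2 / rho^2]. *)
pose r := rho / (2 * nrm h).
have r0 : 0 < r by rewrite divr_gt0 // mulr_gt0.
have rh : r * nrm h = rho / 2 by rewrite /r; field.
have near s : cabs (s - 0) <= r -> nrm (z + s *: h - z0) <= rho.
  rewrite subr0 => sr; rewrite addrAC; apply: le_trans (nrmD _ _) _; rewrite nrmZ.
  by have := ler_wpM2r (ltW hp) sr; lra.
pose phi s := f (z + s *: h) 0 j.
have phid s : cabs (s - 0) <= r -> cdiff phi s.
  move=> sr; exists ((h *m D (z + s *: h)) 0 j); apply: frechet_line_cdiff; apply: fD.
  exact: le_lt_trans (near s sr) _.
have phiM s : cabs (s - 0) <= r -> cabs (phi s) <= M.
  by move=> sr; apply: le_trans (cabs_le_nrm _ _) (fM _ (near s sr)).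
have phi0 : is_cderiv phi 0 ((h *m D (z + 0 *: h)) 0 j).
  by apply: frechet_line_cdiff; apply: fD; rewrite scale0r addr0; lra.
have r2 : cabs (1 - 0 : R[i]) < r / 2.
  by rewrite subr0 cabs1 /r ltr_pdivlMr // ltr_pdivlMr ?mulr_gt0 //; lra.
have := cderiv_quad r0 phid phiM phi0 r2.
rewrite /phi scale0r addr0 scale1r !subr0 mulr1 cabs1 expr1n mulr1.
rewrite (_ : 16 * M / r ^+ 2 = C * nrm h ^+ 2).
  by congr (cabs _ <= _); rewrite !mxE; ring.
by rewrite /C /r; field; rewrite h0 gt_eqF.
Qed.

(** [h (D z' - D z)] is a combination of three remainders, with increments [k + h], [k] and [h]. For
    [h] of the size of [k] along a basis vector they add up to [4 + 1 + 1 = 6] times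
    [C (nrm k)^2]. *)
Lemma frechet_lip f (D : V -> 'M[R[i]]_n) z0 (r C : R) : 0 <= C ->
  (forall z h, nrm (z - z0) < r -> nrm h < r ->
      nrm (f (z + h) - f z - h *m D z) <= C * nrm h ^+ 2) ->
  forall z z', nrm (z - z0) < r / 2 -> nrm (z' - z0) < r / 2 -> nrm (z' - z) < r / 2 ->
    mnrm (D z' - D z) <= n%:R * (6 * C) * nrm (z' - z).
Proof.
move=> C0 fq z z' zr z'r zz'.
set k := z' - z; have k0 : 0 <= nrm k by exact: nrm_ge0.
have [/eqP k00|kn] := eqVneq (nrm k) 0.
  have -> : z' = z by apply/eqP; rewrite -subr_eq0; apply/eqP/nrm0_eq0/eqP.
  rewrite subrr /mnrm big1 ?mulr_ge0 // => i _; rewrite big1 // => j _.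
  by rewrite mxE cabs0.
have kp : 0 < nrm k by rewrite lt_def kn.
rewrite /mnrm -mulrA; apply: ler_sum_const => i.
pose h : V := (nrm k)%:C *: delta_mx 0 i.
have hk : nrm h = nrm k.
  rewrite nrmZ cabs_real ger0_norm // -[RHS]mulr1; congr (_ * _).
  rewrite /nrm (bigD1 i) //= mxE !eqxx cabs1 big1 ?addr0 // => j ji.
  by rewrite mxE eqxx /= (negPf ji) cabs0.
have hD : nrm (h *m (D z' - D z)) = nrm k * \sum_j cabs ((D z' - D z) i j).
  rewrite -scalemxAl nrmZ cabs_real ger0_norm // -rowE; congr (_ * _).
  by apply: eq_bigr => j _; rewrite mxE.
rewrite -(ler_pM2l kp) -hD.
rewrite (_ : h *m _ = (f (z + (k + h)) - f z - (k + h) *m D z)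
   - (f (z + k) - f z - k *m D z) - (f (z' + h) - f z' - h *m D z')); last first.
  rewrite mulmxBr mulmxDl addrA (_ : z + k = z'); last by rewrite /k addrC subrK.
  move: (f _) (f z') (f z) (k *m _) (h *m D z) (h *m D z') => a b cc d e g.
  by apply/rowP => j; rewrite !mxE; ring.
apply: le_trans (nrmB _ _) _; apply: le_trans (lerD (nrmB _ _) (lexx _)) _.
have kh : nrm (k + h) <= 2 * nrm k by have := nrmD k h; rewrite hk; lra.
have h1 : nrm (f (z + (k + h)) - f z - (k + h) *m D z) <= C * nrm (k + h) ^+ 2.
  by apply: fq; rewrite -/k in zz'; lra.
have h2 : nrm (f (z + k) - f z - k *m D z) <= C * nrm k ^+ 2.
  by apply: fq; rewrite -/k in zz'; lra.
have h3 : nrm (f (z' + h) - f z' - h *m D z') <= C * nrm h ^+ 2.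
  by apply: fq; rewrite ?hk; rewrite -/k in zz'; lra.
rewrite hk in h3.
have h4 : nrm (k + h) ^+ 2 <= (2 * nrm k) ^+ 2.
  by rewrite lerXn2r ?nnegrE ?nrm_ge0 ?mulr_ge0.
have := ler_wpM2l C0 h4; lra.
Qed.

End Frechet.

(** * Jacobian determinant and inverse maps *)

Section Jacobian.
Set Implicit Arguments.
Unset Strict Implicit.
Variables (R : realType) (n : nat).
Local Notation V := 'rV[R[i]]_n.
Implicit Types (f g : V -> V) (z h w p q : V) (A : 'M[R[i]]_n) (c : R[i] -> V).

Lemma nrm_delta (a : R[i]) (i : 'I_n) : nrm (a *: delta_mx 0 i : V) = cabs a.
Proof.
rewrite nrmZ -[RHS]mulr1; congr (_ * _).
rewrite /nrm (bigD1 i) //= mxE !eqxx cabs1 big1 ?addr0 // => j ji.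
by rewrite mxE eqxx /= (negPf ji) cabs0.
Qed.

Lemma cabs_le_mnrm A i j : cabs (A i j) <= mnrm A.
Proof.
rewrite /mnrm (bigD1 i) //= (bigD1 j) //= -addrA lerDl.
by rewrite addr_ge0 // !sumr_ge0 // => k _; rewrite ?cabs_ge0 // sumr_ge0 // => l _; exact: cabs_ge0.
Qed.

Variables (f : V -> V) (D : V -> 'M[R[i]]_n).

Lemma vderiv_cont c t v : is_vderiv c t v ->
  forall e : R, 0 < e -> exists2 d : R, 0 < d & forall s, cabs (s - t) < d -> nrm (c s - c t) < e.
Proof.
move=> /(_ 1 ltr01)[d d0 hd] e e0.
have B0 : 0 < nrm v + 1 by rewrite ltr_wpDl ?nrm_ge0.
exists (Num.min d (e / (nrm v + 1))); first by rewrite lt_min d0 divr_gt0.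
move=> s; rewrite lt_min => /andP[/hd h1]; rewrite ltr_pdivlMr // => h2.
rewrite (_ : c s - c t = (c s - c t - (s - t) *: v) + (s - t) *: v); last by rewrite subrK.
by apply: le_lt_trans (nrmD _ _) _; rewrite nrmZ; lra.
Qed.

(** An entry of [D] along the curve is the limit of the difference quotients [F k] of [f] in a basis
    direction. These are holomorphic in the parameter and uniformly bounded. *)
Lemma entry_curve_cdiff c t i j (d d' : R) : 0 < d -> 0 < d' ->
  (forall z, nrm (z - c t) < d -> is_frechet f z (D z)) ->
  (forall s, cabs (s - t) < d' -> exists v, is_vderiv c s v) ->
  cdiff (fun s => D (c s) i j) t.
Proof.
move=> d0 d'0 fD cd; have [r [C [r0 rd C0 fq]]] := frechet_quad d0 fD.
have lip := frechet_lip C0 fq.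
have L0 : 0 <= n%:R * (6 * C) by rewrite !mulr_ge0.
have r2 : 0 < r / 2 by rewrite divr_gt0.
have tt : cabs (t - t) < d' by rewrite subrr cabs0.
have [v cv] := cd t tt; have [d1 d10 hd1] := vderiv_cont cv r2.
have [rho [rho0 rd' rd1]] : exists rho, [/\ 0 < rho, rho < d' & rho < d1].
  exists (Num.min d' d1 / 2).
  have m0 : 0 < Num.min d' d1 by rewrite lt_min d'0.
  have : Num.min d' d1 / 2 < Num.min d' d1 by lra.
  by rewrite lt_min => /andP[-> ->]; rewrite divr_gt0.
have cr s : cabs (s - t) <= rho -> nrm (c s - c t) < r / 2.
  by move=> sr; apply: hd1; exact: le_lt_trans rd1.
pose x (k : nat) := r / 2 / k.+2%:R.
have x0 k : 0 < x k by rewrite divr_gt0 // ltr0n.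
have xr k : x k < r / 2 by rewrite ltr_pdivrMr ?ltr0n // ltr_pMr // ltr1n.
pose h k : V := (x k)%:C *: delta_mx 0 i.
have hx k : nrm (h k) = x k by rewrite nrm_delta cabs_real gtr0_norm.
pose F k s := (f (c s + h k) 0 j - f (c s) 0 j) / (x k)%:C.
have xn k : (x k)%:C != 0 :> R[i] by rewrite -cabs_gt0 cabs_real normr_gt0 gt_eqF.
have Fq k s : cabs (s - t) <= rho -> cabs (F k s - D (c s) i j) <= C * x k.
  move=> sr; have h1 := fq (c s) (h k).
  have hr : nrm (h k) < r by rewrite hx; have := xr k; lra.
  have {h1} h1 := h1 (lt_trans (cr s sr) _) hr.
  have r2r : r / 2 < r by lra.
  have {}h1 := le_trans (cabs_le_nrm _ j) (h1 r2r).
  rewrite hx in h1.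
  rewrite -(ler_pM2r (x0 k)) -[x in cabs _ * x](gtr0_norm (x0 k)) -cabs_real -cabsM.
  rewrite -mulrA -expr2 (_ : _ * _ = (f (c s + h k) - f (c s) - h k *m D (c s)) 0 j) //.
  rewrite -scalemxAl -rowE !mxE /F; field; exact: xn.
apply: (@limit_cdiff _ F _ t rho (cabs (D (c t) i j) + n%:R * (6 * C) * (r / 2) + C * (r / 2))) => //.
- move=> k s sr; have [u cu] := cd s (le_lt_trans sr rd').
  apply: cdiffM; last exact: cdiff_cst.
  have cs := cr s sr.
  apply: cdiffB.
    exists ((u *m D (c s + h k)) 0 j).
    apply: (@is_vderiv_comp _ _ (fun s => f (c s + h k))).
    apply: (@chain_rule _ _ f (fun s => c s + h k)); last exact: is_vderiv_shift.
    apply: fD; rewrite addrAC; apply: le_lt_trans (nrmD _ _) _.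
    by rewrite hx; have := xr k; lra.
  exists ((u *m D (c s)) 0 j).
  apply: (@is_vderiv_comp _ _ (fun s => f (c s))).
  by apply: chain_rule cu; apply: fD; lra.
- move=> k s sr; have h1 := Fq k s sr.
  have cs := cr s sr.
  have := lip (c t) (c s); rewrite subrr nrm0 => /(_ r2 cs cs) h2.
  have := cabs_le_mnrm (D (c s) - D (c t)) i j; rewrite !mxE => h3.
  have h4 := cabs_dist_ge (F k s) (D (c s) i j).
  have h5 := cabs_dist_ge (D (c s) i j) (D (c t) i j).
  have h6 : n%:R * (6 * C) * nrm (c s - c t) <= n%:R * (6 * C) * (r / 2).
    by rewrite ler_wpM2l // ltW.
  have h7 : C * x k <= C * (r / 2) by rewrite ler_wpM2l // ltW.
  lra.
- move=> s sr e e0.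
  have Cr : 0 < C * (r / 2) + 1 by rewrite ltr_wpDl // mulr_ge0 // ltW.
  have [N hN] := exists_invS_lt (divr_gt0 e0 Cr).
  exists N => k Nk; apply: le_trans (Fq k s sr) _.
  have := hN k Nk; rewrite ltr_pdivlMr // => h1.
  apply: le_trans (ltW h1); rewrite /x.
  rewrite (_ : C * _ = k.+2%:R^-1 * (C * (r / 2))); last by ring.
  apply: ler_pM.
  - by rewrite invr_ge0 ler0n.
  - by rewrite mulr_ge0 // ltW.
  - by rewrite lef_pV2 ?posrE ?ltr0n // ler_nat.
  - by rewrite lerDl.
Qed.

Lemma det_curve_cdiff c t (d d' : R) : 0 < d -> 0 < d' ->
  (forall z, nrm (z - c t) < d -> is_frechet f z (D z)) ->
  (forall s, cabs (s - t) < d' -> exists v, is_vderiv c s v) ->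
  cdiff (fun s => \det (D (c s))) t.
Proof.
move=> d0 d'0 fD cd; apply: cdiff_sum => s _; apply: cdiffM; first exact: cdiff_cst.
by apply: cdiff_prod => i _; exact: entry_curve_cdiff fD cd.
Qed.

Lemma entry_cont z0 i j (d : R) : 0 < d ->
  (forall z, nrm (z - z0) < d -> is_frechet f z (D z)) ->
  tends (fun w => nrm (w - z0)) (fun w => D w i j) (D z0 i j).
Proof.
move=> d0 fD; have [r [C [r0 rd C0 fq]]] := frechet_quad d0 fD.
have lip := frechet_lip C0 fq.
have L0 : 0 <= n%:R * (6 * C) by rewrite !mulr_ge0.
move=> e e0; exists (Num.min (r / 2) (e / (n%:R * (6 * C) + 1))).
  by rewrite lt_min !divr_gt0 //= ltr_wpDl.
move=> w; rewrite lt_min => /andP[h1]; rewrite ltr_pdivlMr ?ltr_wpDl // => h2.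
have := lip z0 w; rewrite subrr nrm0 divr_gt0 // => /(_ isT h1 h1) h3.
have := cabs_le_mnrm (D w - D z0) i j; rewrite !mxE => h4.
by have := nrm_ge0 (w - z0); lra.
Qed.

Lemma det_cont z0 (d : R) : 0 < d ->
  (forall z, nrm (z - z0) < d -> is_frechet f z (D z)) ->
  tends (fun w => nrm (w - z0)) (fun w => \det (D w)) (\det (D z0)).
Proof.
move=> d0 fD; apply: tends_sum => s; apply: tendsM; first exact: tends_cst.
by apply: tends_prod => i; exact: entry_cont fD.
Qed.

Lemma unitmx_near z0 (d : R) : 0 < d ->
  (forall z, nrm (z - z0) < d -> is_frechet f z (D z)) -> D z0 \in unitmx ->
  exists2 r : R, 0 < r & forall w, nrm (w - z0) < r -> D w \in unitmx.
Proof.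
move=> d0 fD; rewrite unitmxE unitfE -cabs_gt0 => u0.
have [r r0 hr] := det_cont d0 fD u0; exists r => // w /hr.
rewrite unitmxE unitfE; apply: contraTneq => ->.
by rewrite sub0r cabsN ltxx.
Qed.

Lemma vcont_dist_cont_in (K : set V) w : (forall z, K z -> vcont f z) ->
  cont_in K (fun z => nrm (f z - w)).
Proof.
move=> fc p Kp e e0; have [d d0 hd] := fc p Kp e e0; exists d => // q _ /hd h.
rewrite ltr_norml.
have := nrm_triangle (f q) (f p) w; have := nrm_triangle (f p) (f q) w.
by rewrite (nrm_distC (f p) (f q)) => h1 h2; apply/andP; split; lra.
Qed.

Lemma seq_closed_ball q (r : R) : seq_closed [set z | nrm (z - q) <= r].
Proof.
move=> p hp /=; apply/ler_addgt0Pr => e e0; have [x /= h1 h2] := hp e e0.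
by have := nrm_triangle p x q; rewrite nrm_distC in h2; lra.
Qed.

Lemma seq_closed_sphere q (r : R) : seq_closed [set z | nrm (z - q) = r].
Proof.
move=> p hp /=; apply/eqP; rewrite eq_le; apply/andP; split.
  apply: seq_closed_ball => e /hp[x /= h1 h2]; exists x => //=; by rewrite h1.
apply/ler_addgt0Pr => e e0; have [x /= h1 h2] := hp e e0.
by have := nrm_triangle x p q; lra.
Qed.

(** The distance from [f z] to [w] is minimized over a closed ball. For [w] close to [f q] the
    minimum is attained inside, and if it were positive a small Newton step would lower it. *)
Lemma open_at_regular q (r : R) : 0 < r ->
  (forall z, nrm (z - q) <= r -> is_frechet f z (D z) /\ D z \in unitmx) ->
  (forall z, nrm (z - q) = r -> f z <> f q) ->
  exists2 eta : R, 0 < eta & forall w, nrm (w - f q) < eta ->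
    exists2 z, nrm (z - q) < r & f z = w.
Proof.
move=> r0 fD fq.
have fc z : nrm (z - q) <= r -> vcont f z.
  by move=> /fD[h _]; exact: frechet_cont h.
have [m m0 hm] : exists2 m : R, 0 < m & forall z, nrm (z - q) = r -> m <= nrm (f z - f q).
  have [S0|S0] := pselect ([set z | nrm (z - q) = r] !=set0); last first.
    by exists 1 => // z zr; exfalso; apply: S0; exists z.
  have [||| p /= pr hp] := @extreme_value R n [set z | nrm (z - q) = r]
    (fun z => - nrm (f z - f q)) (nrm q + r) S0.
  - by move=> p /= <-; have := nrmD (p - q) q; rewrite subrK addrC.
  - exact: seq_closed_sphere.
  - have h := @vcont_dist_cont_in [set z | nrm (z - q) = r] (f q).
    move=> p Kp e e0; have [|d d0 hd] := h _ p Kp e e0.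
      by move=> z /= zr; apply: fc; rewrite zr.
    by exists d => // x Kx /(hd x Kx); rewrite -opprB normrN opprK [X in `|X|]addrC.
  exists (nrm (f p - f q)).
    rewrite lt_def nrm_ge0 andbT; apply/eqP => /nrm0_eq0/eqP; rewrite subr_eq0 => /eqP.
    exact: fq.
  by move=> z /hp; rewrite lerN2.
exists (m / 2) => [|w wm]; first by rewrite divr_gt0.
have qq : nrm (q - q) <= r by rewrite subrr nrm0 ltW.
have [|||| p /= pr hp] := @extreme_value R n [set z | nrm (z - q) <= r]
    (fun z => - nrm (f z - w)) (nrm q + r).
- by exists q.
- by move=> p /= pr; have := nrmD (p - q) q; rewrite subrK; lra.
- exact: seq_closed_ball.
- have h := @vcont_dist_cont_in [set z | nrm (z - q) <= r] w fc.
  move=> p Kp e e0; have [d d0 hd] := h p Kp e e0.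
  by exists d => // x Kx /(hd x Kx); rewrite -opprB normrN opprK [X in `|X|]addrC.
have pw : nrm (f p - w) < m / 2.
  by apply: le_lt_trans wm; rewrite (nrm_distC w) -lerN2; exact: hp.
have pr' : nrm (p - q) < r.
  rewrite lt_def pr andbT; apply/eqP => /esym/hm h1.
  by have := nrm_triangle (f p) w (f q); lra.
exists p => //; apply/eqP; rewrite -subr_eq0; apply/eqP/nrm0_eq0/eqP.
apply: contraT => v0; set v := f p - w in v0 pw.
have vp : 0 < nrm v by rewrite lt_def v0 nrm_ge0.
have [fp up] := fD p pr.
pose B := mnrm (invmx (D p)) + 1.
have B0 : 0 < B by rewrite ltr_wpDl // mnrm_ge0.
(* A step that removes the fraction [x] of [v] has length at most [x (nrm v) B]. The tolerance
   [1 / (2 B)] keeps its error below half of the gain [x (nrm v)]. *)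
have B2 : 0 < (2 * B)^-1 by rewrite invr_gt0 mulr_gt0.
have [d d0 hd] := fp _ B2.
pose x := Num.min 1 (Num.min (d / 2) ((r - nrm (p - q)) / 2) / (nrm v * B)).
have vB : 0 < nrm v * B by rewrite mulr_gt0.
have m20 : 0 < Num.min (d / 2) ((r - nrm (p - q)) / 2).
  by rewrite lt_min !divr_gt0 // subr_gt0.
have x0 : 0 < x by rewrite lt_min ltr01 divr_gt0.
have x1 : x <= 1 by rewrite ge_min lexx.
have xB : x * (nrm v * B) <= Num.min (d / 2) ((r - nrm (p - q)) / 2).
  by rewrite -ler_pdivlMr // ge_min lexx orbT.
move: xB; rewrite le_min => /andP[xd xr].
pose h : V := - (x%:C *: (v *m invmx (D p))).
have hx : nrm h <= x * (nrm v * B).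
  rewrite nrmN nrmZ cabs_real gtr0_norm // ler_pM2l //.
  apply: le_trans (nrm_mul _ _) _; rewrite ler_pM2l // /B lerDl //.
have hd' : nrm h < d by apply: le_lt_trans hx _; lra.
have := hd h hd'.
rewrite (_ : h *m D p = - (x%:C *: v)); last by rewrite /h mulNmx -scalemxAl mulmxKV.
move=> h1.
have h2 : nrm (p + h - q) <= r.
  rewrite addrAC; apply: le_trans (nrmD _ _) _; lra.
have := hp _ h2; rewrite lerN2 -/v.
rewrite (_ : f (p + h) - w = (f (p + h) - f p - - (x%:C *: v)) + (1 - x)%:C *: v); last first.
  rewrite rmorphB rmorph1 scalerBl scale1r /v.
  move: (x%:C *: _) => y; by apply/rowP => j; rewrite !mxE; ring.
move=> h3; have := le_trans h3 (nrmD _ _).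
rewrite nrmZ cabs_real ger0_norm ?subr_ge0 // leNgt => /negP; case.
have h4 : (2 * B)^-1 * nrm h <= (2 * B)^-1 * (x * (nrm v * B)) by rewrite ler_pM2l.
have h5 : (2 * B)^-1 * (x * (nrm v * B)) = x * nrm v / 2 by field; rewrite gt_eqF.
have := mulr_gt0 x0 vp; lra.
Qed.

(** The remainder of [f] multiplied by the inverse matrix is that of [g], measured in the increment
    of [g]. Continuity of [g] makes it small, and [e1 (2 B) <= 1] bounds the increment of [g]
    linearly in that of [w]. *)
Lemma inverse_frechet g w0 : is_frechet f (g w0) (D (g w0)) -> D (g w0) \in unitmx ->
  vcont g w0 -> (exists2 d : R, 0 < d & forall w, nrm (w - w0) < d -> f (g w) = w) ->
  is_frechet g w0 (invmx (D (g w0))).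
Proof.
set p := g w0; set A := D p => fp uA gc [d0 d00 fg] e e0.
pose B := mnrm (invmx A) + 1.
have B0 : 0 < B by rewrite ltr_wpDl // mnrm_ge0.
pose e1 := Num.min (2 * B)^-1 (e / (2 * (B * B))).
have e10 : 0 < e1 by rewrite lt_min invr_gt0 divr_gt0 // !mulr_gt0.
have e1B : e1 * (2 * B) <= 1.
  by rewrite -ler_pdivlMr ?mulr_gt0 // div1r ge_min lexx.
have e1BB : e1 * (2 * (B * B)) <= e.
  by rewrite -ler_pdivlMr ?mulr_gt0 // ge_min lexx orbT.
have [d dd hd] := fp _ e10; have [d' d'0 hd'] := gc _ dd.
exists (Num.min d0 d'); first by rewrite lt_min d00.
move=> k; rewrite lt_min => /andP[k0 kd'].
have kw : w0 + k - w0 = k by rewrite addrC addKr.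
have fgk : f (g (w0 + k)) = w0 + k by apply: fg; rewrite kw.
have fp0 : f p = w0 by apply: fg; rewrite subrr nrm0.
set h := g (w0 + k) - p.
have hsm : nrm h < d by apply: hd'; rewrite kw.
have := hd h hsm; rewrite (addrC p) subrK fgk fp0 kw => h1.
have hE : h = k *m invmx A - (k - h *m A) *m invmx A.
  by rewrite mulmxBl mulmxK // opprB addrC subrK.
have h2 : nrm ((k - h *m A) *m invmx A) <= e1 * nrm h * B.
  apply: le_trans (nrm_mul _ _) _; apply: ler_pM; rewrite ?nrm_ge0 ?mnrm_ge0 //.
  by rewrite /B lerDl.
have h3 : nrm (k *m invmx A) <= nrm k * B.
  by apply: le_trans (nrm_mul _ _) _; rewrite ler_wpM2l ?nrm_ge0 // /B lerDl.
have h4 : nrm h <= nrm k * B + e1 * nrm h * B.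
  rewrite {1}hE; apply: le_trans (nrmB _ _) _; exact: lerD.
have h5 : nrm h <= 2 * (nrm k * B).
  have := ler_wpM2r (nrm_ge0 h) e1B; lra.
rewrite (_ : _ - k *m invmx A = - ((k - h *m A) *m invmx A)); last first.
  by rewrite {1}hE addrC addKr.
rewrite nrmN; apply: le_trans h2 _.
have h6 : e1 * nrm h * B <= e1 * (2 * (nrm k * B)) * B.
  by rewrite ler_pM2r // ler_pM2l.
apply: le_trans h6 _; have := ler_wpM2r (nrm_ge0 k) e1BB; lra.
Qed.

End Jacobian.

(** * Regular points of injective maps *)

Section Regular.
Set Implicit Arguments.
Unset Strict Implicit.
Variables (R : realType) (n : nat).
Local Notation V := 'rV[R[i]]_n.
Implicit Types (f g : V -> V) (z h w p q : V) (A B : 'M[R[i]]_n) (c : R[i] -> V).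

(* A function with zero derivative remains holomorphic when composed with
   [z |-> |z| t], and the composite is constant on circles. *)
Lemma cderiv0_const (phi : R[i] -> R[i]) (t : R[i]) (r : R) : cabs t < r ->
  (forall s, cabs s < r -> is_cderiv phi s 0) -> phi t = phi 0.
Proof.
move=> tr phi0; have [->//|t0] := eqVneq t 0.
have tp : 0 < cabs t by rewrite cabs_gt0.
pose G (z : R[i]) := phi ((cabs z)%:C * t) - phi t.
have Gd (z : R[i]) : cabs (z - 0) <= 1 -> cdiff G z.
  rewrite subr0 => z1; exists 0 => e e0.
  have [|d d0 hd] := phi0 ((cabs z)%:C * t) _ (e / cabs t) (divr_gt0 e0 tp).
    rewrite cabsM cabs_real ger0_norm ?cabs_ge0 //; apply: le_lt_trans tr.
    by rewrite ler_piMl // ltW.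
  exists (d / cabs t) => [|x]; first by rewrite divr_gt0.
  have xz : cabs ((cabs x)%:C * t - (cabs z)%:C * t) <= cabs (x - z) * cabs t.
    rewrite -mulrBl -rmorphB cabsM cabs_real ler_pM2r // ler_norml cabs_dist_ge andbT.
    by have := cabs_dist_ge z x; rewrite cabs_distC; lra.
  rewrite ltr_pdivlMr // => /(le_lt_trans xz)/hd.
  rewrite !mul0r !subr0 /G (_ : _ - _ - _ = phi ((cabs x)%:C * t) - phi ((cabs z)%:C * t)).
    move/le_trans; apply; apply: le_trans (ler_wpM2l (ltW (divr_gt0 e0 tp)) xz) _.
    by rewrite mulrCA mulfVK ?gt_eqF // mulrC.
  by ring.
have := @max_disc R G 0 1 0 ltr01 (lexx _) Gd.
have G1 (z : R[i]) : cabs (z - 0) = 1 -> cabs (G z) <= 0.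
  by rewrite subr0 => z1; rewrite /G z1 mul1r subrr cabs0.
move=> /(_ G1 0); rewrite subrr cabs0 ler01 => /(_ isT).
rewrite /G cabs0 mul0r => h; apply/esym/eqP; rewrite -subr_eq0 -cabs_eq0.
by rewrite eq_le h cabs_ge0.
Qed.

Lemma is_frechetD f g z A B : is_frechet f z A -> is_frechet g z B ->
  is_frechet (fun x => f x + g x) z (A + B).
Proof.
move=> fA gB e e0; have e2 : 0 < e / 2 by lra.
have [d d0 hd] := fA _ e2; have [d' d'0 hd'] := gB _ e2.
exists (Num.min d d'); first by rewrite lt_min d0.
move=> h; rewrite lt_min => /andP[/hd h1 /hd' h2].
rewrite (_ : _ - _ - _ = (f (z + h) - f z - h *m A) + (g (z + h) - g z - h *m B)).
  by apply: le_trans (nrmD _ _) _; lra.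
by rewrite mulmxDr; apply/rowP => j; rewrite !mxE; ring.
Qed.

Lemma is_frechetMr f z A B : is_frechet f z A -> is_frechet (fun x => f x *m B) z (A *m B).
Proof.
move=> fA e e0; have B0 : 0 < mnrm B + 1 by rewrite ltr_wpDl // mnrm_ge0.
have [d d0 hd] := fA _ (divr_gt0 e0 B0); exists d => // h /hd h1.
rewrite mulmxA -!mulmxBl; apply: le_trans (nrm_mul _ _) _.
apply: le_trans (ler_wpM2r (mnrm_ge0 B) h1) _.
rewrite mulrAC ler_wpM2r ?nrm_ge0 // mulrAC ler_pdivrMr //.
by rewrite ler_pM2l // lerDl.
Qed.

Lemma is_frechet_lin B z : is_frechet (fun x => x *m B) z B.
Proof.
move=> e e0; exists 1 => // h _.
by rewrite mulmxDl -addrA -opprD subrr nrm0 mulr_ge0 ?nrm_ge0 // ltW.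
Qed.

(** The normalization [D p = 1] makes [f] a small perturbation of a translation near [p], whence an
    expansion estimate. It gives injectivity on a ball, and then continuity of the inverse. *)
Lemma local_inverse f (D : V -> 'M[R[i]]_n) p (d : R) : 0 < d ->
  (forall z, nrm (z - p) < d -> is_frechet f z (D z)) -> D p = 1%:M ->
  exists g, exists2 eta : R, 0 < eta & g (f p) = p /\ forall w, nrm (w - f p) < eta ->
    [/\ nrm (g w - p) < d, f (g w) = w, D (g w) \in unitmx &
      is_frechet g w (invmx (D (g w)))].
Proof.
move=> d0 fD Dp; have [r [C [r0 rd C0 fq]]] := frechet_quad d0 fD.
have lip := frechet_lip C0 fq.
pose L := n%:R * (6 * C).
have L0 : 0 <= L by rewrite !mulr_ge0.
have up : D p \in unitmx by rewrite Dp unitmx1.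
have [ru ru0 hu] := unitmx_near d0 fD up.
(* With [4 rho B <= 1], the quadratic remainder and the variation of [D] together change an
   increment [h] by at most a quarter of its norm. *)
pose B := 2 * C + L + 1; have B0 : 0 < B by rewrite /B; lra.
pose rho := Num.min (Num.min (r / 2) ru) (1 / B) / 4.
have m0 : 0 < Num.min (Num.min (r / 2) ru) (1 / B) by rewrite !lt_min ru0 !divr_gt0.
have rho0 : 0 < rho by rewrite divr_gt0.
have rhom : 4 * rho <= Num.min (Num.min (r / 2) ru) (1 / B) by rewrite /rho; lra.
move: rhom; rewrite !le_min => /andP[/andP[rr rru] rB].
rewrite ler_pdivlMr // in rB.
have inj z z' : nrm (z - p) <= rho -> nrm (z' - p) <= rho -> nrm (z' - z) <= 2 * nrm (f z' - f z).
  move=> zr z'r; set h := z' - z.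
  have hr : nrm h <= 2 * rho.
    by have := nrm_triangle z' p z; rewrite (nrm_distC p) -/h; lra.
  have h0 := nrm_ge0 h.
  have zr' : nrm (z - p) < r by lra.
  have hr' : nrm h < r by lra.
  have := fq z h zr' hr'; rewrite (addrC z) subrK => h1.
  have := lip p z; rewrite subrr nrm0 divr_gt0 // => h2.
  have zr2 : nrm (z - p) < r / 2 by lra.
  have {h2} h2 := h2 isT zr2 zr2.
  have h3 : nrm (h *m (D z - D p)) <= nrm h * (L * nrm (z - p)).
    by apply: le_trans (nrm_mul _ _) _; rewrite ler_wpM2l.
  have h4 : nrm h <= nrm (f z' - f z) + nrm (f z' - f z - h *m D z) + nrm (h *m (D z - D p)).
    rewrite {1}(_ : h = (f z' - f z) - (f z' - f z - h *m D z) - h *m (D z - D p)).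
      by apply: le_trans (nrmB _ _) _; rewrite lerD2r; exact: nrmB.
    rewrite mulmxBr Dp mulmx1; move: (f z') (f z) (h *m D z) => a b x.
    by apply/rowP => j; rewrite !mxE; ring.
  have h5 : nrm h * (C * nrm h) <= nrm h * (C * (2 * rho)) by rewrite !ler_wpM2l.
  have h6 : nrm h * (L * nrm (z - p)) <= nrm h * (L * rho) by rewrite !ler_wpM2l.
  have h7 : nrm h * (rho * 4 * B) <= nrm h * 1.
    by rewrite ler_wpM2l // mulrC mulrA [B * _ ]mulrC -mulrA [B * _]mulrC mulrA; lra.
  rewrite /B in h7.
  have h8 : 0 <= nrm h * (rho * L) by rewrite !mulr_ge0 // ltW.
  have h9 : 0 <= nrm h * rho by rewrite mulr_ge0 // ltW.
  lra.
have pp : nrm (p - p) <= rho by rewrite subrr nrm0 ltW.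
have [|z zr /eqP|eta eta0 heta] := @open_at_regular R n f D p rho rho0.
- by move=> z zr; split; [apply: fD|apply: hu]; lra.
- move=> /eqP fz; have := inj p z pp; rewrite zr lexx fz subrr nrm0 mulr0 => /(_ isT).
  by rewrite leNgt rho0.
have /choice[g hg] : forall w, exists z, nrm (w - f p) < eta -> nrm (z - p) < rho /\ f z = w.
  move=> w; have [/heta[z zr fz]|h] := pselect (nrm (w - f p) < eta); first by exists z.
  by exists p.
have gp : g (f p) = p.
  have [|h1 h2] := hg (f p); first by rewrite subrr nrm0.
  apply/eqP; rewrite -subr_eq0; apply/eqP/nrm0_eq0/eqP.
  have := inj p (g (f p)) pp (ltW h1); rewrite h2 subrr nrm0 mulr0 => h3.
  by rewrite eq_le h3 nrm_ge0.
exists g, eta => //; split=> // w we.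
have [gr fg] := hg w we.
have ug : D (g w) \in unitmx by apply: hu; lra.
split=> //; first by lra.
apply: (@inverse_frechet R n f D) => //; first by apply: fD; lra.
- move=> e e0; exists (Num.min (eta - nrm (w - f p)) (e / 2)).
    by rewrite lt_min subr_gt0 we divr_gt0.
  move=> w'; rewrite lt_min => /andP[h1 h2].
  have [gr' fg'] : nrm (g w' - p) < rho /\ f (g w') = w'.
    by apply: hg; have := nrm_triangle w' w (f p); lra.
  by have := inj (g w) (g w') (ltW gr) (ltW gr'); rewrite fg fg'; lra.
- exists (eta - nrm (w - f p)); first by rewrite subr_gt0.
  move=> w' h1; have [] // := hg w'.
  by have := nrm_triangle w' w (f p); lra.
Qed.

(* Constant rank argument: at a point [p] where the rank of [D] is maximal and
   smaller than [n], [f] is constant along the curve through [p] obtained by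
   straightening with [Phi z = f z B + z (1 - A B)], where [A = D p] and
   [A B A = A], in a direction of the kernel of [A]. *)
Lemma exists_regular f (D : V -> 'M[R[i]]_n) z0 (d : R) : 0 < d ->
  (forall z, nrm (z - z0) < d -> is_frechet f z (D z)) ->
  (forall z z', nrm (z - z0) < d -> nrm (z' - z0) < d -> f z = f z' -> z = z') ->
  exists2 z, nrm (z - z0) < d & D z \in unitmx.
Proof.
move=> d0 fD finj; apply: contrapT => noreg.
have [p pd pmax] : exists2 p, nrm (p - z0) < d &
    forall z, nrm (z - z0) < d -> (\rank (D z) <= \rank (D p))%N.
  pose P k := `[< exists2 z, nrm (z - z0) < d & \rank (D z) = k >].
  have [||k /asboolP[p pd pk] kmax] := @ex_maxnP P n.
  - by exists (\rank (D z0)); apply/asboolP; exists z0; rewrite ?subrr ?nrm0.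
  - by move=> k /asboolP[z _ <-]; exact: rank_leq_row.
  exists p => // z zd; rewrite pk; apply: kmax.
  by apply/asboolP; exists z.
set A := D p in pmax; pose B := pinvmx A.
have ABA : A *m B *m A = A by rewrite /B mulmxKpV // submx_refl.
have kA : kermx A != 0.
  rewrite -mxrank_eq0 mxrank_ker subn_eq0 -ltnNge ltn_neqAle rank_leq_row andbT.
  apply/negP => rA; apply: noreg; exists p => //.
  by rewrite -row_free_unit.
have /rowV0Pn[v /sub_kermxP vA v0] := kA.
(* The derivative of [Phi] at [p] is [A B + (1 - A B) = 1], so [Phi] has a local inverse there. *)
pose Phi z := f z *m B + z *m (1%:M - A *m B).
pose DP z := D z *m B + (1%:M - A *m B).
have d'0 : 0 < d - nrm (p - z0) by rewrite subr_gt0.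
have PD z : nrm (z - p) < d - nrm (p - z0) -> is_frechet Phi z (DP z).
  move=> zd; apply: is_frechetD; last exact: is_frechet_lin.
  apply: is_frechetMr; apply: fD.
  by have := nrm_triangle z p z0; lra.
have [|g [eta eta0 [gp hg]]] := local_inverse d'0 PD.
  by rewrite /DP -/A addrC subrK.
have vp : 0 < nrm v.
  rewrite lt_def nrm_ge0 andbT; apply: contraNneq v0 => /nrm0_eq0 -> //.
pose c (s : R[i]) := g (Phi p + s *: v).
pose r := eta / nrm v; have r0 : 0 < r by rewrite divr_gt0.
have cs s : cabs s < r -> nrm (Phi p + s *: v - Phi p) < eta.
  by rewrite addrC addKr nrmZ -ltr_pdivlMr.
have fc0 s j : cabs s < r -> is_cderiv (fun x => f (c x) 0 j) s 0.
  move=> /cs/hg[gd Pg ug gw]; set u := v *m invmx (DP (c s)).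
  have cv : is_vderiv c s u.
    by apply: (@chain_rule R n g (fun x => Phi p + x *: v)) => //; exact: is_vderiv_line.
  have fcs : nrm (c s - z0) < d.
    by have := nrm_triangle (c s) p z0; rewrite /c; lra.
  have := chain_rule (fD _ fcs) cv.
  suff -> : u *m D (c s) = 0 by move=> h; have := is_vderiv_comp j h; rewrite mxE.
  have uP : u *m DP (c s) = v by rewrite mulmxKV.
  (* Since [DP (c s)] is invertible, [D (c s) B A] has the rank of [A]. By maximality [D (c s)] has
     no larger rank, so its row space meets the kernel of [B A] only in 0; but [u D (c s)] lies in
     both, because [v A = 0]. *)
  have PA : DP (c s) *m A = D (c s) *m (B *m A).
    rewrite /DP mulmxDl mulmxBl mul1mx ABA subrr addr0; exact/esym/mulmxA.
  have rk : \rank (D (c s) *m (B *m A)) = \rank A.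
    have fu : row_full (DP (c s)) by rewrite row_full_unit.
    by rewrite -PA (eqmxMfull _ fu).
  have := mxrank_mul_ker (D (c s)) (B *m A); rewrite rk => rk2.
  have cap0 : (D (c s) :&: kermx (B *m A))%MS = 0.
    apply/eqP; rewrite -mxrank_eq0 -leqn0 -(leq_add2l (\rank A)) rk2 addn0.
    exact: pmax.
  have : (u *m D (c s) <= D (c s) :&: kermx (B *m A))%MS.
    rewrite sub_capmx submxMl /=; apply/sub_kermxP.
    by rewrite -mulmxA -PA mulmxA uP.
  by rewrite cap0 submx0 => /eqP.
have c0 : c 0 = p by rewrite /c scale0r addr0.
pose t : R[i] := (r / 2)%:C.
have tr : cabs t < r by rewrite cabs_real gtr0_norm ?divr_gt0 //; lra.
have [cd Pc _ _] := hg _ (cs t tr).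
(* The curve stays in one fibre of the injective map [f], so it is constant; yet [Phi] moves along
   it by [t v], which is not 0. *)
have ct : c t = p.
  apply: finj => //; first by have := nrm_triangle (c t) p z0; rewrite /c; lra.
  apply/rowP => j; rewrite -[in RHS]c0.
  by apply: (@cderiv0_const (fun x => f (c x) 0 j)) tr _ => s; exact: fc0.
move: Pc; rewrite -/(c t) ct => /esym/eqP; rewrite -subr_eq0 addrC addKr => /eqP tv.
have := nrmZ t v; rewrite tv nrm0 => /esym/eqP.
by rewrite mulf_eq0 (gt_eqF vp) orbF cabs_real normr_eq0 gt_eqF // divr_gt0.
Qed.

End Regular.

(** * Injective holomorphic maps are open *)

Section InjectiveOpen.
Set Implicit Arguments.
Unset Strict Implicit.
Variables (R : realType) (n : nat).
Local Notation V := 'rV[R[i]]_n.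
Implicit Types (f g : V -> V) (z h w p q : V) (A B : 'M[R[i]]_n) (c : R[i] -> V).

Lemma dist_to_image f (K : set V) w (b : R) : (forall z, K z -> nrm z <= b) ->
  seq_closed K -> (forall z, K z -> vcont f z) -> (forall z, K z -> f z <> w) ->
  exists2 m : R, 0 < m & forall z, K z -> m <= nrm (f z - w).
Proof.
move=> Kb Kc fc fw.
have [K0|K0] := pselect (K !=set0); last first.
  by exists 1 => // z Kz; exfalso; apply: K0; exists z.
have [|p Kp hp] := @extreme_value R n K (fun z => - nrm (f z - w)) b K0 Kb Kc.
  move=> p Kp e e0; have [d d0 hd] := @vcont_dist_cont_in R n f K w fc p Kp e e0.
  by exists d => // x Kx /(hd x Kx); rewrite -opprB normrN opprK [X in `|X|]addrC.
exists (nrm (f p - w)); last by move=> z /hp; rewrite lerN2.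
rewrite lt_def nrm_ge0 andbT; apply/eqP => /nrm0_eq0/eqP; rewrite subr_eq0 => /eqP.
exact: fw.
Qed.

(* Rado's argument: the Jacobian determinant of the inverse image, extended by
   zero outside the image of a ball, is continuous and holomorphic where it does
   not vanish, hence cannot vanish on an open set. *)
Theorem injective_open f (D : V -> 'M[R[i]]_n) b (d rho : R) : 0 < rho < d ->
  (forall z, nrm (z - b) < d -> is_frechet f z (D z)) ->
  (forall z z', nrm (z - b) < d -> nrm (z' - b) < d -> f z = f z' -> z = z') ->
  exists2 eta : R, 0 < eta & forall w, nrm (w - f b) < eta ->
    exists2 z, nrm (z - b) < rho & f z = w.
Proof.
move=> /andP[rho0 rhod] fD finj.
have d0 : 0 < d by exact: lt_trans rhod.
have bb : nrm (b - b) = 0 by rewrite subrr nrm0.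
pose K := [set z | nrm (z - b) <= rho].
have Kd z : K z -> nrm (z - b) < d by move=> h; exact: le_lt_trans rhod.
have Kbd z : K z -> nrm z <= nrm b + rho.
  by rewrite /K /= => h; have := nrmD (z - b) b; rewrite subrK; lra.
have fc z : K z -> vcont f z by move=> /Kd/fD; exact: frechet_cont.
(* Values within [m] of [f b] are not taken on the sphere; a preimage in the closed ball is
   therefore interior. *)
have [m m0 hm] : exists2 m : R, 0 < m & forall z, nrm (z - b) = rho -> m <= nrm (f z - f b).
  apply: (@dist_to_image f [set z | nrm (z - b) = rho] (f b) (nrm b + rho)).
  - by move=> z /= zr; apply: Kbd; rewrite /K /= zr.
  - exact: seq_closed_sphere.
  - by move=> z /= zr; apply: fc; rewrite /K /= zr.
  - move=> z /= zr /finj zb; have := zr; rewrite zb ?bb ?zr //.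
    by move=> rho00; rewrite -rho00 ltxx in rho0.
have Kint z : K z -> nrm (f z - f b) < m -> nrm (z - b) < rho.
  move=> Kz h; rewrite lt_def Kz andbT; apply/eqP => /esym/hm.
  by rewrite leNgt h.
pose inK w := `[< exists2 z, K z & f z = w >].
have /choice[g hg] : forall w, exists z, inK w -> K z /\ f z = w.
  move=> w; have [/asboolP[z Kz fz]|h] := boolP (inK w); first by exists z.
  by exists b.
have gK w : inK w -> K (g w) by move=> /hg[].
have fg w : inK w -> f (g w) = w by move=> /hg[].
have inKf z : K z -> inK (f z) by move=> Kz; apply/asboolP; exists z.
have gf z : K z -> g (f z) = z.
  by move=> Kz; apply: finj; rewrite ?fg ?inKf //; apply: Kd => //; apply/gK/inKf.
have gcont w (e : R) : inK w -> 0 < e -> exists2 dl : R, 0 < dl &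
    forall w', inK w' -> nrm (w' - w) < dl -> nrm (g w' - g w) < e.
  move=> Kw e0.
  have [||||dl dl0 hdl] := @dist_to_image f [set z | K z /\ e <= nrm (z - g w)] w (nrm b + rho).
  - by move=> z [Kz _]; exact: Kbd.
  - move=> p hp; split.
      by apply: seq_closed_ball => e' /hp[q [h1 _] h2]; exists q.
    apply/ler_addgt0Pr => e' /hp[q [_ h1] h2].
    by have := nrm_triangle q p (g w); lra.
  - by move=> z [Kz _]; exact: fc.
  - move=> z [Kz ez] fzw; move: ez; rewrite -fzw gf // subrr nrm0.
    by rewrite leNgt e0.
  exists dl => // w' Kw' w'w; rewrite ltNge; apply/negP => h.
  by have := hdl (g w') (conj (gK w' Kw') h); rewrite fg // leNgt w'w.
have Kclosed w : ~~ inK w -> exists2 dl : R, 0 < dl & forall w', nrm (w' - w) < dl -> ~~ inK w'.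
  move=> /asboolPn nK; have [||||dl dl0 hdl] := @dist_to_image f K w (nrm b + rho) => //.
  - exact: seq_closed_ball.
  - by move=> z Kz fz; apply: nK; exists z.
  exists dl => // w' h; apply/negP => Kw'.
  by have := hdl _ (gK _ Kw'); rewrite fg // leNgt h.
pose J w := if inK w then \det (D (g w)) else 0.
have unitJ w : (inK w && (D (g w) \in unitmx)) = (J w != 0).
  by rewrite /J unitmxE unitfE; case: (inK w); rewrite //= eqxx.
have DfD z : nrm (z - b) < d -> exists2 d' : R, 0 < d' &
    forall z', nrm (z' - z) < d' -> is_frechet f z' (D z').
  move=> zd; exists (d - nrm (z - b)); first by rewrite subr_gt0.
  by move=> z' h; apply: fD; have := nrm_triangle z' z b; lra.
have regular w : nrm (w - f b) < m -> J w != 0 ->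
    exists2 dl : R, 0 < dl & forall w', nrm (w' - w) < dl -> inK w'.
  move=> wm; rewrite -unitJ => /andP[Kw uw].
  have zr := Kint _ (gK _ Kw); rewrite fg // in zr; have {}zr := zr wm.
  have [d' d'0 fD'] := DfD _ (Kd _ (gK _ Kw)).
  have [ru ru0 hu] := unitmx_near d'0 fD' uw.
  pose r := Num.min ru (rho - nrm (g w - b)) / 2.
  have mm0 : 0 < Num.min ru (rho - nrm (g w - b)) by rewrite lt_min ru0 subr_gt0.
  have r0 : 0 < r by rewrite divr_gt0.
  have : r < Num.min ru (rho - nrm (g w - b)) by rewrite /r; lra.
  rewrite lt_min => /andP[rru rrho].
  have Kr z : nrm (z - g w) <= r -> nrm (z - b) < rho.
    by move=> h; have := nrm_triangle z (g w) b; lra.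
  have [||dl dl0 hdl] := @open_at_regular R n f D (g w) r r0.
  - by move=> z h; split; [apply/fD/(lt_trans _ rhod)/Kr|apply: hu; exact: le_lt_trans rru].
  - move=> z h /finj zg; have := h; rewrite zg ?subrr ?nrm0.
    + by move=> r00; rewrite -r00 ltxx in r0.
    + by apply: lt_trans rhod; apply: Kr; rewrite h.
    + exact: lt_trans rhod.
  rewrite fg // in hdl; exists dl => // w' /hdl[z zr' <-]; apply: inKf.
  by apply: ltW; apply: Kr; exact: ltW.
have Jcont w : nrm (w - f b) < m -> tends (fun w' => nrm (w' - w)) J (J w).
  move=> wm e e0; case: (boolP (inK w)) => Kw; last first.
    have [dl dl0 hdl] := Kclosed w Kw; exists dl => // w' /hdl Kw'.
    by rewrite /J (negPf Kw) (negPf Kw') subrr cabs0.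
  have [d' d'0 fD'] := DfD _ (Kd _ (gK _ Kw)).
  have [e1 e10 he1] := det_cont d'0 fD' e0.
  have [dl dl0 hdl] := gcont w e1 Kw e10.
  have JK w' : inK w' -> nrm (w' - w) < dl -> cabs (J w' - J w) < e.
    by move=> Kw' h; rewrite /J Kw Kw'; apply: he1; exact: hdl.
  (* Leaving the image costs no jump where [J w = 0]; where [J w] is nonzero, all points near [w]
     are in the image. *)
  have [Jw|Jw] := eqVneq (J w) 0.
    exists dl => // w' h; have [/JK|Kw'] := boolP (inK w'); first exact.
    by rewrite Jw /J (negPf Kw') subrr cabs0.
  have [dl' dl'0 hdl'] := regular w wm Jw.
  exists (Num.min dl dl'); first by rewrite lt_min dl0.
  by move=> w'; rewrite lt_min => /andP[h /hdl' Kw']; exact: JK.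
have Jreg w : nrm (w - f b) < m -> J w != 0 -> exists2 dl : R, 0 < dl &
    forall w', nrm (w' - w) < dl -> [/\ inK w', D (g w') \in unitmx &
      is_frechet g w' (invmx (D (g w')))].
  move=> wm Jw; have [d1 d10 h1] := regular w wm Jw.
  have [|d2 d20 h2] := Jcont w wm (cabs (J w)); first by rewrite cabs_gt0.
  exists (Num.min d1 d2); first by rewrite lt_min d10.
  move=> w'; rewrite lt_min => /andP[w1 w2]; have Kw' := h1 _ w1.
  have /andP[_ uw'] : inK w' && (D (g w') \in unitmx).
    rewrite unitJ; apply: contraTneq (h2 _ w2) => ->.
    by rewrite sub0r cabsN ltxx.
  have near : exists2 dl : R, 0 < dl & forall x, nrm (x - w') < dl -> inK x.
    exists (d1 - nrm (w' - w)); first by rewrite subr_gt0.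
    by move=> x h; apply: h1; have := nrm_triangle x w' w; lra.
  have [d3 d30 h3] := near.
  split=> //; apply: (@inverse_frechet R n f D) => //.
  - by apply: fD; apply: Kd; exact: gK.
  - move=> e e0; have [d4 d40 h4] := gcont w' e Kw' e0.
    exists (Num.min d3 d4); first by rewrite lt_min d30.
    by move=> x; rewrite lt_min => /andP[/h3 Kx]; exact: h4.
  - by exists d3 => // x /h3; exact: fg.
have Jline w v s : nrm (w + s *: v - f b) < m -> J (w + s *: v) != 0 ->
    exists2 dl : R, 0 < dl & forall s', cabs (s' - s) < dl -> cdiff (fun x => J (w + x *: v)) s'.
  move=> sm Js; have [d1 d10 h1] := Jreg _ sm Js.
  have B0 : 0 < nrm v + 1 by rewrite ltr_wpDl ?nrm_ge0.
  have near s' x : cabs (s' - x) * (nrm v + 1) < d1 -> nrm (w + s' *: v - (w + x *: v)) < d1.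
    move=> h; rewrite opprD addrACA subrr add0r -scalerBl nrmZ.
    by have := cabs_ge0 (s' - x); lra.
  exists (d1 / (nrm v + 1)) => [|s']; first by rewrite divr_gt0.
  rewrite ltr_pdivlMr // => hs'.
  pose d2 := d1 / (nrm v + 1) - cabs (s' - s).
  have d20 : 0 < d2 by rewrite subr_gt0 ltr_pdivlMr.
  have near2 x : cabs (x - s') < d2 -> nrm (w + x *: v - (w + s *: v)) < d1.
    move=> h; apply: near; rewrite -ltr_pdivlMr //.
    by have := cabs_triangle x s' s; rewrite /d2 in h; lra.
  apply: (@cdiff_near _ (fun x => \det (D (g (w + x *: v)))) _ _ d2) => //.
    by move=> x /near2/h1[Kx _ _]; rewrite /J Kx.
  have [Ks' _ _] := h1 _ (near _ _ hs').
  have [d' d'0 fD'] := DfD _ (Kd _ (gK _ Ks')).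
  apply: (@det_curve_cdiff R n f D (fun x => g (w + x *: v)) s' d' d2) => //.
  move=> x /near2/h1[_ _ gx].
  exists (v *m invmx (D (g (w + x *: v)))).
  by apply: (@chain_rule R n g (fun y => w + y *: v)) => //; exact: is_vderiv_line.
have [d1 d10 hd1] : exists2 d1 : R, 0 < d1 & forall z, nrm (z - b) < d1 -> nrm (f z - f b) < m / 8.
  by apply: fc; rewrite ?divr_gt0 // /K /= bb ltW.
pose d2 := Num.min d1 rho; have d20 : 0 < d2 by rewrite lt_min d10.
have d2P z : nrm (z - b) < d2 -> [/\ nrm (z - b) < d1, K z & nrm (z - b) < d].
  rewrite lt_min => /andP[h1 h2]; split=> //; first exact: ltW.
  exact: lt_trans rhod.
have [||b' b'd ub'] := @exists_regular R n f D b d2 d20.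
- by move=> z /d2P[_ _]; exact: fD.
- by move=> z z' /d2P[_ _ h] /d2P[_ _ h']; exact: finj.
have [b'1 Kb' b'2] := d2P _ b'd.
exists (m / 8) => [|w2 w2m]; first by rewrite divr_gt0.
have w2m' : nrm (w2 - f b) < m by lra.
suff Kw2 : inK w2.
  exists (g w2); last exact: fg.
  by apply: Kint; [exact: gK|rewrite fg].
apply: contraT => nK; have [dl dl0 hdl] := Kclosed w2 nK.
set w1 := f b'; have w1m := hd1 _ b'1; rewrite -/w1 in w1m.
(* The line [w2 + s v] joins a supposed exterior point, near which [J] is 0, to the value [w1] at a
   regular point, where it is not. As [nrm v < m / 4], the disc [|s| <= 2] stays within [m] of
   [f b], and Rado's lemma applies at [s = 1]. *)
pose v := w1 - w2.
have vm : nrm v < m / 4.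
  by have := nrm_triangle w1 (f b) w2; rewrite (nrm_distC (f b)) -/v; lra.
have seg s : cabs s <= 2 -> nrm (w2 + s *: v - f b) < m.
  move=> s2; rewrite addrAC; apply: le_lt_trans (nrmD _ _) _; rewrite nrmZ.
  have := ler_wpM2r (nrm_ge0 v) s2; lra.
have B0 : 0 < nrm v + 1 by rewrite ltr_wpDl ?nrm_ge0.
have dlB : 0 < dl / (nrm v + 1) / 2 by rewrite !divr_gt0.
have J1 : J (w2 + 1 *: v) = \det (D b').
  by rewrite scale1r /v addrC subrK /J inKf // gf.
move: ub'; rewrite unitmxE unitfE -J1 => /eqP; case.
apply: (@rado R (fun s => J (w2 + s *: v)) _ 2 dlB) => [s /seg sm|s s2|s sdl|].
- move=> e /(Jcont _ sm)[d3 d30 hd3]; exists (d3 / (nrm v + 1)) => [|s'].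
    by rewrite divr_gt0.
  rewrite ltr_pdivlMr // => h; apply: hd3.
  rewrite opprD addrACA subrr add0r -scalerBl nrmZ.
  by have := cabs_ge0 (s' - s); lra.
- have [->|Js] := eqVneq (J (w2 + s *: v)) 0; [by left|right].
  by apply: Jline => //; apply: seg; exact: ltW.
- rewrite /J ifN //; apply: hdl; rewrite addrC addKr nrmZ.
  have h0 := cabs_ge0 s; have : cabs s < dl / (nrm v + 1) by lra.
  by rewrite ltr_pdivlMr //; lra.
- by rewrite cabs1; lra.
Qed.

End InjectiveOpen.

(** * Hartogs phenomenon in two variables *)

(** Connectedness of [[0, 1]] as an induction principle, by the supremum of the [t] such that [P]
    holds on all of [[0, t]]. *)
Lemma segment_ind (R : realType) (P : R -> Prop) : P 0 ->
  (forall t, 0 <= t <= 1 -> exists2 r, 0 < r & forall t1 t2, 0 <= t1 <= 1 -> 0 <= t2 <= 1 ->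
     `|t1 - t| < r -> `|t2 - t| < r -> P t1 -> P t2) -> P 1.
Proof.
move=> P0 step.
pose S := [set t | 0 <= t <= 1 /\ forall s, 0 <= s <= t -> P s].
have S0 : S 0.
  split=> [|s /andP[s0 s1]]; first by rewrite lexx ler01.
  by rewrite (_ : s = 0) //; apply/eqP; rewrite eq_le s1.
have Sb : has_sup S by split; [exists 0|exists 1 => t [/andP[]]].
pose x := sup S.
have x0 : 0 <= x by apply: ub_le_sup S0; case: Sb.
have x1 : x <= 1 by apply: ge_sup; [exists 0|move=> t [/andP[]]].
have [|r r0 hr] := step x; first by rewrite x0.
have [t [/andP[t0 t1] Pt] xt] := sup_adherent r0 Sb; rewrite -/x in xt.
have tx : t <= x by apply: ub_le_sup; [case: Sb|split=> //; rewrite t0].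
have tr : `|t - x| < r by rewrite ltr_norml; apply/andP; split; lra.
have Ptt : P t by apply: Pt; rewrite t0 lexx.
have Pnear s : 0 <= s <= 1 -> `|s - x| < r -> P s.
  by move=> s1 sr; apply: hr Ptt; rewrite // t0.
have [x1'|x1'] := lerP (x + r / 2) 1; last first.
  by apply: Pnear; rewrite ?lexx ?ler01 // ltr_norml; apply/andP; split; lra.
have : S (x + r / 2).
  split=> [|s /andP[s0 s1]]; first by apply/andP; split; lra.
  have [st|st] := lerP s t; first by apply: Pt; rewrite s0.
  by apply: Pnear; [apply/andP; split; lra|rewrite ltr_norml; apply/andP; split; lra].
move=> /(ub_le_sup _) -/(_ Sb.2); rewrite -/x; lra.
Qed.

(** * Primitive roots of unity of order a power of 2 *)

Section RootsOfUnity.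
Set Implicit Arguments.
Unset Strict Implicit.
Variable R : realType.

(** Iterated square roots are enough here; this is why the numbers of nodes below are powers of
    2. *)
Lemma exists_root_m1 k : exists z : R[i], z ^+ (2 ^ k) = -1.
Proof.
elim: k => [|k [z zk]]; first by exists (-1); rewrite expr1.
by exists (sqrtc z); rewrite expnS exprM sqr_sqrtc.
Qed.

Lemma prim_root_m1 k (z : R[i]) : z ^+ (2 ^ k) = -1 -> (2 ^ k.+1).-primitive_root z.
Proof.
move=> zk; have z1 : z ^+ (2 ^ k.+1) = 1 by rewrite expnSr exprM zk sqrrN expr1n.
have n0 : (0 < 2 ^ k.+1)%N by rewrite expn_gt0.
have [m zm /(dvdn_pfactor _ _ (isT : prime 2))[j jk mj]] := prim_order_exists n0 z1.
have [jk'|jk'] := leqP j k; last first.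
  by rewrite (_ : k.+1 = j) -?mj //; apply/eqP; rewrite eqn_leq jk jk'.
have : z ^+ (2 ^ k) = 1.
  by apply/eqP; rewrite -(prim_order_dvd zm) mj dvdn_exp2l.
rewrite zk => /eqP; rewrite -subr_eq0 -opprD oppr_eq0 -[1 + 1]/(2%:R) pnatr_eq0 //.
Qed.

End RootsOfUnity.

Section Hartogs.
Set Implicit Arguments.
Unset Strict Implicit.
(** In the application [H x w] is a coordinate of [f] at the point with last coordinate [w] and all
    others [x], and [Dom x w] says that this point lies in the slit polydisk. *)
Variables (R : realType) (H : R[i] -> R[i] -> R[i]) (Dom : R[i] -> R[i] -> Prop).
Variables (r : R).
Hypotheses (r0 : 0 < r) (r1 : r < 1).
Hypothesis Dom_open : forall x w, Dom x w -> exists2 d : R, 0 < d &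
  forall x' w', cabs (x' - x) < d -> cabs (w' - w) < d -> Dom x' w'.
Hypothesis H_line : forall a b c d t, Dom (a + t * b) (c + t * d) ->
  cdiff (fun s => H (a + s * b) (c + s * d)) t.
Hypothesis H_le1 : forall x w, Dom x w -> cabs (H x w) <= 1.
Hypothesis Dom_w : forall x w, cabs x < 1 -> r < cabs w < 1 -> Dom x w.
Hypothesis Dom_x : forall x w, r < cabs x < 1 -> cabs w < 1 -> Dom x w.

(** The nodes lie on the circle of radius [r'], halfway between [r] and 1. The larger radius [r2],
    halfway between [r'] and 1, provides the ratio [r' / r2] for geometric convergence. *)
Let r' := (1 + r) / 2.
Let r2 := (3 + r) / 4.
Let rr' : r < r'. Proof. by rewrite /r'; have := r1; lra. Qed.
Let r'r2 : r' < r2. Proof. by rewrite /r' /r2; have := r1; lra. Qed.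
Let r21 : r2 < 1. Proof. by rewrite /r2; have := r1; lra. Qed.
Let r'0 : 0 < r'. Proof. exact: lt_trans rr'. Qed.
Let r'1 : r' < 1. Proof. exact: lt_trans r21. Qed.

Let om k : R[i] := sval (cid (exists_root_m1 R k)).
Let omP k : (2 ^ k.+1).-primitive_root (om k).
Proof. exact: prim_root_m1 (svalP (cid (exists_root_m1 R k))). Qed.
Let omV k : (2 ^ k.+1).-primitive_root (om k)^-1.
Proof.
apply: prim_root_m1; rewrite exprVn (svalP (cid (exists_root_m1 R k))).
by rewrite invrN invr1.
Qed.
Let N k := (2 ^ k.+1)%N.
Let N0 k : (0 < N k)%N. Proof. by rewrite expn_gt0. Qed.
Let om1 k : cabs (om k) = 1. Proof. exact: cabs_prim_root (N0 k) (omP k). Qed.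

Let node k j : R[i] := om k ^+ j * r'%:C.
Let cabs_node k j : cabs (node k j) = r'.
Proof. by rewrite /node cabsM cabsX om1 expr1n mul1r cabs_real gtr0_norm. Qed.
Let nodeB k j x : cabs x <= r -> r' - r <= cabs (node k j - x).
Proof. by move=> xr; have := cabs_dist_ge (node k j) x; rewrite cabs_node; lra. Qed.
Let node_neq k j x : cabs x <= r -> node k j - x != 0.
Proof. by move=> /(nodeB k j) h; rewrite -cabs_gt0; have := rr'; lra. Qed.

(** Riemann sums of the Cauchy integral over [|zeta| = r'], for the constant 1 and for [H]. The
    error compares with [kern * H] instead of [H], so that its terms are
    [zeta (H zeta w - H x w) / (zeta - x)], where the pole cancels as soon as the slice is
    holomorphic. *)
Let kern k x := (N k)%:R^-1 * \sum_(j < N k) node k j / (node k j - x).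
Let cauchy k x w := (N k)%:R^-1 * \sum_(j < N k) H (node k j) w * (node k j / (node k j - x)).
Let err k x w := cauchy k x w - kern k x * H x w.

Let cabs_mean k (F : 'I_(N k) -> R[i]) (M : R) : (forall j, cabs (F j) <= M) ->
  cabs ((N k)%:R^-1 * \sum_(j < N k) F j) <= M.
Proof.
move=> FM; rewrite cabsM cabsV cabs_nat mulrC ler_pdivrMr ?ltr0n // mulrC.
apply: le_trans _ (ler_sum_const FM).
elim/big_ind2: _ => [|x1 x2 y1 y2 h2 h3|j _] //; first by rewrite cabs0.
by apply: le_trans (cabsD _ _) (lerD h2 h3).
Qed.

Let B := r' / (r' - r).
Let B0 : 0 < B. Proof. by rewrite divr_gt0 // subr_gt0. Qed.

Let cabs_wt k j x : cabs x <= r -> cabs (node k j / (node k j - x)) <= B.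
Proof.
move=> xr; rewrite cabsM cabsV cabs_node ler_pM2l // lef_pV2 ?posrE ?subr_gt0 //.
  exact: nodeB.
by rewrite cabs_gt0 node_neq.
Qed.

Let Dom_node k j w : cabs w < 1 -> Dom (node k j) w.
Proof. by move=> w1; apply: Dom_x => //; rewrite cabs_node rr' r'1. Qed.

Let err_bound k x w : cabs x <= r -> cabs w < 1 -> Dom x w -> cabs (err k x w) <= 2 * B.
Proof.
move=> xr w1 xw; apply: le_trans (cabsB _ _) _.
have h1 : cabs (cauchy k x w) <= B.
  apply: cabs_mean => j; rewrite cabsM -[B]mul1r; apply: ler_pM; rewrite ?cabs_ge0 ?cabs_wt //.
  exact/H_le1/Dom_node.
have h2 : cabs (kern k x) * cabs (H x w) <= B * 1.
  apply: ler_pM; rewrite ?cabs_ge0 ?H_le1 //; apply: cabs_mean => j; exact: cabs_wt.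
rewrite (cabsM (kern k x) (H x w)); lra.
Qed.

Let cauchy_cdiff k a b c d t : cabs (a + t * b) <= r -> cabs (c + t * d) < 1 ->
  cdiff (fun s => cauchy k (a + s * b) (c + s * d)) t.
Proof.
move=> xr w1; apply: cdiffM (cdiff_cst _ _) _; apply: cdiff_sum => j _.
apply: cdiffM.
  apply: (@cdiff_near _ (fun s => H (node k j + s * 0) (c + s * d)) _ _ 1 ltr01).
    by move=> z _; rewrite mulr0 addr0.
  by apply: H_line; rewrite mulr0 addr0; exact: Dom_node.
apply: cdiff_div; first exact: node_neq.
  exact: cdiff_cst.
by apply: cdiffB (cdiff_cst _ _) _; exact: cdiff_aff.
Qed.

Let err_cdiff k a b c d t : cabs (a + t * b) <= r -> cabs (c + t * d) < 1 ->
  Dom (a + t * b) (c + t * d) -> cdiff (fun s => err k (a + s * b) (c + s * d)) t.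
Proof.
move=> xr w1 xw; apply: cdiffB; first exact: cauchy_cdiff.
apply: cdiffM; last exact: H_line.
apply: cdiffM (cdiff_cst _ _) _; apply: cdiff_sum => j _.
apply: cdiff_div; first exact: node_neq.
  exact: cdiff_cst.
by apply: cdiffB (cdiff_cst _ _) _; exact: cdiff_aff.
Qed.

Let th := r' / r2.
Let th0 : 0 <= th. Proof. by rewrite divr_ge0 // ltW // (lt_trans r'0). Qed.
Let th1 : th < 1. Proof. by rewrite ltr_pdivrMr ?mul1r // (lt_trans r'0). Qed.

(** For [|w| > r] the slice is the whole disc, so the error is the mean over roots of unity of the
    holomorphic function [chi z = z q z], which vanishes at 0. *)
Let err_outer k x w : cabs x <= r -> r < cabs w < 1 ->
  cabs (err k x w) <= 2 * (2 / (r2 - r)) * th ^+ N k.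
Proof.
move=> xr w1; have [_ w11] := andP w1.
have Hd z : cabs z < 1 -> cdiff (H^~ w) z.
  move=> z1; apply: (@cdiff_near _ (fun s => H (0 + s * 1) (w + s * 0)) _ _ 1 ltr01).
    by move=> s _; rewrite mulr1 mulr0 add0r addr0.
  by apply: H_line; rewrite mulr1 mulr0 add0r addr0; exact: Dom_w.
have x1 : cabs x < 1 by have := r1; lra.
have [q [qE qc]] := (cdiffP (H^~ w) x).1 (Hd x x1).
have qd z : cabs z < 1 -> cdiff q z.
  have qd' y : cabs y < 1 -> y != x -> cdiff q y.
    move=> y1 yx; apply: (@cdiff_near _ (fun s => (H s w - H x w) / (s - x)) _ _ (cabs (y - x))).
    - by rewrite cabs_gt0 subr_eq0.
    - move=> s sy; rewrite qE addrC addKr mulfK // subr_eq0.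
      by apply: contraTneq sy => ->; rewrite cabs_distC ltxx.
    - apply: cdiff_div; first by rewrite subr_eq0.
        exact: cdiffB (Hd _ y1) (cdiff_cst _ _).
      exact: cdiffB (cdiff_id _) (cdiff_cst _ _).
  move=> z1; have [->|] := eqVneq z x; last exact: qd'.
  apply: (@removable _ _ _ (1 - cabs x)) => //; first by rewrite subr_gt0.
  move=> y yx; apply: qd'; have := cabsD (y - x) x; rewrite subrK; lra.
pose chi z := z * q z.
have chid z : cabs z < 1 -> cdiff chi z.
  by move=> z1; apply: cdiffM (cdiff_id _) (qd _ z1).
have r20 : 0 < r2 by exact: lt_trans r'r2.
have r2r : 0 < r2 - r by rewrite subr_gt0 (lt_trans rr').
have chiM z : cabs z <= r2 -> cabs (chi z) <= 2 / (r2 - r).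
  move=> zr; apply: (@max_disc _ chi 0 r2) => //.
  - by rewrite divr_ge0 // ltW.
  - by move=> y; rewrite subr0 => yr; apply: chid; exact: le_lt_trans r21.
  - move=> y; rewrite subr0 => yr.
    have yx : r2 - r <= cabs (y - x) by have := cabs_dist_ge y x; lra.
    have yxp : 0 < cabs (y - x) by exact: lt_le_trans yx.
    have y1 : cabs y < 1 by rewrite yr.
    have -> : chi y = y * ((H y w - H x w) / (y - x)).
      by rewrite /chi qE addrC addKr mulfK // -cabs_gt0.
    rewrite cabsM yr -[leRHS]mul1r; apply: ler_pM; rewrite ?cabs_ge0 ?(ltW r20) ?(ltW r21) //.
    rewrite cabsM cabsV; apply: ler_pM; rewrite ?invr_ge0 ?cabs_ge0 //.
      apply: le_trans (cabsB _ _) _.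
      have := H_le1 (Dom_w y1 w1); have := H_le1 (Dom_w x1 w1); lra.
    by rewrite lef_pV2 ?posrE.
  - by rewrite subr0.
have r'c : cabs r'%:C = r' by rewrite cabs_real gtr0_norm.
have r'r2' : cabs (r'%:C : R[i]) <= r2 by rewrite r'c ltW.
have := @mean_roots R chi (N k) (om k) r2 1 _ (N0 k) (omP k) r20 r21 chid chiM _ r'r2'.
rewrite r'c {2}/chi mul0r subr0; congr (cabs _ <= _).
rewrite /err /cauchy /kern -mulrA -mulrBr; congr (_ * _).
rewrite big_distrl /= -sumrB; apply: eq_bigr => j _.
rewrite -/(node k j) /chi.
have nx : node k j - x != 0 by exact: node_neq.
have -> : q (node k j) = (H (node k j) w - H x w) / (node k j - x).
  by rewrite qE addrC addKr mulfK.
by field.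
Qed.

Let pow_small (t C e : R) : 0 <= t < 1 -> 0 <= C -> 0 < e ->
  exists K : nat, forall k, (K <= k)%N -> C * t ^+ N k <= e.
Proof.
move=> /andP[t0 t1] C0 e0; have [->|tn0] := eqVneq t 0.
  by exists 0%N => k _; rewrite expr0n (gtn_eqF (N0 k)) mulr0 ltW.
have tp : 0 < t by rewrite lt_def tn0.
have tV : 0 < t^-1 - 1 by rewrite subr_gt0 -[ltLHS]invr1 ltf_pV2 ?posrE.
have bern m : 1 + m%:R * (t^-1 - 1) <= (t^-1) ^+ m.
  elim: m => [|m ih]; first by rewrite mul0r addr0 expr0.
  have p0 : 0 <= t^-1 by rewrite invr_ge0.
  have := ler_wpM2l p0 ih; rewrite -exprS -natr1.
  have : 0 <= m%:R * ((t^-1 - 1) * (t^-1 - 1)) by rewrite !mulr_ge0 // ltW.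
  by move: (t^-1) => u; lra.
have [K hK] := exists_invS_lt (divr_gt0 e0 (ltr_wpDl (divr_ge0 C0 (ltW tV)) ltr01)).
exists K => k Kk.
have kN : (k.+1 <= N k)%N by apply: leq_trans (ltn_expl k.+1 (isT : 1 < 2)%N).
have h1 : k.+1%:R * (t^-1 - 1) <= (t^-1) ^+ N k.
  apply: le_trans (bern (N k)); rewrite ler_wpDl // ler_wpM2r ?ler_nat // ltW //.
have h2 : 0 < k.+1%:R * (t^-1 - 1) by rewrite mulr_gt0 // ltr0n.
have h3 : t ^+ N k <= (k.+1%:R * (t^-1 - 1))^-1.
  by rewrite -[leLHS]invrK -exprVn lef_pV2 ?posrE ?exprn_gt0 ?invr_gt0.
apply: le_trans (ler_wpM2l C0 h3) _; rewrite invfM.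
have := hK k Kk; rewrite ltr_pdivlMr; last by rewrite ltr_wpDl // divr_ge0 // ltW.
have h4 : 0 < (k.+1%:R : R)^-1 by rewrite invr_gt0 ltr0n.
by move: h4; move: (k.+1%:R^-1) ((t^-1 - 1)^-1) => u v u0 h; lra.
Qed.

Let thN (C e : R) : 0 <= C -> 0 < e -> exists K : nat, forall k, (K <= k)%N -> C * th ^+ N k <= e.
Proof. by apply: pow_small; rewrite th0 th1. Qed.

(** After division by the node, the kernel is the mean of [1 / (1 - y z)] over the inverse roots of
    unity, with [y = x / r']; the value at 0 is 1. *)
Let kern_lim x : cabs x <= r -> forall e : R, 0 < e -> exists K : nat,
  forall k, (K <= k)%N -> cabs (kern k x - 1) <= e.
Proof.
move=> xr e e0.
pose y := x / r'%:C.
have r'c : cabs r'%:C = r' by rewrite cabs_real gtr0_norm.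
have r'n : r'%:C != 0 :> R[i] by rewrite -cabs_gt0 r'c.
have yr : cabs y <= r / r' by rewrite cabsM cabsV r'c ler_pM2r ?invr_gt0.
pose R1 := r' / r; pose R2 := (1 + R1) / 2.
have R11 : 1 < R1 by rewrite ltr_pdivlMr // mul1r.
have R21 : 1 < R2 by rewrite /R2; lra.
have R2R1 : R2 < R1 by rewrite /R2; lra.
have R20 : 0 < R2 by lra.
have yRR : r / r' * R1 = 1 by rewrite /R1; field; rewrite !gt_eqF.
have yz z : cabs z < R1 -> cabs (y * z) < 1.
  move=> zR; rewrite cabsM -yRR; apply: le_lt_trans (ler_wpM2r (cabs_ge0 _) yr) _.
  by rewrite ltr_pM2l // divr_gt0.
have nz z : cabs z < R1 -> 1 - y * z != 0.
  move=> /yz; apply: contraTneq => /eqP; rewrite subr_eq0 => /eqP <-.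
  by rewrite cabs1 ltxx.
pose phi z := (1 - y * z)^-1.
have phid z : cabs z < R1 -> cdiff phi z.
  move=> zR; apply: cdiffV; first exact: nz.
  exact: cdiffB (cdiff_cst _ _) (cdiffM (cdiff_cst _ _) (cdiff_id _)).
pose q := r / r' * R2.
have q1 : q < 1 by rewrite -yRR ltr_pM2l // divr_gt0.
have phiM z : cabs z <= R2 -> cabs (phi z) <= (1 - q)^-1.
  move=> zR; have zR1 := le_lt_trans zR R2R1.
  rewrite cabsV lef_pV2 ?posrE ?cabs_gt0 ?nz ?subr_gt0 //.
  have := cabs_dist_ge 1 (y * z); rewrite cabs1; apply: le_trans.
  rewrite lerD2l lerN2 cabsM; apply: ler_pM; rewrite ?cabs_ge0 //.
have c1 : cabs (1 : R[i]) <= R2 by rewrite cabs1 ltW.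
have C0 : 0 <= 2 * (1 - q)^-1 by rewrite mulr_ge0 // invr_ge0 subr_ge0 ltW.
have R2V : 0 <= 1 / R2 < 1 by rewrite divr_ge0 ?(ltW R20) //= ltr_pdivrMr // mul1r.
have [K hK] := pow_small R2V C0 e0; exists K => k Kk.
apply: le_trans (hK k Kk).
have := @mean_roots R phi (N k) (om k)^-1 R2 R1 _ (N0 k) (omV k) R20 R2R1 phid phiM 1 c1.
rewrite cabs1 {2}/phi mulr0 subr0 invr1; congr (cabs (_ * _ - _) <= _).
apply: eq_bigr => j _; rewrite mulr1 /phi /y.
have on : om k ^+ j != 0 by rewrite expf_neq0 // -cabs_gt0 om1.
have nn := node_neq k j xr.
rewrite /node in nn *; rewrite exprVn; field.
by rewrite on r'n nn.
Qed.

(** * Propagation of a small error through the hole of the slit *)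

Let good x w := exists2 dl : R, 0 < dl & forall kap : R, 0 < kap -> exists K : nat,
  forall k x' w', (K <= k)%N -> cabs (x' - x) < dl -> cabs (w' - w) < dl ->
    cabs (err k x' w') <= kap.

Let inner x w := [/\ Dom x w, cabs x < r & cabs w < 1].

(** On the complex line from [(x1, w1)] at [s = 0] to a point near [(x, w)] at [s = 1], the error is
    bounded by [2 B] for [|s| <= 2] and tiny for small [s]; the three circles theorem makes it small
    at 1. *)
Let good_step x w x1 w1 (rho : R) : 0 < rho ->
  (forall x' w', cabs (x' - x) < rho -> cabs (w' - w) < rho -> inner x' w') ->
  cabs (x1 - x) < rho / 8 -> cabs (w1 - w) < rho / 8 -> good x1 w1 -> good x w.
Proof.
move=> rho0 inn xx ww [dl dl0 hdl]; exists (rho / 8) => [|kap kap0].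
  by rewrite divr_gt0.
pose dl' := Num.min 1 (dl / rho).
have dl'0 : 0 < dl' by rewrite lt_min ltr01 divr_gt0.
have dl'1 : dl' <= 1 by rewrite ge_min lexx.
have dl'r : dl' * rho <= dl by rewrite -ler_pdivlMr // ge_min lexx orbT.
(* The exponent [m] makes the contribution [2 B / 2^m] of the outer circle at most [kap]. The
   smallness requested near [(x1, w1)] is then [kap dl'^m], which the inner circle turns into
   [kap]. *)
have [m mk] : exists m : nat, 2 * B / 2 ^+ m <= kap.
  have B2 : 0 < 2 * B by rewrite mulr_gt0.
  have [K hK] := exists_invS_lt (divr_gt0 kap0 B2).
  exists K; rewrite mulrC -ler_pdivlMr // ltW //; apply: le_lt_trans (hK K (leqnn _)).
  by rewrite lef_pV2 ?posrE ?ltr0n ?exprn_gt0 // -natrX ler_nat ltn_expl.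
have eps0 : 0 < kap * dl' ^+ m by rewrite mulr_gt0 // exprn_gt0.
have [K hK] := hdl _ eps0; exists K => k x' w' Kk xx' ww'.
pose b := x' - x1; pose d := w' - w1.
have b4 : cabs b <= rho / 4.
  by have := cabs_triangle x' x x1; rewrite (cabs_distC x) -/b; lra.
have d4 : cabs d <= rho / 4.
  by have := cabs_triangle w' w w1; rewrite (cabs_distC w) -/d; lra.
have line s : cabs s <= 2 -> inner (x1 + s * b) (w1 + s * d).
  move=> s2; apply: inn.
    rewrite addrAC; apply: le_lt_trans (cabsD _ _) _; rewrite cabsM.
    have : cabs s * cabs b <= 2 * (rho / 4) by apply: ler_pM; rewrite ?cabs_ge0.
    lra.
  rewrite addrAC; apply: le_lt_trans (cabsD _ _) _; rewrite cabsM.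
  have : cabs s * cabs d <= 2 * (rho / 4) by apply: ler_pM; rewrite ?cabs_ge0.
  lra.
have := @three_circles R (fun s => err k (x1 + s * b) (w1 + s * d)) dl' (2 * B) (kap * dl' ^+ m) m.
rewrite dl'0 dl'1 mulfK ?expf_neq0 ?gt_eqF // !mul1r.
rewrite (_ : x1 + b = x'); last by rewrite /b addrC subrK.
rewrite (_ : w1 + d = w'); last by rewrite /d addrC subrK.
rewrite (max_idPr mk); apply=> //.
- by move=> s /line[h1 h2 h3]; apply: err_cdiff => //; exact: ltW.
- by move=> s /line[h1 h2 h3]; apply: err_bound => //; exact: ltW.
- move=> s sdl; apply: hK => //; rewrite addrC addKr cabsM.
    have : cabs s * cabs b <= dl' * (rho / 4) by apply: ler_pM; rewrite ?cabs_ge0.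
    lra.
  have : cabs s * cabs d <= dl' * (rho / 4) by apply: ler_pM; rewrite ?cabs_ge0.
  lra.
Qed.

Let inner_open x w : inner x w -> exists2 rho : R, 0 < rho &
  forall x' w', cabs (x' - x) < rho -> cabs (w' - w) < rho -> inner x' w'.
Proof.
move=> [/Dom_open[d d0 hd] xr w1].
exists (Num.min d (Num.min (r - cabs x) (1 - cabs w))).
  by rewrite !lt_min d0 !subr_gt0 xr.
move=> x' w'; rewrite !lt_min => /and3P[x1 x2 x3] /and3P[w1' w2 w3]; split.
- exact: hd.
- by have := cabsD (x' - x) x; rewrite subrK; lra.
- by have := cabsD (w' - w) w; rewrite subrK; lra.
Qed.

Let good_segment a b c d :
  (forall t : R, 0 <= t <= 1 -> inner (a + t%:C * b) (c + t%:C * d)) ->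
  good a c -> good (a + b) (c + d).
Proof.
move=> inn gac.
suff : good (a + 1%:C * b) (c + 1%:C * d) by rewrite !mul1r.
apply: (@segment_ind R (fun t => good (a + t%:C * b) (c + t%:C * d))).
  by rewrite !mul0r !addr0.
move=> t /inn/inner_open[rho rho0 hrho].
pose L := cabs b + cabs d + 1.
have L0 : 0 < L by rewrite ltr_wpDl ?addr_ge0 ?cabs_ge0.
have near (t1 t2 : R) (y z : R[i]) (e : R) : cabs z <= L -> `|t1 - t2| * L < e ->
    cabs (y + t1%:C * z - (y + t2%:C * z)) < e.
  move=> zL h; rewrite opprD addrACA subrr add0r -mulrBl -rmorphB cabsM cabs_real.
  by apply: le_lt_trans h; rewrite ler_wpM2l.
have bL : cabs b <= L by rewrite /L; have := cabs_ge0 d; lra.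
have dL : cabs d <= L by rewrite /L; have := cabs_ge0 b; lra.
exists (rho / 64 / L) => [|t1 t2 _ _]; first by rewrite !divr_gt0.
rewrite !ltr_pdivlMr // => h1 h2.
have h12 : `|t1 - t2| * L < rho / 16.
  have : `|t1 - t2| <= `|t1 - t| + `|t2 - t|.
    by rewrite -[t1 - t2](subrKA t) (le_trans (ler_normD _ _)) // [X in _ + X]distrC.
  by move=> /(ler_wpM2r (ltW L0)); lra.
apply: (@good_step _ _ _ _ (rho / 2)).
- by rewrite divr_gt0.
- move=> x' w' hx hw; apply: hrho.
    have := cabs_triangle x' (a + t2%:C * b) (a + t%:C * b).
    have := near t2 t a b (rho / 2) bL; lra.
  have := cabs_triangle w' (c + t2%:C * d) (c + t%:C * d).
  have := near t2 t c d (rho / 2) dL; lra.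
- by apply: near; rewrite //; lra.
- by apply: near; rewrite //; lra.
Qed.

Variable w0 : R.
Hypothesis w0r : - r <= w0 <= 0.
Hypothesis Dom_axis : forall t : R, w0 <= t <= (1 + r) / 2 -> Dom 0 t%:C.
Hypothesis Dom_disc : forall x, cabs x < r -> Dom x w0%:C.

(** The path starts at [(0, r')], where the outer estimate holds, descends the axis to [(0, w0)] and
    follows a radius to [(x, w0)]. So [H] is the limit of Cauchy sums on the disc; they depend on
    [x] only through the kernel, which gives the constant. *)
Lemma hartogs_lip x x' : cabs x < r -> cabs x' < r ->
  cabs (H x w0%:C - H x' w0%:C) <= r' / (r' - r) ^+ 2 * cabs (x - x').
Proof.
have w0n : `|w0| < 1 by rewrite ltr_norml; have := r1; have := r0; move: w0r => /andP[]; lra.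
have w0c : cabs (w0%:C : R[i]) < 1 by rewrite cabs_real.
have start : good 0 r'%:C.
  (* Both [r' - r] and [1 - r'] are [(1 - r) / 2], so [w] stays in the annulus [r < |w| < 1]. *)
  exists (Num.min r ((1 - r) / 2)) => [|kap kap0].
    by rewrite lt_min r0 divr_gt0 // subr_gt0.
  have r2r : 0 < r2 - r by rewrite subr_gt0 (lt_trans rr').
  have C0 : 0 <= 2 * (2 / (r2 - r)) by rewrite !mulr_ge0 // invr_ge0 ltW.
  have [K hK] := thN C0 kap0; exists K => k y w Kk.
  rewrite !lt_min subr0 => /andP[y1 _] /andP[_ w1].
  apply: le_trans (err_outer _ _ _) (hK k Kk); first exact: ltW.
  have r'c : cabs r'%:C = r' by rewrite cabs_real gtr0_norm.
  have := cabsD (w - r'%:C) r'%:C; have := cabs_dist_ge r'%:C w.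
  rewrite subrK (cabs_distC _ w) r'c /r' => h1 h2; apply/andP; split; rewrite /r' in w1; lra.
have mid : good 0 w0%:C.
  have wE : r'%:C + (w0 - r')%:C = w0%:C :> R[i] by rewrite -rmorphD addrC subrK.
  have := @good_segment 0 0 r'%:C (w0 - r')%:C _ start.
  rewrite addr0 wE; apply=> t /andP[t0 t1].
  rewrite mulr0 addr0 -rmorphM -rmorphD /=.
  have h : w0 <= r' + t * (w0 - r') <= r'.
    have wr : 0 <= r' - w0 by have := r'0; move: w0r => /andP[]; lra.
    have := mulr_ge0 t0 wr; have := ler_wpM2r wr t1; move=> h1 h2.
    by apply/andP; split; lra.
  split; [exact: Dom_axis|by rewrite cabs0|].
  rewrite cabs_real ltr_norml; have /andP[h1 h2] := h; have /andP[h3 h4] := w0r.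
  by have a1 := r'1; have a2 := r1; apply/andP; split; lra.
have fin y : cabs y < r -> good y w0%:C.
  move=> yr; have := @good_segment 0 y w0%:C 0 _ mid.
  rewrite add0r addr0; apply=> t /andP[t0 t1]; rewrite mulr0 addr0 add0r.
  have ty : cabs (t%:C * y) < r.
    rewrite cabsM cabs_real ger0_norm //; apply: le_lt_trans yr.
    by rewrite ler_piMl ?cabs_ge0.
  by split=> //; exact: Dom_disc.
have approx y : cabs y < r -> forall e : R, 0 < e -> exists K : nat, forall k, (K <= k)%N ->
    cabs (H y w0%:C - cauchy k y w0%:C) <= e.
  move=> yr e e0; have e2 : 0 < e / 2 by rewrite divr_gt0.
  have [dl dl0 hdl] := fin y yr; have [K1 h1] := hdl _ e2.
  have [K2 h2] := kern_lim (ltW yr) e2.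
  exists (maxn K1 K2) => k; rewrite geq_max => /andP[k1 k2].
  have := h1 k y w0%:C k1; rewrite !subrr cabs0 => /(_ dl0 dl0); rewrite /err => h3.
  have {}h2 := h2 k k2; have h4 := H_le1 (Dom_disc yr).
  rewrite (_ : _ - _ = - (cauchy k y w0%:C - kern k y * H y w0%:C) - (kern k y - 1) * H y w0%:C); last by ring.
  apply: le_trans (cabsB _ _) _; rewrite cabsN cabsM.
  have : cabs (kern k y - 1) * cabs (H y w0%:C) <= e / 2 * 1.
    by apply: ler_pM; rewrite ?cabs_ge0.
  lra.
move=> xr xr'; apply/ler_addgt0Pr => e e0; have e2 : 0 < e / 2 by rewrite divr_gt0.
have [K1 h1] := approx x xr _ e2; have [K2 h2] := approx x' xr' _ e2.
pose k := maxn K1 K2; have {}h1 := h1 k (leq_maxl _ _); have {}h2 := h2 k (leq_maxr _ _).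
have h3 : cabs (cauchy k x w0%:C - cauchy k x' w0%:C) <= r' / (r' - r) ^+ 2 * cabs (x - x').
  rewrite -mulrBr -sumrB; apply: cabs_mean => j.
  have n1 := node_neq k j (ltW xr); have n2 := node_neq k j (ltW xr').
  rewrite (_ : _ - _ = H (node k j) w0%:C * (node k j * ((x - x') * ((node k j - x)^-1 * (node k j - x')^-1)))); last first.
    by field; rewrite n1 n2.
  rewrite (cabsM (H _ _)) (cabsM (node k j)) (cabsM (x - x')) (cabsM (node k j - x)^-1).
  rewrite !cabsV cabs_node.
  have p0 : 0 < r' - r by rewrite subr_gt0.
  apply: le_trans (_ : 1 * (r' * (cabs (x - x') * ((r' - r)^-1 * (r' - r)^-1))) <= _); last first.
    by rewrite le_eqVlt; apply/orP; left; apply/eqP; field; rewrite gt_eqF.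
  have pv y : cabs y < r -> (cabs (node k j - y))^-1 <= (r' - r)^-1.
    move=> yr; rewrite lef_pV2 ?posrE ?cabs_gt0 ?nodeB ?node_neq // ltW //.
  apply: ler_pM; first exact: cabs_ge0.
  - by rewrite mulr_ge0 ?(ltW r'0) // mulr_ge0 ?cabs_ge0 // mulr_ge0 // invr_ge0 cabs_ge0.
  - by apply/H_le1/Dom_node.
  rewrite ler_pM2l //; apply: ler_wpM2l; first exact: cabs_ge0.
  by apply: ler_pM; rewrite ?invr_ge0 ?cabs_ge0 ?pv.
rewrite (_ : H x _ - H x' _ = (H x w0%:C - cauchy k x w0%:C) - (H x' w0%:C - cauchy k x' w0%:C)
  + (cauchy k x w0%:C - cauchy k x' w0%:C)); last by ring.
apply: le_trans (cabsD _ _) _; apply: le_trans (lerD (cabsB _ _) (lexx _)) _; lra.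
Qed.

End Hartogs.

(** * Bridging with the definitions *)

(** Measurability of the squeezing function along a circle is not established, so the estimate is
    made on the positive part, through the simple functions below it. *)
Lemma integral_le_cst (R : realType) (a b : R) (f : R -> \bar R) (k : R) : a <= b -> 0 <= k ->
  (forall t, a <= t <= b -> (f t <= k%:E)%E) ->
  (\int[@lebesgue_measure R]_(t in `[a, b]%classic) f t <= (k * (b - a))%:E)%E.
Proof.
move=> ab k0 fk.
pose mu := @lebesgue_measure R.
have mD : measurable `[a, b]%classic by exact: measurable_itv.
have -> : (k * (b - a))%:E = (\int[mu]_(t in `[a, b]%classic) (cst k%:E) t)%E.
  rewrite integral_cst // [X in (_ * X)%E](@lebesgue_measure_itv R `[a, b]) /=.
  have [ab'|ba] := ltP a b; first by rewrite lte_fin ab'.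
  have -> : b = a by apply/eqP; rewrite eq_le ab ba.
  by rewrite lte_fin ltxx subrr mulr0 mule0.
rewrite integralE -[leRHS]sube0; apply: leeB; last first.
  by apply: integral_ge0 => x _; exact: funeneg_ge0.
rewrite !ge0_integralE; last 2 first.
- by move=> x _; rewrite lee_fin.
- by move=> x _; exact: funepos_ge0.
apply: ereal_sup_le => _ [h /= hf <-]; exists h => //= x; apply: le_trans (hf x) _.
rewrite /patch; case: ifPn => // /set_mem /=; rewrite in_itv /= => /fk fx.
by rewrite funeposE ge_max fx lee_fin.
Qed.

Section Interface.
Set Implicit Arguments.
Unset Strict Implicit.
Variables (R : realType) (n : nat).
Local Notation V := 'rV[R[i]]_n.

(** The topology comes from the maximum norm with values in [R[i]], whereas [nrm] is the real sum of
    the moduli; the factor [n.+1] compares them and is nonzero for every [n]. *)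
Lemma nbhs_nrm (z : V) (S : set V) : nbhs z S <->
  exists2 d : R, 0 < d & forall w, nrm (w - z) < d -> S w.
Proof.
split=> [/nbhs_ballP[e /=]|[d d0 hd]].
  rewrite ltcE => /andP[/eqP /= e2 e1] eS; exists (Re e) => // w wz; apply: eS.
  have eE : e = (Re e)%:C by case: e e1 e2 wz => a b /= _ ->.
  split; first by rewrite eE ltcR.
  move=> i j; rewrite /ball /= normCE eE ltcR ord1 cabs_distC.
  by apply: le_lt_trans wz; have := cabs_le_nrm (w - z) j; rewrite !mxE.
apply/nbhs_ballP; exists (d / n.+1%:R)%:C; first by rewrite /= ltcR divr_gt0 // ltr0n.
move=> w [_ wz]; apply: hd; apply: le_lt_trans (nrm_le (e := d / n.+1%:R) _) _.
  move=> i; have := wz 0 i; rewrite /ball /= normCE ltcR cabs_distC !mxE.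
  exact: ltW.
by rewrite mulrA ltr_pdivrMr ?ltr0n // mulrC ltr_pM2l // ltr_nat.
Qed.

Lemma mx_norm_ge (v : V) j : (cabs (v 0 j))%:C <= `|v|.
Proof.
rewrite -normCE [leRHS]/Num.norm /= mx_normE -[leLHS]nngE num_le.
exact: (@le_bigmax _ _ _ _ _ (0, j)).
Qed.

Lemma mx_norm_le (v : V) : `|v| <= (nrm v)%:C.
Proof.
have [->|v0] := eqVneq `|v| 0; first by rewrite lecR nrm_ge0.
have [[i j] /= vij] := mx_norm_neq0 v0.
by rewrite [leLHS]vij ord1 normCE lecR cabs_le_nrm.
Qed.

Lemma differentiable_frechet (f : V -> V) z : differentiable f z -> exists A, is_frechet f z A.
Proof.
move=> fz; exists (lin1_mx ('d f z)) => e e0.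
have e1 : 0 < e / n.+1%:R by rewrite divr_gt0 // ltr0n.
have := diff_locally fz => /eqaddoP /(_ (e / n.+1%:R)%:C); rewrite ltcR => /(_ e1).
move=> /nbhs_nrm [d d0 hd]; exists d => // h hh.
have := hd h; rewrite subr0 => /(_ hh) hle.
have -> : f (z + h) - f z - h *m lin1_mx ('d f z) = ((f \o shift z) - (cst (f z) + 'd f z)) h.
  by rewrite mul_rV_lin1 !fctE /= opprD addrA (addrC z).
set v := (X in nrm X).
apply: le_trans (nrm_le (e := e / n.+1%:R * nrm h) _) _ => [j|].
  rewrite -lecR rmorphM; apply: le_trans (mx_norm_ge v j) _; apply: le_trans hle _.
  by rewrite ler_wpM2l ?mx_norm_le // ltW // ltcR.
rewrite mulrA ler_wpM2r ?nrm_ge0 // mulrCA ler_piMr ?(ltW e0) //.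
by rewrite ler_pdivrMr ?ltr0n // mul1r ler_nat.
Qed.

Lemma polydisk_open (r : R) (z : V) : polydisk n r z ->
  exists2 d : R, 0 < d & forall w, nrm (w - z) < d -> polydisk n r w.
Proof.
move=> zr.
have [d d0 hd] : exists2 d : R, 0 < d & forall i, cabs (z 0 i) + d <= r.
  pose m := \big[Num.min/1]_i (r - cabs (z 0 i)).
  exists m.
    rewrite /m; elim/big_ind: _ => [|x y x0 y0|i _] //; first by rewrite lt_min x0.
    by rewrite subr_gt0 -ltcR -normCE; exact: zr.
  move=> i; rewrite addrC -lerBrDr /m (bigD1 i) //=.
  by rewrite ge_min lexx.
exists d => // w wz i; rewrite normCE ltcR.
have := cabs_le_nrm (w - z) i; rewrite !mxE.
have := cabsD (w 0 i - z 0 i) (z 0 i); rewrite subrK.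
by have := hd i; lra.
Qed.

Lemma boundaryP (r : R) (z : V) : 0 < r -> boundary (polydisk n r) z <->
  (forall i, cabs (z 0 i) <= r) /\ exists i, cabs (z 0 i) = r.
Proof.
move=> r0; split=> [[zc zi]|[zr [i zir]]].
  have zr i : cabs (z 0 i) <= r.
    apply/ler_addgt0Pr => e e0.
    have [|w [wr wz]] := zc [set w | nrm (w - z) < e]; first by apply/nbhs_nrm; exists e.
    have := wr i; rewrite normCE ltcR => h.
    have := cabs_le_nrm (w - z) i; rewrite !mxE => h1.
    have := cabs_dist_ge (z 0 i) (w 0 i); rewrite cabs_distC => h2.
    by move: wz => /= h3; lra.
  split=> //; apply: contrapT => nr; apply: zi; apply/nbhs_nrm; apply: polydisk_open.
  move=> i; rewrite normCE ltcR lt_neqAle zr andbT.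
  by apply/eqP => h; apply: nr; exists i.
split.
  move=> S /nbhs_nrm[d d0 hd].
  (* The contraction of [z] by [1 - s] is in the open polydisk and within [d] of [z]. *)
  pose s := Num.min (1 / 2) (d / 2 / (nrm z + 1)).
  have z1 : 0 < nrm z + 1 by rewrite ltr_wpDl ?nrm_ge0.
  have s0 : 0 < s by rewrite lt_min !divr_gt0.
  have s1 : s <= 1 / 2 by rewrite ge_min lexx.
  have sd : s * (nrm z + 1) <= d / 2 by rewrite -ler_pdivlMr // ge_min lexx orbT.
  exists ((1 - s)%:C *: z); split.
    move=> k; rewrite normCE ltcR mxE cabsM cabs_real ger0_norm; last by lra.
    have := zr k; rewrite le_eqVlt => /orP[/eqP ->|h].
      by rewrite gtr_pMl //; lra.
    by apply: le_lt_trans h; rewrite ler_piMl ?cabs_ge0 //; lra.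
  apply: hd; rewrite (_ : _ - z = (- s%:C) *: z); last first.
    by apply/rowP => k; rewrite !mxE rmorphB rmorph1 /=; ring.
  rewrite nrmZ cabsN cabs_real gtr0_norm //; lra.
move=> /interior_subset/(_ i); rewrite normCE ltcR zir ltxx //.
Qed.

End Interface.

(** * The slit polydisk *)

Section Slit.
Set Implicit Arguments.
Unset Strict Implicit.
Variables (R : realType) (m : nat) (r eps : R).
Hypotheses (r0 : 0 < r) (r1 : r < 1) (eps0 : 0 < eps).
Local Notation n := m.+2.
Local Notation V := 'rV[R[i]]_n.
Local Notation D := (slit_polydisk n r eps).

(** The diagonal plane, which reduces the problem to two variables for every [n]: on it the slit
    depends only on [|x|] and [w]. *)
Definition emb (x w : R[i]) : V := \row_(i < n) (if i.+1 == n then w else x).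

Lemma emb_max x w : emb x w 0 ord_max = w.
Proof. by rewrite mxE eqxx. Qed.

Lemma emb_0 x w : emb x w 0 0 = x.
Proof. by rewrite mxE. Qed.

Lemma emb_cases (P : R[i] -> Prop) x w : (forall i, P (emb x w 0 i)) <-> P x /\ P w.
Proof.
split=> [h|[Px Pw] i]; last by rewrite mxE; case: ifP.
by split; [rewrite -(emb_0 x w)|rewrite -(emb_max x w)]; exact: h.
Qed.

Lemma emb_line a b c d (s : R[i]) : emb (a + s * b) (c + s * d) = emb a c + s *: emb b d.
Proof. by apply/rowP => i; rewrite !mxE; case: ifP. Qed.

Definition sqdist (z : V) : R := \sum_i cabs (z 0 i - Q n r 0 i) ^+ 2.

Lemma sqdist_split z : sqdist z =
  \sum_(i < m.+1) cabs (z 0 (widen_ord (leqnSn m.+1) i)) ^+ 2 + cabs (z 0 ord_max - r%:C) ^+ 2.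
Proof.
rewrite /sqdist big_ord_recr /= !mxE eqxx; congr (_ + _).
by apply: eq_bigr => i _; rewrite mxE /= eqSS ltn_eqF ?subr0 // ltnS ltn_ord.
Qed.

Lemma sqdist_emb x w : sqdist (emb x w) = m.+1%:R * cabs x ^+ 2 + cabs (w - r%:C) ^+ 2.
Proof.
rewrite sqdist_split emb_max; congr (_ + _).
rewrite (eq_bigr (fun=> cabs x ^+ 2)) => [|i _].
  by rewrite sumr_const card_ord mulr_natl.
by rewrite mxE /= eqSS ltn_eqF // ltnS ltn_ord.
Qed.

Lemma euclidean_ballP z : euclidean_ball (Q n r) eps z <-> sqdist z < eps ^+ 2.
Proof.
rewrite /euclidean_ball /= -/(sqdist z) -{1}(ger0_norm (ltW eps0)) -sqrtr_sqr ltr_sqrt //.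
by rewrite exprn_gt0.
Qed.

Lemma slitP z : slit_set n r eps z <->
  [/\ forall i, cabs (z 0 i) <= r, exists i, cabs (z 0 i) = r & eps ^+ 2 <= sqdist z].
Proof.
split=> [[/(boundaryP _ r0)[h1 h2] h3]|[h1 h2 h3]].
  by split=> //; rewrite leNgt; apply/negP => /euclidean_ballP.
split; first by apply/(boundaryP _ r0).
by move=> /euclidean_ballP; rewrite ltNge h3.
Qed.

Lemma slit_emb x w : slit_set n r eps (emb x w) <->
  [/\ cabs x <= r, cabs w <= r, cabs x = r \/ cabs w = r &
    eps ^+ 2 <= m.+1%:R * cabs x ^+ 2 + cabs (w - r%:C) ^+ 2].
Proof.
have cases := emb_cases (fun y => cabs y <= r) x w.
rewrite slitP sqdist_emb; split=> [[/cases[h1 h2] [i hi] h3]|[h1 h2 h3 h4]]; split=> //.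
- by move: hi; rewrite mxE; case: ifP => _; [right|left].
- exact/cases.
- by case: h3 => h; [exists 0; rewrite emb_0|exists ord_max; rewrite emb_max].
Qed.

Lemma polydisk_emb (s : R) x w : polydisk n s (emb x w) <-> cabs x < s /\ cabs w < s.
Proof.
rewrite -(emb_cases (fun y => cabs y < s)).
by split=> h i; have := h i; rewrite normCE ltcR.
Qed.

Lemma sqdist_cont z : tends (fun w => nrm (w - z)) (fun w => (sqdist w)%:C) (sqdist z)%:C.
Proof.
have E (w : V) : (sqdist w)%:C =
    \sum_i ((cabs (w 0 i - Q n r 0 i))%:C * (cabs (w 0 i - Q n r 0 i))%:C) :> R[i].
  by rewrite rmorph_sum; apply: eq_bigr => i _; rewrite -rmorphM.
rewrite E; suff h : tends (fun w => nrm (w - z))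
    (fun w : V => \sum_i ((cabs (w 0 i - Q n r 0 i))%:C * (cabs (w 0 i - Q n r 0 i))%:C))
    (\sum_i ((cabs (z 0 i - Q n r 0 i))%:C * (cabs (z 0 i - Q n r 0 i))%:C)).
  by move=> e /h[d d0 hd]; exists d => // w /hd; rewrite E.
apply: tends_sum => i.
have h : tends (fun w => nrm (w - z)) (fun w : V => (cabs (w 0 i - Q n r 0 i))%:C) (cabs (z 0 i - Q n r 0 i))%:C.
  set q := Q n r 0 i => e e0; exists e => // w wz; rewrite -rmorphB cabs_real ltr_norml.
  have := cabs_le_nrm (w - z) i; rewrite !mxE => h1.
  have := cabs_triangle (w 0 i) (z 0 i) q; have := cabs_triangle (z 0 i) (w 0 i) q.
  by rewrite (cabs_distC (z 0 i) (w 0 i)) => h2 h3; apply/andP; split; lra.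
exact: tendsM.
Qed.

(** A point off the slit has a coordinate beyond [r], or all coordinates below [r], or lies in the
    hole; each condition is open. *)
Lemma slit_polydisk_open z : D z ->
  exists2 d : R, 0 < d & forall w, nrm (w - z) < d -> D w.
Proof.
move=> [z1 zA]; have [d1 d10 h1] := polydisk_open z1.
suff [d2 d20 h2] : exists2 d : R, 0 < d & forall w, nrm (w - z) < d -> ~ slit_set n r eps w.
  exists (Num.min d1 d2); first by rewrite lt_min d10.
  by move=> w; rewrite lt_min => /andP[/h1 ? /h2].
have [zr|] := pselect (forall i, cabs (z 0 i) <= r); last first.
  move=> /existsNP[i /negP]; rewrite -ltNge => zi.
  exists (cabs (z 0 i) - r); first by rewrite subr_gt0.
  move=> w wz /slitP[/(_ i) h _ _].
  have := cabs_le_nrm (w - z) i; rewrite !mxE cabs_distC.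
  by have := cabs_dist_ge (z 0 i) (w 0 i); lra.
have [zir|zir] := pselect (exists i, cabs (z 0 i) = r); last first.
  have [|d d0 hd] := @polydisk_open R n r z.
    move=> i; rewrite normCE ltcR lt_neqAle zr andbT.
    by apply/eqP => h; apply: zir; exists i.
  exists d => // w /hd h /slitP[_ [i hi] _].
  by have := h i; rewrite normCE ltcR hi ltxx.
have ze : sqdist z < eps ^+ 2.
  by rewrite ltNge; apply/negP => h; apply: zA; apply/slitP.
have e0 : 0 < eps ^+ 2 - sqdist z by rewrite subr_gt0.
have [d d0 hd] := @sqdist_cont z _ e0; exists d => // w /hd h /slitP[_ _ h1'].
by move: h; rewrite -rmorphB cabs_real ltr_norml => /andP[_]; lra.
Qed.

Lemma slit_outer_x x w : r < cabs x < 1 -> cabs w < 1 -> D (emb x w).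
Proof.
move=> /andP[x1 x2] w1; split; first by apply/polydisk_emb.
by move=> /slit_emb[h _ _ _]; move: x1; rewrite ltNge h.
Qed.

Lemma slit_outer_w x w : cabs x < 1 -> r < cabs w < 1 -> D (emb x w).
Proof.
move=> x1 /andP[w1 w2]; split; first by apply/polydisk_emb.
by move=> /slit_emb[_ h _ _]; move: w1; rewrite ltNge h.
Qed.

Lemma nrm_emb x w : nrm (emb x w) <= n%:R * (cabs x + cabs w).
Proof.
apply: nrm_le => i; have := cabs_ge0 x; have := cabs_ge0 w.
by rewrite mxE; case: ifP => _; lra.
Qed.

(** A difference of the kernel is [zeta (x - x') / ((zeta - x) (zeta - x'))], bounded for
    [|zeta| = r'] and [|x|, |x'| < r] by [r' / (r' - r)^2] times [|x - x'|], where
    [r' = (1 + r) / 2]. *)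
Definition lip_const := (1 + r) / 2 / ((1 + r) / 2 - r) ^+ 2.

Lemma lip_const_gt0 : 0 < lip_const.
Proof. by rewrite /lip_const divr_gt0 ?exprn_gt0 //; have := r1; have := r0; lra. Qed.

Variable w0 : R.
Hypothesis w0r : - r <= w0 <= 0.
Hypothesis Dom_axis : forall t : R, w0 <= t <= (1 + r) / 2 -> D (emb 0 t%:C).
Hypothesis Dom_disc : forall x, cabs x < r -> D (emb x w0%:C).
Hypothesis torus_slit : forall x, cabs x = r -> slit_set n r eps (emb x w0%:C).

Lemma disc_lip (f : V -> V) x x' i : holomorphic_on D f -> f @` D `<=` polydisk n 1 ->
  cabs x < r -> cabs x' < r ->
  cabs (f (emb x w0%:C) 0 i - f (emb x' w0%:C) 0 i) <= lip_const * cabs (x - x').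
Proof.
move=> fD f1 xr xr'.
apply: (@hartogs_lip R (fun x w => f (emb x w) 0 i) (fun x w => D (emb x w)) r) => //.
- move=> y w /slit_polydisk_open[d d0 hd]; exists (d / 2 / n%:R).
    by rewrite !divr_gt0 // ltr0n.
  move=> y' w' hy hw; apply: hd.
  have -> : emb y' w' - emb y w = emb (y' - y) (w' - w).
    by apply/rowP => k; rewrite !mxE; case: ifP.
  apply: le_lt_trans (nrm_emb _ _) _; rewrite mulrC -ltr_pdivlMr ?ltr0n //.
  by rewrite (_ : d / n%:R = d / 2 / n%:R + d / 2 / n%:R); [exact: ltrD|field].
- move=> a b c d t /fD/differentiable_frechet[A]; rewrite emb_line => fA.
  exists ((emb b d *m A) 0 i).
  have := frechet_line_cdiff i fA; under eq_fun do rewrite -emb_line; exact.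
- move=> y w /(imageP f)/f1/(_ i); rewrite normCE ltcR; exact: ltW.
- exact: slit_outer_w.
- exact: slit_outer_x.
Qed.

Lemma squeezing_disc_le (x : R[i]) : 0 < cabs x < r ->
  (squeezing D (emb x w0%:C) <= (lip_const * (r - cabs x))%:E)%E.
Proof.
move=> /andP[x0 xr]; apply: ge_ereal_sup => _ [t [f [fD finj f1 fz ft]] <-].
rewrite lee_fin leNgt; apply/negP => kt.
set rho := cabs x in x0 xr kt; pose kap := lip_const * (r - rho).
have L0 := lip_const_gt0.
(* Radii strictly between [rho] and [r], already for [k = 0], tending to [r]; [y k] has this modulus
   on the ray through [x], which is why [x] is nonzero. *)
pose s (k : nat) := r - (r - rho) / k.+2%:R.
have kV (k : nat) : 0 < (r - rho) / k.+2%:R < r - rho.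
  rewrite divr_gt0 ?ltr0n ?subr_gt0 //= ltr_pdivrMr ?ltr0n //.
  by rewrite ltr_pMr ?subr_gt0 // ltr1n.
have sr k : rho < s k < r by have := kV k; rewrite /s; move: (_ / k.+2%:R) => u /andP[h1 h2]; apply/andP; split; lra.
pose y k : R[i] := (s k / rho)%:C * x.
have ys k : cabs (y k) = s k.
  have /andP[h1 _] := sr k.
  by rewrite cabsM cabs_real gtr0_norm ?divr_gt0 // ?(lt_trans x0) // divfK // gt_eqF.
have yx k : cabs (y k - x) = s k - rho.
  have /andP[h1 _] := sr k.
  rewrite (_ : y k - x = ((s k - rho) / rho)%:C * x).
    by rewrite cabsM cabs_real gtr0_norm ?divr_gt0 ?subr_gt0 // divfK // gt_eqF.
  rewrite /y (_ : (s k - rho) / rho = s k / rho - 1); last first.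
    by field; rewrite gt_eqF.
  by rewrite rmorphB /=; ring.
pose p k := f (emb (y k) w0%:C).
have pk k i : cabs (p k 0 i) <= kap.
  have /andP[h1 h2] := sr k.
  have := @disc_lip f (y k) x i fD f1; rewrite ys -/rho fz mxE subr0 yx => /(_ h2 xr).
  by move/le_trans; apply; rewrite ler_pM2l // lerD2r ltW.
have [|w1 hw1] := @bounded_cluster R n p (n%:R * kap).
  by move=> k; apply: nrm_le => i; exact: pk.
have w1t : polydisk n t w1.
  move=> i; rewrite normCE ltcR; apply: le_lt_trans kt.
  apply/ler_addgt0Pr => e e0; have [k _ hk] := hw1 e e0 0%N.
  have := cabs_le_nrm (p k - w1) i; rewrite !mxE => h1.
  have := cabs_dist_ge (w1 0 i) (p k 0 i); rewrite cabs_distC.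
  by have := pk k i; rewrite -/kap; lra.
have [b bD fb] := ft _ w1t.
(* The torus point to which the points with parameter [y k] converge. It lies in the slit, so it
   differs from [b]. *)
pose a := emb ((r / rho)%:C * x) w0%:C.
have aA : slit_set n r eps a.
  by apply: torus_slit; rewrite cabsM cabs_real gtr0_norm ?divr_gt0 // divfK // gt_eqF.
have ab : 0 < nrm (a - b).
  rewrite lt_def nrm_ge0 andbT; apply/eqP => /nrm0_eq0/eqP; rewrite subr_eq0 => /eqP abE.
  by case: bD => _; rewrite -abE.
have /choice[Df hDf] : forall z, exists A, D z -> is_frechet f z A.
  move=> z; have [/fD/differentiable_frechet[A fA]|nz] := pselect (D z); first by exists A.
  by exists 0.
have [d1 d10 hd1] := slit_polydisk_open bD.
(* A preimage within [d] of [b] is less than half of [nrm (a - b)] away from [b]. By injectivity it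
   is also a point of the sequence, and for large [k] that point is less than half of [nrm (a - b)]
   away from [a]. *)
pose d := Num.min d1 (nrm (a - b) / 2).
have d0 : 0 < d by rewrite lt_min d10 divr_gt0.
have dP z : nrm (z - b) < d -> D z /\ nrm (z - b) < nrm (a - b) / 2.
  by rewrite lt_min => /andP[/hd1].
have d2 : 0 < d / 2 < d by rewrite divr_gt0 //=; lra.
have [||eta eta0 heta] := @injective_open R n f Df b d (d / 2) d2.
- by move=> z /dP[zD _]; exact: hDf.
- by move=> z z' /dP[zD _] /dP[zD' _] h; apply: finj; rewrite ?inE.
rewrite fb in heta.
have n0 : 0 < n%:R * (r - rho) by rewrite mulr_gt0 ?ltr0n // subr_gt0.
have [N hN] := exists_invS_lt (divr_gt0 (divr_gt0 ab (ltr0n _ 2)) n0).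
have [k Nk hk] := hw1 eta eta0 N.
have [z' z'b fz'] := heta _ hk.
have z'd : nrm (z' - b) < d by case/andP: d2 => _; exact: lt_trans.
have [z'D z'ab] := dP _ z'd.
have ykD : D (emb (y k) w0%:C) by apply: Dom_disc; rewrite ys; case/andP: (sr k).
have zE : z' = emb (y k) w0%:C by apply: finj; rewrite ?inE.
have h1 : nrm (a - z') < nrm (a - b) / 2.
  rewrite zE (_ : a - _ = emb ((r / rho)%:C * x - y k) 0); last first.
    by apply/rowP => j; rewrite !mxE; case: ifP => // _; rewrite subrr.
  apply: le_lt_trans (nrm_emb _ _) _; rewrite cabs0 addr0.
  rewrite (_ : _ - y k = ((r - s k) / rho)%:C * x); last first.
    rewrite /y (_ : (r - s k) / rho = r / rho - s k / rho); last by ring.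
    by rewrite rmorphB /=; ring.
  have /andP[_ h2] := sr k.
  rewrite cabsM cabs_real gtr0_norm ?divr_gt0 ?subr_gt0 // divfK ?gt_eqF //.
  have -> : r - s k = (r - rho) / k.+2%:R by rewrite /s; ring.
  have := hN k Nk; rewrite ltr_pdivlMr //; apply: le_lt_trans.
  rewrite mulrA mulrC ler_pM2r // lef_pV2 ?posrE ?ltr0n // ler_nat //.
have := nrm_triangle a z' b; lra.
Qed.

End Slit.

Lemma squeezing_gt0 (R : realType) n (D : set 'rV[R[i]]_n) (z : 'rV[R[i]]_n) (d : R) :
  0 < d -> (forall w, nrm (w - z) < d -> D w) -> D `<=` polydisk n 1 ->
  exists2 t : R, 0 < t & (t%:E <= squeezing D z)%E.
Proof.
move=> d0 zD D1; exists (d / 2 / n.+1%:R); first by rewrite !divr_gt0 // ltr0n.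
have two0 : (2 : R[i]) != 0 by rewrite pnatr_eq0.
apply: ereal_sup_ubound; exists (d / 2 / n.+1%:R) => //.
(* Coordinates of [w] and [z] have modulus below 1, so half of their difference stays in the unit
   polydisk. *)
exists (fun w => 2^-1 *: (w - z)); split.
- move=> w _; by apply: differentiableZ; apply: differentiableB.
- move=> w w' _ _ /(scalerI (invr_neq0 two0)) /addIr //.
- have z1 : polydisk n 1 z by apply/D1/zD; rewrite subrr nrm0.
  move=> _ [w wD <-] i; have := D1 _ wD i; have := z1 i.
  rewrite !normCE !ltcR !mxE cabsM cabsV cabs_nat => h1 h2.
  have := cabsB (w 0 i) (z 0 i); lra.
- by rewrite subrr scaler0.
- move=> u ut; exists (z + 2 *: u); last by rewrite addrAC subrr add0r scalerK.
  apply: zD; rewrite addrAC subrr add0r nrmZ cabs_nat mulrC -ltr_pdivlMr //.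
  apply: le_lt_trans (nrm_le (e := d / 2 / n.+1%:R) _) _.
    by move=> i; have := ut i; rewrite normCE ltcR; exact: ltW.
  rewrite mulrA ltr_pdivrMr ?ltr0n // mulrC ltr_pM2l ?divr_gt0 // ltr_nat //.
Qed.

Theorem theorem4p5 (R : realType) (n : nat) (r eps : R) (hn : (2 <= n)%N)
    (hr0 : 0 < r) (hr1 : r < 1) (heps : 0 < eps)
    (hball : euclidean_ball (Q n r) eps `<=` polydisk n 1)
    (hA : slit_set n r eps !=set0) :
  ~ plurisubharmonic_on (slit_polydisk n r eps)
      (squeezing (slit_polydisk n r eps)).
Proof.
case: n hn hball hA => [|[|m]] // _ _ [z0 /(slitP hr0 heps)[z0r _ z0e]].
set D := slit_polydisk _ _ _.
move=> [_ _ Dsub].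
(* The given slit point is outside the ball, while its coordinates are at most [r]: this bounds
   [eps] by the largest distance from [Q] on the closed polydisk of radius [r]. *)
have eps_le : eps ^+ 2 <= m.+1%:R * r ^+ 2 + 4 * r ^+ 2.
  apply: le_trans z0e _; rewrite sqdist_split; apply: lerD.
    apply: ler_sum_const => i; rewrite lerXn2r ?nnegrE ?cabs_ge0 ?(ltW hr0) //.
  have -> : 4 * r ^+ 2 = (2 * r) ^+ 2 by ring.
  rewrite lerXn2r ?nnegrE ?cabs_ge0 ?mulr_ge0 ?(ltW hr0) //.
  have := cabsB (z0 0 ord_max) r%:C; rewrite cabs_real gtr0_norm //.
  by have := z0r ord_max; lra.
(* [b] is the squared distance from [w0] to [r]. The second entry puts the torus outside the ball,
   the first makes [w0 <= 0]. *)
pose b := Num.max (r ^+ 2) (eps ^+ 2 - m.+1%:R * r ^+ 2).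
have b_ge : r ^+ 2 <= b by rewrite le_max lexx.
have b_ge' : eps ^+ 2 - m.+1%:R * r ^+ 2 <= b by rewrite le_max lexx orbT.
have r2 : 0 < r ^+ 2 by rewrite exprn_gt0.
have b_le : b <= 4 * r ^+ 2 by rewrite ge_max; apply/andP; split; lra.
have b0 : 0 <= b by lra.
pose w0 := r - Num.sqrt b.
have sqr_w0 : (w0 - r) ^+ 2 = b.
  by rewrite /w0 addrAC subrr add0r sqrrN sqr_sqrtr.
have w0r : - r <= w0 <= 0.
  have h1 : r <= Num.sqrt b by rewrite -[leLHS](gtr0_norm hr0) -sqrtr_sqr ler_wsqrtr.
  have h2 : Num.sqrt b <= 2 * r.
    have r20 : 0 <= 2 * r by rewrite mulr_ge0 // ltW.
    rewrite -[leRHS](ger0_norm r20) -sqrtr_sqr ler_wsqrtr // exprMn.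
    by rewrite (_ : 2 ^+ 2 = 4 :> R) //; ring.
  by rewrite /w0; apply/andP; split; lra.
have /andP[w0_ge w0_le] := w0r.
have w0abs : cabs (w0%:C : R[i]) <= r by rewrite cabs_real ler_norml; apply/andP; split; lra.
have dist_w0 : cabs (w0%:C - r%:C : R[i]) ^+ 2 = b.
  by rewrite -rmorphB cabs_real real_normK ?num_real.
have torus x : cabs x = r -> slit_set m.+2 r eps (emb m x w0%:C).
  move=> xr; apply/(slit_emb m hr0 heps); rewrite xr dist_w0; split=> //; first by left.
  by lra.
have disc x : cabs x < r -> D (emb m x w0%:C).
  move=> xr; split; first by apply/polydisk_emb; split; lra.
  move=> /(slit_emb m hr0 heps)[_ _ h he].
  have {h} w0E : cabs (w0%:C : R[i]) = r.
    by case: h => // h; move: xr; rewrite h ltxx.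
  have w0m : w0 = - r.
    by move: w0E; rewrite cabs_real ler0_norm // => <-; rewrite opprK.
  have bE : b = 4 * r ^+ 2 by rewrite -sqr_w0 w0m; ring.
  (* As [b = 4 r^2] exceeds [r^2], the maximum is the second entry. The torus is then at distance
     exactly [eps], and smaller [|x|] means being in the hole. *)
  have bE' : b = eps ^+ 2 - m.+1%:R * r ^+ 2.
    apply/max_idPr; rewrite leNgt; apply/negP => h.
    by move: bE; rewrite /b (max_idPl (ltW h)); lra.
  rewrite dist_w0 in he.
  have : m.+1%:R * cabs x ^+ 2 < m.+1%:R * r ^+ 2.
    by rewrite ltr_pM2l ?ltr0n // ltrXn2r ?nnegrE ?cabs_ge0 // ltW.
  lra.
have axis t : w0 <= t <= (1 + r) / 2 -> D (emb m 0 t%:C).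
  move=> /andP[t1 t2]; split.
    apply/polydisk_emb; rewrite cabs0 ltr01 cabs_real ltr_norml; split=> //.
    by apply/andP; split; lra.
  move=> slit_t; move: (slit_t) => /(slit_emb m hr0 heps)[_ _ [h|h] he].
    by move: hr0; rewrite -h cabs0 ltxx.
  move: h; rewrite cabs_real => h.
  have [tE|tE] : t = r \/ t = - r.
    by case: (ler0P t) h => _ h; [right|left]; lra.
  (* At [t = r] the axis meets the centre [Q] of the hole. The value [t = -r] occurs only as the end
     point [w0 = -r], the centre of the disc. *)
  - move: he; rewrite tE subrr cabs0 !expr0n /= mulr0 addr0.
    by rewrite leNgt exprn_gt0.
  - have [|_] := disc 0; first by rewrite cabs0.
    by apply; rewrite (_ : w0 = t) //; lra.
have D1 : D `<=` polydisk m.+2 1 by move=> z [].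
have cD : D (emb m 0 w0%:C) by apply: disc; rewrite cabs0.
have [d d0 hd] := slit_polydisk_open hr0 heps cD.
have [t t0 ht] := @squeezing_gt0 R m.+2 D _ d d0 hd D1.
have L0 := lip_const_gt0 hr0 hr1.
(* So close to [r] that [L (r - rho) <= t / 2], half of the lower bound at the centre; the entry
   [r / 2] keeps the circle nondegenerate. *)
pose rho := Num.max (r / 2) (r - t / 2 / lip_const r).
have rho0 : 0 < rho by rewrite lt_max divr_gt0.
have tL : 0 < t / 2 / lip_const r by apply: divr_gt0 => //; exact: divr_gt0.
have rhor : rho < r by rewrite gt_max; apply/andP; split; lra.
pose k := lip_const r * (r - rho).
have k0 : 0 <= k by rewrite mulr_ge0 ?(ltW L0) // subr_ge0 ltW.
have kt : k < t.
  have : r - rho <= t / 2 / lip_const r.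
    have : r - t / 2 / lip_const r <= rho by rewrite le_max lexx orbT.
    lra.
  rewrite ler_pdivlMr // mulrC -/k; lra.
(* The disc is the slice of [D] used for subharmonicity, in the direction [emb m 1 0], which leaves
   the last coordinate fixed. *)
have lineE x : emb m 0 w0%:C + x *: emb m 1 0 = emb m x w0%:C.
  by rewrite -emb_line mulr1 mulr0 add0r addr0.
have [_ _ /(_ 0 rho rho0)] := Dsub (emb m 0 w0%:C) (emb m 1 0).
rewrite scale0r addr0 => mean.
have : (squeezing D (emb m 0%R w0%:C) <= k%:E)%E.
  apply: le_trans (mean _) _.
    move=> x /=; rewrite subr0 normCE lecR lineE => xr.
    by apply: disc; exact: le_lt_trans rhor.
  have pi2 : 0 < 2 * pi :> R by rewrite mulr_gt0 // pi_gt0.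
  have -> : k%:E = ((2 * pi)^-1%:E * (k * (2 * pi - 0))%:E)%E :> \bar R.
    by rewrite -EFinM subr0; congr EFin; rewrite mulrCA mulVf ?mulr1 // gt_eqF.
  apply: lee_wpmul2l; first by rewrite lee_fin invr_ge0 ltW.
  apply: integral_le_cst => //; first exact: ltW.
  move=> s _; rewrite lineE.
  have cs : cabs (circle_point 0 rho s) = rho.
    rewrite /circle_point add0r cabsM cabs_real gtr0_norm // -[RHS]mulr1; congr (_ * _).
    apply/eqP; rewrite -(@eqrXn2 _ 2) ?cabs_ge0 ?ler01 // cabs_sqr /= cos2Dsin2.
    by rewrite expr1n.
  have := @squeezing_disc_le R m r eps hr0 hr1 heps w0 w0r axis disc torus (circle_point 0 rho s).
  by rewrite cs rho0 rhor; apply.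
move/(le_trans ht); rewrite lee_fin leNgt kt //.
Qed.
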